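(* Let $(M,\tau)$ be a tracial von Neumann algebra and suppose $(x_i)_{i\in I}\subset M_{s.a.}$ is a tuple of self-adjoint elements admitting a conjugate system. Let $J\subsetneq I$ be any non-empty proper subset. Then: (1) the inclusion $W^*(x_j: j\in J)\leq W^*(x_i: i\in I)$ has infinite index and is non-regular; (2) if $A\leq W^*(x_i: i\in I)$ is an abelian von Neumann subalgebra such that the intersection $A\cap W^*(x_j: j\in J)$ is diffuse, then $A$ is not regular in $W^*(x_i: i\in I)$; (3) if $|J|\geq 2$, then the inclusion $W^*(x_j: j\in J)\leq W^*(x_i: i\in I)$ is also irreducible.
   Context: A tracial von Neumann algebra $(M,\tau)$ is a von Neumann algebra with a faithful normal tracial state $\tau$. $M_{s.a.}=\{x\in M: x=x^*\}$. $W^*(\cdot)$ denotes the (unital) von Neumann subalgebra of $M$ generated by the given elements; subalgebras are unital. Conjugate system: let $\mathbb{C}\langle t_i: i\in I\rangle$ be the algebra of non-commutative polynomials and let $\partial_i\colon \mathbb{C}\langle t_k: k\in I\rangle\to \mathbb{C}\langle t_k: k\in I\rangle\otimes\mathbb{C}\langle t_k: k\in I\rangle$ be the free difference quotient, i.e. the unique derivation (for the bimodule structure $a\cdot(b\otimes c)\cdot d=ab\otimes cd$) with $\partial_i(t_k)=\delta_{i=k}\,1\otimes 1$. The tuple $(x_i)_{i\in I}$ admits a conjugate system if there exist vectors $\xi_i\in L^2(W^*(x_k: k\in I),\tau)$, $i\in I$, such that for all $i\in I$ and all $p\in\mathbb{C}\langle t_k: k\in I\rangle$, \[ \langle p(x),\xi_i\rangle_\tau=(\tau\otimes\tau)\big((\partial_i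 p)(x)\big), \] where $p(x)$ and $(\partial_i p)(x)$ denote evaluation at $t_k=x_k$ (in both tensor factors in the latter case) and the inner product is linear in its first entry. For an inclusion $Q\leq N$ of von Neumann algebras with faithful normal tracial state $\tau$ on $N$: it has infinite index if $\dim_Q L^2(N,\tau)=\infty$, where $\dim_Q$ is the von Neumann dimension of $L^2(N,\tau)$ as a $Q$-module with respect to $\tau|_Q$; it is regular (or $Q$ is regular in $N$) if $\mathcal{N}_N(Q)''=N$, where $\mathcal{N}_N(Q)=\{u\in N \text{ unitary}: uQu^*=Q\}$, and non-regular otherwise; it is irreducible if $Q'\cap N=\mathbb{C}$. A von Neumann algebra is diffuse if it has no minimal projections. *)

(* Defs.v *)
From HB Require Import structures.
From mathcomp Require Import all_boot all_order all_algebra.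
From mathcomp Require Import finmap.
From mathcomp.real_closed Require Import complex.
From mathcomp.multinomials Require Import monalg.
From mathcomp Require Import all_classical all_reals all_analysis.

Set Implicit Arguments.
Unset Strict Implicit.
Unset Printing Implicit Defensive.

Import Order.TTheory GRing.Theory Num.Theory.
Import numFieldNormedType.Exports.
Local Open Scope ring_scope.
Local Open Scope classical_set_scope.

Section FreeAlgebra.
Variables (C : comNzRingType) (I : choiceType).

(* C<t_i : i in I> is the monoid algebra of the free monoid on I, and its
   tensor square is the free module on pairs of words, the pair (u, v) standing
   for the tensor of u and v. *)
Notation ncpoly := {malg C[{fmonom I}]}.
Notation ncpoly2 := {malg C[({fmonom I} * {fmonom I})%type]}.

Definition lin_ext (K : choiceType) (V : lmodType C) (f : K -> V)
    (g : {malg C[K]}) : V :=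
  \sum_(k <- msupp g) g@_k *: f k.

Section LinExt.
Variables (K : choiceType) (V : lmodType C).
Implicit Types (f : K -> V) (g h : {malg C[K]}).

Lemma lin_extEw f g (d : {fset K}) : (msupp g `<=` d)%fset ->
  lin_ext f g = \sum_(k <- d) g@_k *: f k.
Proof.
move=> gd; rewrite /lin_ext (big_fset_incl _ gd)//= => k _.
by rewrite -mcoeff_eq0 => /eqP ->; rewrite scale0r.
Qed.

Lemma lin_ext_linear f : linear (lin_ext f).
Proof.
move=> a g h.
pose d := (msupp g `|` msupp h `|` msupp (a *: g + h))%fset.
have gd : (msupp g `<=` d)%fset by rewrite /d -fsetUA fsubsetUl.
have hd : (msupp h `<=` d)%fset by rewrite /d fsubsetU// fsubsetUr.
have ghd : (msupp (a *: g + h) `<=` d)%fset by rewrite /d fsubsetUr.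
rewrite (lin_extEw f gd) (lin_extEw f hd) (lin_extEw f ghd) scaler_sumr -big_split/=.
by apply: eq_bigr => k _; rewrite mcoeffD mcoeffZ scalerDl scalerA.
Qed.

HB.instance Definition _ f :=
  GRing.isLinear.Build C {malg C[K]} V _ (lin_ext f) (lin_ext_linear f).

Lemma lin_extU f k : lin_ext f << k >> = f k.
Proof.
rewrite (lin_extEw f (d := [fset k]%fset)) ?big_seq_fset1 ?mcoeffUU ?scale1r//.
exact: msuppU_le.
Qed.

Lemma malgUZ (c : C) (k : K) : << c *g k >> = c *: << k >> :> {malg C[K]}.
Proof.
by apply/malgP => l; rewrite !mcoeffsE; case: eqP; rewrite ?mulr1 ?mulr0.
Qed.

End LinExt.

(* The bimodule structure of the tensor square: a . (b ** c) = ab ** c and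
   (b ** c) . d = b ** cd. *)
Definition lact (a : ncpoly) (T : ncpoly2) : ncpoly2 :=
  lin_ext (fun u => lin_ext (fun s : {fmonom I} * {fmonom I} => << (mmul u s.1, s.2) >>) T) a.

Definition ract (T : ncpoly2) (b : ncpoly) : ncpoly2 :=
  lin_ext (fun v => lin_ext (fun s : {fmonom I} * {fmonom I} => << (s.1, mmul s.2 v) >>) T) b.

(* The i-th free difference quotient: a word w is sent to the sum of u ** v over
   the factorizations w = u t_i v. Being linear, it is the unique derivation
   with the values fdqU on the generators; the Leibniz rule is fdqM. *)
Definition fdq (i : I) : ncpoly -> ncpoly2 :=
  lin_ext (fun w : {fmonom I} =>
    \sum_(k < size w | nth i w k == i)
      << (FMonom (take k w), FMonom (drop k.+1 w)) >>).

Lemma lactU u T : lact << u >> T =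
  lin_ext (fun s : {fmonom I} * {fmonom I} => << (mmul u s.1, s.2) >>) T.
Proof. exact: lin_extU. Qed.

Lemma ractU T v : ract T << v >> =
  lin_ext (fun s : {fmonom I} * {fmonom I} => << (s.1, mmul s.2 v) >>) T.
Proof. exact: lin_extU. Qed.

Lemma fdq_word i (w : {fmonom I}) : fdq i << w >> =
  \sum_(k < size w | nth i w k == i)
    << (FMonom (take k w), FMonom (drop k.+1 w)) >>.
Proof. exact: lin_extU. Qed.

Lemma fdqU i k : fdq i << fmu k >> = if i == k then << (mone, mone) >> else 0.
Proof.
rewrite fdq_word fmuE /= big_mkcond big_ord1 /= eq_sym.
by rewrite [mone]fmoneE.
Qed.

Lemma fmulE (u v : seq I) : mmul (FMonom u) (FMonom v) = FMonom (u ++ v).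
Proof. exact: fmmulE. Qed.

Lemma fdq_mulU i (u v : {fmonom I}) :
  fdq i << mmul u v >> = ract (fdq i << u >>) << v >> + lact << u >> (fdq i << v >>).
Proof.
rewrite ractU lactU !fdq_word.
case: u => u; case: v => v; rewrite fmulE /=.
rewrite (linear_sum (lin_ext _)) (linear_sum (lin_ext _)) /=.
rewrite -(big_mkord (fun k => nth i (u ++ v) k == i)
  (fun k => << (FMonom (take k (u ++ v)), FMonom (drop k.+1 (u ++ v))) >>)).
rewrite size_cat (@big_cat_nat _ _ _ (size u)) ?leq_addr//=; congr (_ + _).
  rewrite big_mkord; apply: eq_big => [k|k _]; first by rewrite nth_cat ltn_ord.
  rewrite (lin_extU _ (FMonom _, FMonom _)) /= fmulE.
  rewrite take_cat drop_cat ltn_ord.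
  have := ltn_ord k; rewrite leq_eqVlt => /orP[/eqP kE|-> //].
  by rewrite kE ltnn subnn drop0 drop_size.
rewrite -{1}[size u]add0n big_addn addKn big_mkord.
apply: eq_big => [k|k _]; first by rewrite nth_cat ltnNge leq_addl addnK.
rewrite (lin_extU _ (FMonom _, FMonom _)) /= fmulE take_cat drop_cat -addSn.
by rewrite !ltnNge !leq_addl /= !addnK.
Qed.

Lemma fdqM i (p q : ncpoly) :
  fdq i (p * q) = ract (fdq i p) q + lact p (fdq i q).
Proof.
have fdqE (r : ncpoly) : fdq i r = \sum_(u <- msupp r) r@_u *: fdq i << u >>.
  by rewrite {1}/fdq /lin_ext; apply: eq_bigr => u _; rewrite fdq_word.
have ractE : ract (fdq i p) q = \sum_(u <- msupp p) \sum_(v <- msupp q)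
    (p@_u * q@_v) *: ract (fdq i << u >>) << v >>.
  rewrite exchange_big /= {1}/ract {1}/lin_ext; apply: eq_bigr => v _.
  rewrite fdqE (linear_sum (lin_ext _)) /= scaler_sumr; apply: eq_bigr => u _.
  by rewrite (linearZ_LR (lin_ext _)) /= scalerA mulrC ractU.
have lactE : lact p (fdq i q) = \sum_(u <- msupp p) \sum_(v <- msupp q)
    (p@_u * q@_v) *: lact << u >> (fdq i << v >>).
  rewrite {1}/lact {1}/lin_ext; apply: eq_bigr => u _.
  rewrite fdqE (linear_sum (lin_ext _)) /= scaler_sumr; apply: eq_bigr => v _.
  by rewrite (linearZ_LR (lin_ext _)) /= scalerA lactU.
rewrite ractE lactE malgME -big_split /= {1}/fdq (linear_sum (lin_ext _)) /=.
apply: eq_bigr => u _; rewrite (linear_sum (lin_ext _)) -big_split /=.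
apply: eq_bigr => v _.
by rewrite malgUZ (linearZ_LR (lin_ext _)) /= -scalerDr -fdq_mulU.
Qed.

End FreeAlgebra.

Section HilbertSpaces.
Variable R : realType.

(* dotp is linear in its first argument. Operators are plain functions H -> H:
   the product is \o, the unit is id, sums and scalings are pointwise. *)
Record hilbert := Hilbert {
  hilbert_car :> completeNormedModType R[i] ;
  dotp : {dot hilbert_car for (@Num.conj R[i])} ;
  dotpE : forall u : hilbert_car, dotp u u = `|u| ^+ 2 }.
Arguments dotp {h}.

Definition sqnorm (H : hilbert) (u : H) : R := complex.Re (dotp u u).

Definition bounded_op (H K : hilbert) (T : H -> K) :=
  linear T /\ continuous T.

(* The Hilbert space adjoint; for bounded T it exists and is unique by the Riesz
   representation theorem, so that the default value is never taken. *)
Definition adj (H K : hilbert) (T : H -> K) : K -> H :=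
  xget (0 : K -> H) [set S : K -> H | forall u v, dotp (T u) v = dotp u (S v)].

(* On R[i], 0 <= z means that z is real and nonnegative. *)
Definition op_le (H : hilbert) (S T : H -> H) :=
  forall u, 0 <= dotp (T u - S u) u.

Definition commutant (H : hilbert) (A : set (H -> H)) : set (H -> H) :=
  [set T | bounded_op T /\ forall S, A S -> T \o S = S \o T].

(* A von Neumann algebra acting on H. Being a commutant, A automatically
   contains id and is closed under sums, scalings and products. *)
Record vnalg (H : hilbert) (A : set (H -> H)) : Prop := {
  vnalg_bounded : forall T, A T -> bounded_op T ;
  vnalg_adj : forall T, A T -> A (adj T) ;
  vnalg_bicommutant : commutant (commutant A) = A }.

(* The smallest von Neumann algebra on H containing G; when G is included in a
   von Neumann algebra M it is the von Neumann subalgebra of M generated by G. *)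
Definition Wstar (H : hilbert) (G : set (H -> H)) : set (H -> H) :=
  smallest (@vnalg H) G.

Definition op_lub (H : hilbert) (M F : set (H -> H)) (S : H -> H) :=
  [/\ M S, forall T, F T -> op_le T S &
      forall S', M S' -> (forall T, F T -> op_le T S') -> op_le S S'].

Definition op_directed (H : hilbert) (F : set (H -> H)) :=
  F !=set0 /\
  forall S T, F S -> F T -> exists U, [/\ F U, op_le S U & op_le T U].

(* Only the values of tau on M matter. Normality: tau preserves suprema of
   bounded increasing nets of positive elements, indexed here by themselves. *)
Record tracial_state (H : hilbert) (M : set (H -> H)) (tau : (H -> H) -> R[i])
    : Prop := {
  tau_linear : forall (a : R[i]) S T, M S -> M T ->
    tau (a *: S + T) = a * tau S + tau T ;
  tau_unit : tau id = 1 ;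
  tau_positive : forall T, M T -> 0 <= tau (adj T \o T) ;
  tau_trace : forall S T, M S -> M T -> tau (S \o T) = tau (T \o S) ;
  tau_faithful : forall T, M T -> tau (adj T \o T) = 0 -> T = 0 ;
  tau_normal : forall F S, F `<=` M -> op_directed F ->
    (forall T, F T -> op_le 0 T) -> op_lub M F S ->
    supremums (tau @` F) (tau S) }.

(* A model of L^2(N, tau): a Hilbert space completion of N for the inner product
   <S, T> = tau(T^* S), with the embedding l2_emb of N (unspecified outside N).
   Models exist and are unique up to a unitary compatible with l2_emb. *)
Record l2space (H : hilbert) (N : set (H -> H)) (tau : (H -> H) -> R[i]) :=
  L2Space {
    l2_car :> hilbert ;
    l2_emb : (H -> H) -> l2_car ;
    l2_linear : forall (a : R[i]) S T, N S -> N T ->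
      l2_emb (a *: S + T) = a *: l2_emb S + l2_emb T ;
    l2_dot : forall S T, N S -> N T ->
      dotp (l2_emb S) (l2_emb T) = tau (adj T \o S) ;
    l2_dense : dense (l2_emb @` N) }.
Arguments l2_emb {H N tau} l _.

(* The action of Q on L^2(N, tau): the bounded extension of left multiplication
   by Q, which exists when N is a von Neumann algebra with tracial state tau and
   Q belongs to N, and is unique by density. *)
Definition l2_lmul (H : hilbert) (N : set (H -> H)) (tau : (H -> H) -> R[i])
    (L : l2space N tau) (Q : H -> H) : L -> L :=
  xget (0 : L -> L) [set T : L -> L | bounded_op T /\
    forall S, N S -> T (l2_emb L S) = l2_emb L (Q \o S)].
Arguments l2_lmul {H N tau} L Q _.

(* The dimension of the left Q-module K: for a Q-linear isometry V = (V b)_b from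
   K into the Hilbert sum of copies of L = L^2(Q, tau) indexed by B, it is the
   value of tau ** Tr at V V^*, that is \sum_b <V_b V_b^* 1, 1> with
   1 = l2_emb L id. For a normal module such a V exists when B is large enough,
   and the value does not depend on B and V: the infimum is over a singleton. *)
Definition vn_dim (H : hilbert) (Q : set (H -> H)) (tau : (H -> H) -> R[i])
    (L : l2space Q tau) (K : hilbert) (act : (H -> H) -> K -> K) : \bar R :=
  ereal_inf [set d | exists (B : choiceType) (V : B -> K -> L),
    [/\ forall b, linear (V b),
        forall h, (\esum_(b in [set: B]) (sqnorm (V b h))%:E = (sqnorm h)%:E)%E,
        forall b q h, Q q -> V b (act q h) = l2_lmul L q (V b h) &
        d = (\esum_(b in [set: B])
               (complex.Re (dotp (V b (adj (V b) (l2_emb L id))) (l2_emb L id)))%:E)%E]].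

(* dim_Q L^2(N, tau) = +oo, the models being immaterial. *)
Definition infinite_index (H : hilbert) (Q N : set (H -> H))
    (tau : (H -> H) -> R[i]) :=
  forall (LQ : l2space Q tau) (LN : l2space N tau),
    vn_dim LQ (l2_lmul LN) = +oo%E.

Definition normalizer (H : hilbert) (Q N : set (H -> H)) : set (H -> H) :=
  [set u | [/\ N u, adj u \o u = id, u \o adj u = id &
               [set u \o T \o adj u | T in Q] = Q]].

Definition regular_in (H : hilbert) (Q N : set (H -> H)) :=
  commutant (commutant (normalizer Q N)) = N.

Definition irreducible_in (H : hilbert) (Q N : set (H -> H)) :=
  commutant Q `&` N = [set c *: (id : H -> H) | c in [set: R[i]]].

Definition projection (H : hilbert) (A : set (H -> H)) (p : H -> H) :=
  [/\ A p, p \o p = p & adj p = p].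

Definition minimal_projection (H : hilbert) (A : set (H -> H)) (p : H -> H) :=
  [/\ projection A p, p <> 0 &
      forall q, projection A q -> op_le q p -> q = 0 \/ q = p].

Definition diffuse (H : hilbert) (A : set (H -> H)) :=
  ~ exists p, minimal_projection A p.

Definition abelian_alg (H : hilbert) (A : set (H -> H)) :=
  forall S T, A S -> A T -> S \o T = T \o S.

Section ConjugateSystem.
Variables (H : hilbert) (I : choiceType) (x : I -> H -> H).
Variable tau : (H -> H) -> R[i].

Definition eval_word (w : {fmonom I}) : H -> H :=
  foldr (fun i T => x i \o T) id w.

Definition eval_poly (p : {malg R[i][{fmonom I}]}) : H -> H :=
  lin_ext eval_word p.

(* (tau ** tau)(T(x)), for T in the tensor square. *)
Definition eval_tau2 (T : {malg R[i][({fmonom I} * {fmonom I})%type]}) : R[i] :=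
  lin_ext (fun s : {fmonom I} * {fmonom I} =>
    tau (eval_word s.1) * tau (eval_word s.2) : R[i]^o) T.

Definition admits_conjugate_system :=
  exists (L : l2space (Wstar (range x)) tau) (xi : I -> L),
    forall i (p : {malg R[i][{fmonom I}]}),
      dotp (l2_emb L (eval_poly p)) (xi i) = eval_tau2 (fdq i p).

End ConjugateSystem.
End HilbertSpaces.

(* Main.v *)
From HB Require Import structures.
Require Import Defs.
From mathcomp Require Import all_boot all_order all_algebra.
From mathcomp Require Import finmap ring lra.
From mathcomp.real_closed Require Import complex.
From mathcomp.multinomials Require Import monalg.
From mathcomp Require Import all_classical all_reals all_analysis.

(** Let [N] be generated by all the [x_i], and regard the free difference quotient
    [d = d_k] as a densely defined operator from [L^2 N] to [L^2 N (x) L^2 N]. The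
    conjugate system is used only through the bound
    [|(tau (x) tau)(d p)| <= C |p|_2]. Let [K] be the set of those [T] in [N] such
    that [(T, 0)] belongs to the closure of the graph of [d]. By the Leibniz rule
    [K] is an algebra, closed in [L^2]; a density theorem in the spirit of
    von Neumann's shows that [K] contains [W^*(G)] whenever [K] contains the
    self-adjoint set [G]. Hence [K] contains [W^*(x_j : j in J)] for [k] outside
    [J], while the bound shows that [x_k] is not in [K].

    The projection of [(0, a (x) b)] onto the closed graph has a first component
    [W (a, b)], of norm at most [|a|_2 |b|_2] and [K]-bimodular in [(a, b)], and an
    element of [N] orthogonal to all the [W (a, b)] is in [K]. Let [e_i] be a
    partition of 1 into projections of [K] of small trace. If [u e_i = f_i u] for
    another such partition, then [<u, W (a, b)>] is the sum of the
    [<u e_i, W (f_i a, b e_i)>], which is small, so that [u] is in [K]. This puts in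
    [K] the normalizer of any subalgebra of [K] with such partitions, and proves
    non-regularity. Were the dimension finite, cutting [W (a, b)] by the [e_i] would
    give [W = 0] and [K = N].

    The partitions exist because [W^*(x_j)] is diffuse: if [p] is a minimal
    projection, then [x_j p = l p] for a scalar [l], and the resolvent
    [g = (1 - i s (x_j - l))^-1] satisfies [d_j g = i s g (x) g], so that
    [s |tau g|^2] is bounded as [s] tends to infinity, although [|tau g|] is at
    least [tau p]. Finally, if [z] commutes with [x_i] and [x_j], then [z] is in the
    kernel of [d_j] and applying [d_j] to [z x_j = x_j z] gives
    [z (x) 1 = 1 (x) z]. *)

Set Implicit Arguments.
Unset Strict Implicit.
Unset Printing Implicit Defensive.

Import Order.TTheory GRing.Theory Num.Theory.
Import numFieldNormedType.Exports.
Local Open Scope ring_scope.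
Local Open Scope classical_set_scope.

(** * Semi-definite inner products *)

(** [N] acts on an arbitrary [H], so approximation on [H] says nothing directly about the 2-norm;
    intertwiners [H -> L], total in [L] because the trace is normal, make the passage. The tensor
    square is kept semi-definite and uncompleted: its vectors are compared up to norm 0, and
    closures, orthogonality and projections appear as approximations with an explicit error. Effects
    (operators between 0 and 1) that are maximal for a suitable property, found by Zorn's lemma,
    play the part of spectral projections. In the sum over a partition, Cauchy-Schwarz absorbs the
    factors [u e_i] and [f_i a], while [|b e_i|_2 <= |b| tau(e_i)^(1/2)] supplies the smallness. The
    resolvent [g] is not a polynomial: it is replaced by one built from a truncated geometric
    series, of operator norm at most 2 whatever [s] and the truncation, so that the conjugate system
    bounds its pairing by [2 C]; the truncation error is made small once [s] is fixed. In the
    abelian case, [A] commutes with a diffuse subalgebra of [K], hence lies in [K], and so does its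
    normalizer. *)

Record prehilb (R : realType) := Prehilb {
  ph_car :> lmodType R[i];
  ip : ph_car -> ph_car -> R[i];
  ip_lin : forall a u v w, ip (a *: u + v) w = a * ip u w + ip v w;
  ip_conj : forall u v, ip v u = (ip u v)^*;
  ip_ge0 : forall u, 0 <= complex.Re (ip u u) }.
Arguments ip {R p}.

Section ComplexNumbers.
Variable R : realType.
Implicit Types z w : R[i].

(** The modulus with values in [R], where the estimates take place; the norm of [R[i]] has values in
    [R[i]]. *)
Definition cabs z : R := ComplexField.Normc.normc z.

Lemma cReD z w : complex.Re (z + w) = complex.Re z + complex.Re w.
Proof. by case: z; case: w. Qed.
Lemma cReN z : complex.Re (- z) = - complex.Re z.
Proof. by case: z. Qed.
Lemma cReB z w : complex.Re (z - w) = complex.Re z - complex.Re w.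
Proof. by rewrite cReD cReN. Qed.
Lemma cImB z w : complex.Im (z - w) = complex.Im z - complex.Im w.
Proof. by case: z; case: w. Qed.
Lemma cRe_conj z : complex.Re z^* = complex.Re z.
Proof. by case: z. Qed.
Lemma cIm_conj z : complex.Im z^* = - complex.Im z.
Proof. by case: z. Qed.
Lemma cRe_Zr (c : R) z : complex.Re (c%:C%C * z) = c * complex.Re z.
Proof. by case: z => x y /=; rewrite mul0r subr0. Qed.
Lemma cIm_Zr (c : R) z : complex.Im (c%:C%C * z) = c * complex.Im z.
Proof. by case: z => x y /=; rewrite mul0r addr0. Qed.
Lemma cRe_Zi z : complex.Re ('i%C * z) = - complex.Im z.
Proof. by case: z => x y /=; rewrite mul0r mul1r sub0r. Qed.
Lemma cReM z w : complex.Re (z * w) =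
  complex.Re z * complex.Re w - complex.Im z * complex.Im w.
Proof. by case: z; case: w. Qed.
Lemma cImM z w : complex.Im (z * w) =
  complex.Re z * complex.Im w + complex.Im z * complex.Re w.
Proof. by case: z; case: w. Qed.
Lemma cRe_sum (J : Type) (r : seq J) (P : pred J) (F : J -> R[i]) :
  complex.Re (\sum_(j <- r | P j) F j) = \sum_(j <- r | P j) complex.Re (F j).
Proof. exact: (big_morph _ cReD). Qed.
Lemma complex_ext z w :
  complex.Re z = complex.Re w -> complex.Im z = complex.Im w -> z = w.
Proof. by case: z => a b; case: w => c d /= -> ->. Qed.

Lemma cge0P z : reflect (complex.Im z = 0 /\ 0 <= complex.Re z) (0 <= z).
Proof.
case: z => a b; rewrite lecE /= eq_sym; apply: (iffP andP) => -[].
  by move=> /eqP.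
by move=> -> ->.
Qed.

Lemma cgt0P z : 0 < z -> z = (complex.Re z)%:C%C /\ 0 < complex.Re z.
Proof. by case: z => a b; rewrite ltcE /= => /andP[/eqP -> ->]. Qed.

Lemma cabs_ge0 z : 0 <= cabs z.
Proof. by case: z => a b; exact: sqrtr_ge0. Qed.
Lemma cabsE z : cabs z = Num.sqrt (complex.Re z ^+ 2 + complex.Im z ^+ 2).
Proof. by case: z. Qed.
Lemma cabs_sqr z : cabs z ^+ 2 = complex.Re z ^+ 2 + complex.Im z ^+ 2.
Proof. by rewrite cabsE sqr_sqrtr// addr_ge0// sqr_ge0. Qed.
Lemma cabsM z w : cabs (z * w) = cabs z * cabs w.
Proof. exact: ComplexField.Normc.normcM. Qed.
Lemma cabsD z w : cabs (z + w) <= cabs z + cabs w.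
Proof. exact: le_normcD. Qed.
Lemma cabsN z : cabs (- z) = cabs z.
Proof. by rewrite !cabsE; case: z => a b /=; rewrite !sqrrN. Qed.
Lemma cabs_conj z : cabs z^* = cabs z.
Proof. by rewrite !cabsE cRe_conj cIm_conj sqrrN. Qed.
Lemma cabs0 : cabs 0 = 0. Proof. exact: ComplexField.Normc.normc0. Qed.
Lemma cabs1 : cabs 1 = 1. Proof. exact: ComplexField.Normc.normc1. Qed.
Lemma cabs_real (c : R) : cabs c%:C%C = `|c|.
Proof. by rewrite cabsE /= expr0n addr0 sqrtr_sqr. Qed.
Lemma cabs_i : cabs 'i%C = 1.
Proof. by rewrite cabsE /= expr0n expr1n add0r sqrtr1. Qed.
Lemma cabs_eq0 z : cabs z = 0 -> z = 0.
Proof. exact: ComplexField.Normc.eq0_normc. Qed.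
Lemma Re_le_cabs z : `|complex.Re z| <= cabs z.
Proof.
rewrite -(ler_pXn2r (n := 2)) ?nnegrE ?normr_ge0 ?cabs_ge0//.
by rewrite cabs_sqr real_normK ?num_real// lerDl sqr_ge0.
Qed.
Lemma cabs_sum (J : Type) (r : seq J) (P : pred J) (F : J -> R[i]) :
  cabs (\sum_(j <- r | P j) F j) <= \sum_(j <- r | P j) cabs (F j).
Proof.
elim/big_ind2 : _ => //; first by rewrite cabs0.
by move=> x1 x2 y1 y2 h1 h2; apply: (le_trans (cabsD _ _)); rewrite lerD.
Qed.
Lemma mul_conj_cabs z : z * z^* = (cabs z ^+ 2)%:C%C.
Proof.
by apply: complex_ext; rewrite ?cReM ?cImM cRe_conj cIm_conj ?cabs_sqr /=; ring.
Qed.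

Lemma phase z : exists2 w : R[i], cabs w = 1 & complex.Re (w * z) = cabs z.
Proof.
have [z0|z0] := eqVneq (cabs z) 0.
  by exists 1; rewrite ?cabs1// mul1r z0 (cabs_eq0 z0).
exists ((cabs z)^-1%:C%C * z^*).
  by rewrite cabsM cabs_real cabs_conj ger0_norm ?invr_ge0 ?cabs_ge0// mulVf.
rewrite -mulrA [_^* * _]mulrC mul_conj_cabs cRe_Zr /= expr2 mulrA mulVf//.
by rewrite mul1r.
Qed.
End ComplexNumbers.

Section Subspaces.
Variables (K : pzRingType) (V : lmodType K).
Implicit Types (G : set V) (u v : V) (a : K).

Definition lin_subspace G := G 0 /\ forall a u v, G u -> G v -> G (a *: u + v).

Lemma subspaceZ G a u : lin_subspace G -> G u -> G (a *: u).
Proof. by move=> [G0 GL] Gu; rewrite -[_ *: _]addr0; exact: GL. Qed.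
Lemma subspaceN G u : lin_subspace G -> G u -> G (- u).
Proof. by move=> sG Gu; rewrite -scaleN1r; exact: subspaceZ. Qed.
Lemma subspaceD G u v : lin_subspace G -> G u -> G v -> G (u + v).
Proof. by move=> [G0 GL] Gu Gv; rewrite -[u]scale1r; exact: GL. Qed.
Lemma subspaceB G u v : lin_subspace G -> G u -> G v -> G (u - v).
Proof. by move=> sG Gu Gv; apply: subspaceD => //; exact: subspaceN. Qed.

End Subspaces.

Section PreHilbert.
Variables (R : realType) (V : prehilb R).
Implicit Types (u v w : V) (a : R[i]) (c d : R).

Definition rip u v : R := complex.Re (ip u v).
Definition nrm u : R := Num.sqrt (rip u u).

Lemma ipDl u v w : ip (u + v) w = ip u w + ip v w.
Proof. by have := ip_lin 1 u v w; rewrite scale1r mul1r. Qed.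
Lemma ip0l w : ip 0 w = 0 :> R[i].
Proof. by apply: (addrI (ip 0 w)); rewrite -ipDl !addr0. Qed.
Lemma ipZl a u w : ip (a *: u) w = a * ip u w.
Proof. by have := ip_lin a u 0 w; rewrite ip0l !addr0. Qed.
Lemma ipNl u w : ip (- u) w = - ip u w.
Proof. by rewrite -scaleN1r ipZl mulN1r. Qed.
Lemma ipBl u v w : ip (u - v) w = ip u w - ip v w.
Proof. by rewrite ipDl ipNl. Qed.
Lemma ipDr u v w : ip u (v + w) = ip u v + ip u w.
Proof. by rewrite ip_conj ipDl rmorphD /= -!ip_conj. Qed.
Lemma ipZr a u w : ip u (a *: w) = a^* * ip u w.
Proof. by rewrite ip_conj ipZl rmorphM /= -!ip_conj. Qed.
Lemma ip0r u : ip u 0 = 0 :> R[i].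
Proof. by rewrite ip_conj ip0l rmorph0. Qed.
Lemma ipNr u w : ip u (- w) = - ip u w.
Proof. by rewrite ip_conj ipNl rmorphN /= -!ip_conj. Qed.
Lemma ipBr u v w : ip u (v - w) = ip u v - ip u w.
Proof. by rewrite ipDr ipNr. Qed.
Lemma ip_suml (J : Type) (r : seq J) (P : pred J) (F : J -> V) w :
  ip (\sum_(j <- r | P j) F j) w = \sum_(j <- r | P j) ip (F j) w.
Proof.
by elim/big_ind2 : _ => [|x x' y y' <- <-|]//; rewrite ?ip0l ?ipDl.
Qed.
Lemma ip_sumr (J : Type) (r : seq J) (P : pred J) (F : J -> V) w :
  ip w (\sum_(j <- r | P j) F j) = \sum_(j <- r | P j) ip w (F j).
Proof.
by elim/big_ind2 : _ => [|x x' y y' <- <-|]//; rewrite ?ip0r ?ipDr.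
Qed.
Lemma Im_ip u v : complex.Im (ip u v) = rip u ('i%C *: v).
Proof.
rewrite /rip ipZr; case: (ip u v) => a b /=.
by rewrite mul0r sub0r mulN1r opprK.
Qed.

Lemma ripC u v : rip u v = rip v u.
Proof. by rewrite /rip ip_conj cRe_conj. Qed.
Lemma ripDl u v w : rip (u + v) w = rip u w + rip v w.
Proof. by rewrite /rip ipDl cReD. Qed.
Lemma ripDr u v w : rip w (u + v) = rip w u + rip w v.
Proof. by rewrite /rip ipDr cReD. Qed.
Lemma ripNl u w : rip (- u) w = - rip u w.
Proof. by rewrite /rip ipNl cReN. Qed.
Lemma ripNr u w : rip u (- w) = - rip u w.
Proof. by rewrite ripC ripNl ripC. Qed.
Lemma ripBl u v w : rip (u - v) w = rip u w - rip v w.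
Proof. by rewrite ripDl ripNl. Qed.
Lemma ripBr u v w : rip w (u - v) = rip w u - rip w v.
Proof. by rewrite ripDr ripNr. Qed.
Lemma ripZl c u w : rip (c%:C%C *: u) w = c * rip u w.
Proof. by rewrite /rip ipZl cRe_Zr. Qed.
Lemma ripZr c u w : rip u (c%:C%C *: w) = c * rip u w.
Proof. by rewrite ripC ripZl ripC. Qed.
Lemma rip0l w : rip 0 w = 0. Proof. by rewrite /rip ip0l. Qed.
Lemma rip0r w : rip w 0 = 0. Proof. by rewrite /rip ip0r. Qed.
Lemma rip_ge0 u : 0 <= rip u u. Proof. exact: ip_ge0. Qed.
Lemma rip_sumr (J : Type) (r : seq J) (P : pred J) (F : J -> V) w :
  rip w (\sum_(j <- r | P j) F j) = \sum_(j <- r | P j) rip w (F j).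
Proof. by rewrite /rip ip_sumr cRe_sum. Qed.

Lemma nrm_ge0 u : 0 <= nrm u. Proof. exact: sqrtr_ge0. Qed.
Lemma nrm_sqr u : nrm u ^+ 2 = rip u u.
Proof. by rewrite sqr_sqrtr// rip_ge0. Qed.
Lemma nrm0 : nrm 0 = 0. Proof. by rewrite /nrm rip0l sqrtr0. Qed.
Lemma nrmZ a u : nrm (a *: u) = cabs a * nrm u.
Proof.
apply: (@pexpIrn _ 2); rewrite ?nnegrE ?mulr_ge0 ?nrm_ge0 ?cabs_ge0//.
rewrite exprMn !nrm_sqr /rip ipZl ipZr mulrA mul_conj_cabs cRe_Zr.
by [].
Qed.
Lemma nrmN u : nrm (- u) = nrm u.
Proof. by rewrite /nrm ripNl ripNr opprK. Qed.
Lemma nrmB u v : nrm (u - v) = nrm (v - u).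
Proof. by rewrite -nrmN opprB. Qed.

Lemma ler_nrm u c : 0 <= c -> rip u u <= c ^+ 2 -> nrm u <= c.
Proof.
by move=> c0 h; rewrite -(ler_pXn2r (n := 2)) ?nnegrE ?nrm_ge0// nrm_sqr.
Qed.

Lemma quad_discr (a b d : R) : 0 <= a -> 0 <= d ->
  (forall c : R, 0 <= a - 2 * b * c + d * c ^+ 2) -> b ^+ 2 <= a * d.
Proof.
move=> a0 d0 h; have [dz|dz] := eqVneq d 0.
  have [-> //|bn] := eqVneq b 0; first by rewrite expr0n mulr_ge0.
  (* With [d = 0] the polynomial in [c] is affine; at this point it takes the value -1. *)
  have := h ((a + 1) / b / 2); rewrite dz mul0r addr0.
  have -> : 2 * b * ((a + 1) / b / 2) = a + 1 by field.
  lra.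
have := h (b / d).
have -> : a - 2 * b * (b / d) + d * (b / d) ^+ 2 = (a * d - b ^+ 2) / d by field.
by rewrite pmulr_lge0 ?subr_ge0// invr_gt0 lt_neqAle eq_sym dz.
Qed.

Lemma rip_cs_sqr u v : rip u v ^+ 2 <= rip u u * rip v v.
Proof.
apply: quad_discr; rewrite ?rip_ge0// => c.
have := rip_ge0 (u - c%:C%C *: v).
rewrite ripBl !ripBr !ripZl !ripZr (ripC v u) => h; apply: (le_trans h); lra.
Qed.

Lemma rip_cs u v : `|rip u v| <= nrm u * nrm v.
Proof.
rewrite -(ler_pXn2r (n := 2)) ?nnegrE ?normr_ge0 ?mulr_ge0 ?nrm_ge0//.
by rewrite real_normK ?num_real// exprMn !nrm_sqr rip_cs_sqr.
Qed.

Lemma rip_le u v : rip u v <= nrm u * nrm v.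
Proof. exact: le_trans (ler_norm _) (rip_cs u v). Qed.

Lemma ip_cs u v : cabs (ip u v) <= nrm u * nrm v.
Proof.
have [w w1 <-] := phase (ip u v).
rewrite -ipZl; apply: (le_trans (rip_le _ _)).
by rewrite nrmZ w1 mul1r.
Qed.

Lemma nrm_triangle u v : nrm (u + v) <= nrm u + nrm v.
Proof.
apply: ler_nrm; first by rewrite addr_ge0 ?nrm_ge0.
rewrite ripDl !ripDr (ripC v u) sqrrD !nrm_sqr.
by have := rip_le u v; lra.
Qed.

Lemma nrmB_triangle u v w : nrm (u - w) <= nrm (u - v) + nrm (v - w).
Proof.
have -> : u - w = (u - v) + (v - w) by rewrite addrA subrK.
exact: nrm_triangle.
Qed.

Lemma nrmDB u v u' v' : nrm (u + v - (u' + v')) <= nrm (u - u') + nrm (v - v').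
Proof. by rewrite opprD addrACA nrm_triangle. Qed.

Lemma nrmB_le u v : nrm (u - v) <= nrm u + nrm v.
Proof. by apply: (le_trans (nrm_triangle _ _)); rewrite nrmN. Qed.

(** Orthogonality to [G] up to an error [d] relative to [|g|]. On a subspace the one-sided bound is
    two-sided, see [northo_abs]. *)
Definition northo (G : set V) (d : R) (r : V) :=
  forall g, G g -> rip r g <= d * nrm g.

Lemma northo_abs G d r : lin_subspace G -> northo G d r ->
  forall g, G g -> `|rip r g| <= d * nrm g.
Proof.
move=> sG h g Gg; rewrite ler_norml h// andbT.
by have := h _ (subspaceN sG Gg); rewrite ripNr nrmN lerNl.
Qed.

(** The distance from [w] to [G] need not be attained. A [g] with [|w - g|^2] within [d^2] of the
    infimum will do: comparison with [g + c h] makes a quadratic polynomial in [c] nonnegative, and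
    its discriminant gives the bound. *)
Lemma near_projection G w d : lin_subspace G -> 0 < d ->
  exists2 g, G g & northo G d (w - g).
Proof.
move=> sG d0.
pose D := [set rip (w - g) (w - g) | g in G].
have D0 : has_inf D.
  split; first by exists (rip (w - 0) (w - 0)); exists 0 => //; case: sG.
  by exists 0 => _ [g _ <-]; exact: rip_ge0.
have d2 : 0 < d ^+ 2 by rewrite exprn_gt0.
have [_ [g Gg <-] hg] := inf_adherent d2 D0.
exists g => // h Gh.
have q : rip (w - g) h ^+ 2 <= d ^+ 2 * rip h h.
  apply: quad_discr; rewrite ?rip_ge0 ?(ltW d2)// => c.
  have : inf D <= rip (w - g - c%:C%C *: h) (w - g - c%:C%C *: h).
    apply: ge_inf; first by case: D0.
    exists (g + c%:C%C *: h); last by rewrite opprD addrA.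
    by apply: subspaceD => //; exact: subspaceZ.
  move: hg; move: (inf D) => i; move: (w - g) => y hy.
  by rewrite ripBl !ripBr !ripZl !ripZr (ripC h y); lra.
apply: le_trans (ler_norm _) _.
rewrite -(ler_pXn2r (n := 2)) ?nnegrE ?normr_ge0 ?mulr_ge0 ?nrm_ge0 ?(ltW d0)//.
by rewrite real_normK ?num_real// exprMn nrm_sqr.
Qed.

Lemma near_nrm w g d : 0 <= d -> `|rip (w - g) g| <= d * nrm g -> nrm g <= nrm w + d.
Proof.
move=> d0; have [->|n0] := eqVneq (nrm g) 0; first by rewrite addr_ge0 ?nrm_ge0.
have np : 0 < nrm g by rewrite lt_neqAle eq_sym n0 nrm_ge0.
rewrite ripBl ler_norml => /andP[h1 _]; have h2 := rip_le w g.
rewrite -(ler_pM2r np) -expr2 mulrDl.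
move: h1; rewrite -nrm_sqr; lra.
Qed.

(** [|g - g'|^2] is the difference of the pairings of [w - g'] and [w - g] with [g - g'], both
    small. Near projections of [w] thus form a Cauchy family. *)
Lemma near_projection_dist G w d d' g g' : lin_subspace G -> 0 <= d -> 0 <= d' ->
  G g -> G g' -> northo G d (w - g) -> northo G d' (w - g') ->
  nrm (g - g') <= d + d'.
Proof.
move=> sG d0 d0' Gg Gg' h h'.
have := h' _ (subspaceB sG Gg Gg'); have := h _ (subspaceB sG Gg' Gg).
rewrite -[nrm (g' - g)]nrmB -[g' - g]opprB ripNr.
have : rip (g - g') (g - g') = rip (w - g') (g - g') - rip (w - g) (g - g').
  by rewrite -ripBl; congr rip; rewrite opprB [RHS]addrC addrA subrK.
rewrite -nrm_sqr; have := nrm_ge0 (g - g'); nra.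
Qed.

End PreHilbert.

(** * Hilbert spaces *)

Section Hilbert.
Variable R : realType.

Lemma dotp_lin (H : hilbert R) (a : R[i]) (u v w : H) :
  dotp H (a *: u + v) w = a * dotp H u w + dotp H v w.
Proof. by rewrite linearPl. Qed.
Lemma dotp_conj (H : hilbert R) (u v : H) : dotp H v u = (dotp H u v)^*.
Proof. by rewrite hermC/= expr0 mul1r. Qed.
Lemma dotp_ge0 (H : hilbert R) (u : H) : 0 <= complex.Re (dotp H u u).
Proof. by have /cge0P[] : 0 <= dotp H u u by rewrite dotpE exprn_ge0. Qed.
Definition prehilb_of (H : hilbert R) :=
  @Prehilb R H (dotp H) (@dotp_lin H) (@dotp_conj H) (@dotp_ge0 H).
Canonical prehilb_of.
Coercion prehilb_of : hilbert >-> prehilb.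

Implicit Types H K L : hilbert R.

Lemma sqnormE H (u : H) : sqnorm u = rip u u. Proof. by []. Qed.

Lemma normE H (u : H) : `|u| = (nrm u)%:C%C.
Proof.
have h : `|u| ^+ 2 = (nrm u)%:C%C ^+ 2.
  rewrite -dotpE -rmorphXn /= nrm_sqr.
  apply: complex_ext => //=.
  by have /cge0P[] : 0 <= dotp H u u by rewrite dotpE exprn_ge0.
by apply: (pexpIrn _ _ _ h) => //; rewrite nnegrE// ler0c nrm_ge0.
Qed.

Lemma nrm_eq0 H (u : H) : nrm u = 0 -> u = 0.
Proof. by move=> u0; apply/eqP; rewrite -normr_eq0 normE u0. Qed.

Lemma small_eq0 (c k : R) : 0 <= c -> (forall e, 0 < e -> c <= k * e) -> c = 0.
Proof.
move=> c0 h; apply/eqP; rewrite eq_le c0 andbT leNgt; apply/negP => cp.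
have k0 : 0 < k by have := h 1 ltr01; rewrite mulr1; apply: lt_le_trans.
have := h (c / k / 2); rewrite !divr_gt0// => /(_ isT).
have -> : k * (c / k / 2) = c / 2 by field; rewrite gt_eqF.
lra.
Qed.

Lemma nrm_small_eq0 H (u : H) k : (forall e, 0 < e -> nrm u <= k * e) -> u = 0.
Proof. by move=> h; apply/nrm_eq0/(small_eq0 (nrm_ge0 u) h). Qed.

Lemma hilbert_ext H (u v : H) : (forall w, rip u w = rip v w) -> u = v.
Proof.
move=> h; apply/subr0_eq/nrm_eq0.
by rewrite /nrm ripBl h subrr sqrtr0.
Qed.

(** [P d y] reads: [y] is an approximation with error [d]. The limit is built from the errors
    [1/(n+1)] but controls every approximation, so that its properties can later be proved with
    whichever approximation is convenient. *)
Lemma complete_family H (P : R -> H -> Prop) (k : R) : 0 <= k ->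
  (forall d, 0 < d -> exists y, P d y) ->
  (forall d d' y y', 0 < d -> 0 < d' -> P d y -> P d' y' ->
    nrm (y - y') <= k * (d + d')) ->
  exists l, forall d y, 0 < d -> P d y -> nrm (l - y) <= k * d.
Proof.
move=> k0 hex hP.
have d0 n : 0 < n.+1%:R^-1 :> R by rewrite invr_gt0 ltr0n.
have [y hy] : {y : nat -> H & forall n, P n.+1%:R^-1 (y n)}.
  by apply: (@choice _ _ (fun n => P n.+1%:R^-1)) => n; exact: hex.
have small (e : R) : 0 < e -> exists n0, forall n, (n0 <= n)%N -> k * n.+1%:R^-1 < e.
  move=> e0; exists (Num.truncn (k / e)) => n hn.
  rewrite ltr_pdivrMr ?ltr0n// -ltr_pdivrMl// mulrC.
  by apply: lt_le_trans (truncnS_gt _) _; rewrite ler_nat.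
have cy : cvg (y @ \oo).
  apply: cauchy_cvg; apply: cauchy_exP => e e0.
  have [er ei] := cgt0P e0.
  have [n0 hn0] := small _ (divr_gt0 ei (ltr0n _ 2)).
  exists (y n0); exists n0 => // n /= hn.
  rewrite -ball_normE /= normE er ltcR.
  apply: le_lt_trans (hP _ _ _ _ (d0 _) (d0 _) (hy _) (hy _)) _.
  have := hn0 _ hn; have := hn0 _ (leqnn n0); rewrite mulrDr => a1 a2.
  by apply: (lt_le_trans (ltrD a1 a2)); lra.
exists (lim (y @ \oo)) => d z dp hz.
rewrite leNgt; apply/negP => hlt.
pose e := (nrm (lim (y @ \oo) - z) - k * d) / 2.
have e0 : 0 < e by rewrite divr_gt0// subr_gt0.
have ec : (0 : R[i]) < e%:C%C by rewrite ltcR.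
have /cvgrPdist_lt /(_ _ ec) [n1 _ h1] := cy.
have [n0 hn0] := small _ e0.
have /= := h1 (maxn n0 n1) (leq_maxr _ _); rewrite normE ltcR => h2.
have h3 := hP _ _ _ _ (d0 (maxn n0 n1)) dp (hy _) hz.
have h4 := hn0 _ (leq_maxl n0 n1).
have := nrmB_triangle (lim (y @ \oo)) (y (maxn n0 n1)) z.
move: h2 h3 h4; rewrite mulrDr /e.
by move: (k * _^-1) (k * d) (nrm _) (nrm _) (nrm _) => *; lra.
Qed.

Definition bounded_by (V W : prehilb R) (k : R) (T : V -> W) :=
  forall u, nrm (T u) <= k * nrm u.

Lemma bounded_opP H K (T : H -> K) : bounded_op T <->
  linear T /\ exists k, 0 <= k /\ bounded_by k T.
Proof.
split=> [[lT cT]|[lT [k [k0 kT]]]].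
  split=> //.
  pose m := GRing.isLinear.Build _ _ _ _ T lT.
  pose f : {linear H -> K} := HB.pack T m.
  have /linear_boundedP/pinfty_ex_gt0 [r r0 hr] :
      bounded_near f (nbhs (0 : H)).
    exact/linear_bounded_continuous.
  have [er ei] := cgt0P r0; exists (complex.Re r); split; first exact: ltW.
  by move=> u; have := hr u; rewrite !normE er -rmorphM /= lecR.
split=> //.
pose m := GRing.isLinear.Build _ _ _ _ T lT.
pose f : {linear H -> K} := HB.pack T m.
suff : bounded_near f (nbhs (0 : H)) by move/linear_bounded_continuous.
apply/linear_boundedP; exists k%:C%C; split; first by rewrite realE ler0c k0.
move=> r hr x; apply: (@le_trans _ _ (k%:C%C * `|x|)).
  rewrite !normE -rmorphM /= lecR; exact: kT.
by rewrite ler_wpM2r// ltW.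
Qed.

Lemma denseP H (S : set H) : dense S <->
  forall u e, 0 < e -> exists2 s, S s & nrm (u - s) <= e.
Proof.
split=> [dS u e e0|h O [u Ou] oO].
  have ec : (0 : R[i]) < e%:C%C by rewrite ltcR.
  have [] := dS (ball u e%:C%C).
  - by exists u; exact: ballxx.
  - exact: ball_open.
  - by move=> s [/=]; rewrite -ball_normE /= normE ltcR => /ltW hs Ss; exists s.
have /nbhs_ballP[e e0 he] : nbhs u O by exact: open_nbhs_nbhs.
have [er ei] := cgt0P e0.
have [s Ss hs] := h u _ (divr_gt0 ei (ltr0n _ 2)).
exists s; split=> //; apply: he; rewrite -ball_normE /= normE er ltcR.
by apply: le_lt_trans hs _; lra.
Qed.

End Hilbert.

(** * Extension of densely defined operators, adjoints *)

Section Extension.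
Variables (R : realType) (V : prehilb R) (L : hilbert R) (X : lmodType R[i]).
Variables (D : set X) (A : X -> V) (B : X -> L) (C : R).

(** [U] is the projection of [V] onto the closure of [A(D)] followed by the continuous extension of
    [A t |-> B t]. As [V] may be incomplete, the projection is only seen through [ext_northo] (the
    orthogonal complement is sent to 0, with an error) and [ext_near] (values are computed on near
    projections). *)
Record is_ext (U : V -> L) : Prop := IsExt {
  ext_lin : linear U;
  ext_bound : bounded_by C U;
  ext_val : forall t, D t -> U (A t) = B t;
  ext_northo : forall r d, 0 <= d -> northo (A @` D) d r -> nrm (U r) <= C * d;
  ext_near : forall v d, 0 < d ->
    exists t, [/\ D t, northo (A @` D) d (v - A t) & nrm (U v - B t) <= C * d] }.

Hypothesis sD : lin_subspace D.
Hypothesis lA : forall a s t, D s -> D t -> A (a *: s + t) = a *: A s + A t.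
Hypothesis lB : forall a s t, D s -> D t -> B (a *: s + t) = a *: B s + B t.
Hypothesis C0 : 0 <= C.
Hypothesis AB : forall t, D t -> nrm (B t) <= C * nrm (A t).

Let G := A @` D.

Let A0 : A 0 = 0.
Proof.
have [D0 _] := sD; apply: (addrI (A 0)); rewrite addr0.
by have := lA 1 D0 D0; rewrite !scale1r addr0.
Qed.

Let sG : lin_subspace G.
Proof.
have [D0 DL] := sD; split; first by exists 0.
by move=> a _ _ [s Ds <-] [t Dt <-]; exists (a *: s + t); [exact: DL|exact: lA].
Qed.

Lemma northoD d d' (r r' : V) : northo G d r -> northo G d' r' ->
  northo G (d + d') (r + r').
Proof. by move=> h h' g Gg; rewrite ripDl mulrDl lerD ?h ?h'. Qed.

Lemma northoZ d a (r : V) : northo G d r -> northo G (cabs a * d) (a *: r).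
Proof.
move=> h g Gg.
have -> : rip (a *: r) g = rip r (a^* *: g) by rewrite /rip ipZl ipZr conjCK.
apply: (le_trans (h _ (subspaceZ _ sG Gg))).
by rewrite nrmZ cabs_conj mulrA [d * _]mulrC.
Qed.

Let AB_dist s t : D s -> D t -> nrm (B s - B t) <= C * nrm (A s - A t).
Proof.
move=> Ds Dt; have := AB (subspaceB sD Ds Dt).
by rewrite -[- t]scaleN1r ![s + _]addrC lA// lB// !scaleN1r ![- _ + _]addrC.
Qed.

Let near_dist v d d' s t : 0 <= d -> 0 <= d' -> D s -> D t ->
  northo G d (v - A s) -> northo G d' (v - A t) ->
  nrm (B s - B t) <= C * (d + d').
Proof.
move=> d0 d0' Ds Dt h h'; apply: (le_trans (AB_dist Ds Dt)).
rewrite ler_wpM2l//; apply: near_projection_dist h h' => //.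
  by exists s.
by exists t.
Qed.

(** [U v] is the limit of [B t] as [A t] runs through the near projections of [v]: these are Cauchy
    by [near_projection_dist], and [L] is complete. *)
Lemma ext_exists : exists U, is_ext U.
Proof.
have /(@choice _ _ _)[U hU] : forall v, exists l, forall d t, 0 < d -> D t ->
    northo G d (v - A t) -> nrm (l - B t) <= C * d.
  move=> v.
  have [||l hl] := @complete_family _ L
    (fun d y => exists t, [/\ D t, northo G d (v - A t) & y = B t]) C C0.
  - by move=> d d0; have [g [t Dt <-] h] := near_projection v sG d0; exists (B t), t.
  - move=> d d' y y' d0 d0' [t [Dt ht ->]] [t' [Dt' ht' ->]].
    by apply: near_dist ht ht' => //; exact: ltW.
  - by exists l => d t d0 Dt h; apply: hl => //; exists t.
have near v d : 0 < d -> exists t,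
    [/\ D t, northo G d (v - A t) & nrm (U v - B t) <= C * d].
  move=> d0; have [g [t Dt <-] h] := near_projection v sG d0.
  by exists t; split => //; exact: hU.
have val t : D t -> U (A t) = B t.
  move=> Dt; apply/subr0_eq/(@nrm_small_eq0 _ _ _ C) => e e0; apply: hU => //.
  by move=> g _; rewrite subrr rip0l mulr_ge0 ?nrm_ge0 ?ltW.
exists U; split => //.
- move=> a u v; apply/subr0_eq/(@nrm_small_eq0 _ _ _ (C * (cabs a + cabs a + 1 + 1))).
  move=> e e0; have [s [Ds hs bs]] := near u e e0; have [t [Dt ht bt]] := near v e e0.
  have [D0 DL] := sD.
  have h : northo G (cabs a * e + e) (a *: u + v - A (a *: s + t)).
    rewrite lA// opprD addrACA -scalerBr; apply: northoD => //; exact: northoZ.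
  have := hU _ _ _ (ltr_wpDl (mulr_ge0 (cabs_ge0 a) (ltW e0)) e0) (DL a _ _ Ds Dt) h.
  rewrite lB// => h1.
  have := nrmB_triangle (U (a *: u + v)) (a *: B s + B t) (a *: U u + U v).
  have : nrm (a *: B s + B t - (a *: U u + U v)) <= cabs a * (C * e) + C * e.
    rewrite opprD addrACA -scalerBr; apply: (le_trans (nrm_triangle _ _)).
    by rewrite nrmZ ![nrm (B _ - _)]nrmB lerD// ler_wpM2l// cabs_ge0.
  move: h1; have := cabs_ge0 a; nra.
- move=> u; rewrite -subr_ge0.
  apply: contrapT => /negP; rewrite -ltNge subr_lt0 => hlt.
  pose e := (nrm (U u) - C * nrm u) / (C + C + 1).
  have k0 : 0 < C + C + 1 by rewrite ltr_wpDl ?addr_ge0.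
  have e0 : 0 < e by rewrite divr_gt0// subr_gt0.
  have [t [Dt ht bt]] := near u e e0.
  have hA : nrm (A t) <= nrm u + e.
    apply: near_nrm; first exact: ltW.
    by apply: northo_abs sG ht _ _; exists t.
  have := nrm_triangle (U u - B t) (B t); rewrite subrK.
  have := AB Dt; have : C * nrm (A t) <= C * (nrm u + e) by rewrite ler_wpM2l.
  have : e * (C + C + 1) = nrm (U u) - C * nrm u by rewrite divfK// gt_eqF.
  nra.
- move=> r d d0 h; apply/ler_addgt0Pr => e e0.
  have e1 : 0 < e / (C + 1) by rewrite divr_gt0// ltr_wpDl.
  have := hU r (d + e / (C + 1)) 0 (ltr_wpDl d0 e1) (proj1 sD).
  have -> : B 0 = 0.
    have [D0 _] := sD; apply: (addrI (B 0)); rewrite addr0.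
    by have := lB 1 D0 D0; rewrite !scale1r addr0.
  rewrite A0 !subr0 mulrDr => h1; apply: le_trans (h1 _) _.
    by move=> g Gg; apply: (le_trans (h g Gg)); rewrite ler_wpM2r ?nrm_ge0// lerDl ltW.
  rewrite lerD2l mulrCA ger_pMr// ler_pdivrMr ?mul1r ?lerDl//.
  by rewrite ltr_wpDl.
Qed.

Section Intertwining.
Variables (U : V -> L) (S Sa : V -> V) (S' : L -> L) (k : R).
Hypothesis UE : is_ext U.
Hypothesis lS : linear S.
Hypothesis lS' : linear S'.
Hypothesis k0 : 0 <= k.
Hypothesis Sadj : forall u v, rip (S u) v = rip u (Sa v).
Hypothesis bSa : bounded_by k Sa.
Hypothesis bS' : bounded_by k S'.
Hypothesis SG : forall t e, D t -> 0 < e -> exists t',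
  [/\ D t', nrm (S (A t) - A t') <= e & nrm (S' (B t) - B t') <= e].
Hypothesis SaG : forall t e, D t -> 0 < e ->
  exists2 t', D t' & nrm (Sa (A t) - A t') <= e.

Lemma linearB_of (M N : lmodType R[i]) (T : M -> N) (u v : M) : linear T ->
  T (u - v) = T u - T v.
Proof. by move=> lT; rewrite -[- v]scaleN1r addrC lT scaleN1r addrC. Qed.

(** The closure of [A(D)] is invariant under [S] and under its adjoint [Sa], so [S] commutes with
    the projection onto it. In approximate form: [S] keeps vectors nearly orthogonal to [A(D)]
    ([hS]), because [Sa] nearly preserves [A(D)]. *)
Lemma ext_intertwine v : U (S v) = S' (U v).
Proof.
have Ul := ext_lin UE.
have hS r d : 0 < d -> northo G d r -> northo G (k * d) (S r).
  move=> d0 h _ [t Dt <-]; rewrite Sadj.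
  apply/ler_addgt0Pr => e e0.
  have c0 : 0 < d + nrm r by rewrite ltr_pwDl// nrm_ge0.
  have [t' Dt' ht'] := SaG Dt (divr_gt0 e0 c0).
  have -> : Sa (A t) = (Sa (A t) - A t') + A t' by rewrite subrK.
  have h1 : rip r (A t') <= d * nrm (A t') by apply: h; exists t'.
  have h2 := rip_le r (Sa (A t) - A t').
  have h3 : nrm (A t') <= nrm (Sa (A t)) + e / (d + nrm r).
    have := nrm_triangle (A t' - Sa (A t)) (Sa (A t)); rewrite subrK => h3.
    by apply: (le_trans h3); rewrite addrC lerD2l nrmB.
  have h4 := bSa (A t).
  have h5 : d * nrm (A t') <= d * (k * nrm (A t) + e / (d + nrm r)).
    rewrite ler_wpM2l ?(ltW d0)//; apply: (le_trans h3); rewrite lerD2r//.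
  have h6 : nrm r * nrm (Sa (A t) - A t') <= nrm r * (e / (d + nrm r)).
    by rewrite ler_wpM2l ?nrm_ge0.
  have h7 : (d + nrm r) * (e / (d + nrm r)) = e by rewrite mulrC divfK// gt_eqF.
  rewrite ripDr; apply: (@le_trans _ _ (nrm r * (e / (d + nrm r)) +
    d * (k * nrm (A t) + e / (d + nrm r)))).
    apply: lerD; [exact: le_trans h2 h6|exact: le_trans h1 h5].
  by rewrite -[X in _ <= _ + X]h7; move: (e / _) => q; lra.
apply/subr0_eq/(@nrm_small_eq0 _ _ _ (C + 1 + (C * k + k * C))) => e e0.
have [t [Dt ht bt]] := ext_near UE v e0.
have [t' [Dt' h1 h2]] := SG Dt e0.
have a1 : nrm (U (S v) - U (S (A t))) <= C * (k * e).
  rewrite -linearB_of// -linearB_of//; apply: (ext_northo UE); last exact: hS.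
  by rewrite mulr_ge0// ltW.
have a2 : nrm (U (S (A t)) - B t') <= C * e.
  rewrite -(ext_val UE Dt') -linearB_of//; apply: (le_trans (ext_bound UE _)).
  by rewrite ler_wpM2l.
have a3 : nrm (B t' - S' (B t)) <= e by rewrite nrmB.
have a4 : nrm (S' (B t) - S' (U v)) <= k * (C * e).
  rewrite -linearB_of//; apply: (le_trans (bS' _)); rewrite ler_wpM2l//.
  by rewrite nrmB.
have b1 := nrmB_triangle (U (S v)) (U (S (A t))) (S' (U v)).
have b2 := nrmB_triangle (U (S (A t))) (B t') (S' (U v)).
have b3 := nrmB_triangle (B t') (S' (B t)) (S' (U v)).
lra.
Qed.
End Intertwining.
End Extension.

Section Adjoints.
Variable R : realType.
Implicit Types H K L : hilbert R.

Lemma dense_ext_unique H K (S : set H) (T T' : H -> K) :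
  dense S -> bounded_op T -> bounded_op T' -> (forall s, S s -> T s = T' s) -> T = T'.
Proof.
move=> /denseP dS /bounded_opP[lT [k [k0 kT]]] /bounded_opP[lT' [k' [k0' kT']]] h.
apply/funext => u; apply/subr0_eq/(@nrm_small_eq0 _ _ _ (k + k')) => e e0.
have [s Ss hs] := dS u e e0.
have -> : T u - T' u = T (u - s) - T' (u - s).
  by rewrite (linearB_of _ _ lT) (linearB_of _ _ lT') (h _ Ss) opprB addrA subrK.
apply: (le_trans (nrmB_le _ _)); rewrite mulrDl.
by apply: lerD; [apply: (le_trans (kT _))|apply: (le_trans (kT' _))];
  rewrite ler_wpM2l.
Qed.

Lemma riesz H (f : H -> R[i]) k : 0 <= k ->
  (forall a u v, f (a *: u + v) = a * f u + f v) ->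
  (forall u, cabs (f u) <= k * nrm u) ->
  exists y, forall u, f u = ip u y.
Proof.
move=> k0 lf bf.
have f0 : f 0 = 0 by apply/cabs_eq0/eqP; rewrite eq_le cabs_ge0 andbT;
  apply: (le_trans (bf _)); rewrite nrm0 mulr0.
have [h|] := pselect (forall u, f u = 0); first by exists 0 => u; rewrite h ip0r.
move=> /existsNP[u0 fu0].
pose D := [set u | f u = 0].
have sD : lin_subspace D.
  by split=> // a u v /= fu fv; rewrite /D /= lf fu fv mulr0 addr0.
(* With [A = B = id], [U] is the projection onto the kernel [D] of [f]. *)
have [||||U UE] := @ext_exists R H H H D id id 1 sD => //.
  by move=> t _; rewrite mul1r.
have fB u v : f (u - v) = f u - f v.
  by rewrite -[- v]scaleN1r addrC lf mulN1r addrC.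
have fU u : f (U u) = 0.
  apply/cabs_eq0/(@small_eq0 _ _ k); first exact: cabs_ge0.
  move=> e e0; have [t [Dt _ ht]] := ext_near UE u e0.
  have -> : f (U u) = f (U u - t) by rewrite fB [f t]Dt subr0.
  by apply: (le_trans (bf _)); rewrite ler_wpM2l// -[e]mul1r.
pose n := u0 - U u0.
have fn : f n = f u0 by rewrite fB fU subr0.
have hn g : D g -> ip g n = 0.
  have ortho h : D h -> rip n h = 0.
    move=> Dh; apply/eqP; rewrite -normr_eq0; apply/eqP.
    apply: (@small_eq0 _ _ (2 * nrm h)); first exact: normr_ge0.
    move=> e e0; have [t [Dt ht bt]] := ext_near UE u0 e0.
    rewrite image_id in ht.
    have -> : n = (u0 - t) - (U u0 - t) by rewrite opprB addrA subrK.
    rewrite ripBl; apply: (le_trans (ler_normB _ _)).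
    have := northo_abs sD ht Dh; have := rip_cs (U u0 - t) h.
    have : nrm (U u0 - t) * nrm h <= e * nrm h.
      by rewrite ler_wpM2r ?nrm_ge0// -[e]mul1r.
    lra.
  move=> Dg; apply: complex_ext; first by rewrite -/(rip g n) ripC ortho.
  by rewrite ip_conj cIm_conj Im_ip ortho ?oppr0//; exact: subspaceZ.
have nn : ip n n != 0.
  apply/eqP => nn; apply: fu0; rewrite -fn.
  suff -> : n = 0 by [].
  by apply/nrm_eq0; rewrite /nrm /rip nn sqrtr0.
exists ((f n / ip n n)^* *: n) => u.
rewrite ipZr conjCK.
have : ip (u - (f u / f n) *: n) n = 0.
  apply: hn; rewrite /D /= addrC -scaleNr lf mulNr divfK ?addNr//.
  by rewrite fn; apply/eqP.
rewrite ipBl ipZl => /subr0_eq ->.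
have fn0 : f n != 0 by rewrite fn; apply/eqP.
by rewrite mulrCA mulrA [f u / _]mulrC -!mulrA mulrCA; field; rewrite nn fn0.
Qed.

Lemma adj_exists H K (T : H -> K) : bounded_op T ->
  exists S : K -> H, forall u v, dotp K (T u) v = dotp H u (S v).
Proof.
move=> /bounded_opP[lT [k [k0 kT]]].
have /(@choice _ _ _)[S hS] : forall v : K, exists y : H, forall u, ip (T u) v = ip u y.
  move=> v; apply: (@riesz _ _ (k * nrm v)); first by rewrite mulr_ge0 ?nrm_ge0.
    by move=> a u w; rewrite lT ip_lin.
  move=> u; apply: (le_trans (ip_cs _ _)).
  by rewrite mulrAC ler_wpM2r ?nrm_ge0.
by exists S => u v; exact: hS.
Qed.

Lemma adjP H K (T : H -> K) : bounded_op T -> forall u v, ip (T u) v = ip u (adj T v).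
Proof.
move=> bT; have [S hS] := adj_exists bT; rewrite /adj.
by case: xgetP => [S' _ //|/(_ S)]; case.
Qed.

Lemma ip_adjr H K (T : H -> K) u v : bounded_op T -> ip u (T v) = ip (adj T u) v.
Proof. by move=> bT; rewrite ip_conj adjP// -ip_conj. Qed.

Lemma rip_adj H K (T : H -> K) u v : bounded_op T -> rip (T u) v = rip u (adj T v).
Proof. by move=> bT; rewrite /rip adjP. Qed.

Lemma rip_adjr H K (T : H -> K) u v : bounded_op T -> rip u (T v) = rip (adj T u) v.
Proof. by move=> bT; rewrite ripC rip_adj// ripC. Qed.

Lemma adj_unique H K (T : H -> K) (S : K -> H) : bounded_op T ->
  (forall u v, rip (T u) v = rip u (S v)) -> adj T = S.
Proof.
move=> bT h; apply/funext => v; apply: hilbert_ext => w.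
by rewrite ripC -rip_adj// h ripC.
Qed.

Lemma rip_adjoint_bounded H K (T : H -> K) (S : K -> H) k : 0 <= k ->
  bounded_by k T -> (forall u v, rip (T u) v = rip u (S v)) -> bounded_by k S.
Proof.
move=> k0 kT h v; have [->|n0] := eqVneq (nrm (S v)) 0.
  by rewrite mulr_ge0 ?nrm_ge0.
have np : 0 < nrm (S v) by rewrite lt_neqAle eq_sym n0 nrm_ge0.
rewrite -(ler_pM2r np) -expr2 nrm_sqr -h; apply: (le_trans (rip_le _ _)).
by rewrite mulrAC ler_wpM2r ?nrm_ge0.
Qed.

Lemma adj_bounded_by H K (T : H -> K) k : bounded_op T -> 0 <= k ->
  bounded_by k T -> bounded_by k (adj T).
Proof. by move=> bT k0 kT; apply: rip_adjoint_bounded kT _ => // u v; exact: rip_adj. Qed.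

Lemma adj_bounded H K (T : H -> K) : bounded_op T -> bounded_op (adj T).
Proof.
move=> bT; have [lT [k [k0 kT]]] := (bounded_opP T).1 bT.
apply/bounded_opP; split; last by exists k; split=> //; exact: adj_bounded_by.
move=> a u v; apply: hilbert_ext => w.
by rewrite /rip ipDl ipZl -!ip_adjr// ipDl ipZl.
Qed.

Lemma adjK H K (T : H -> K) : bounded_op T -> adj (adj T) = T.
Proof.
move=> bT; apply: adj_unique; first exact: adj_bounded.
by move=> u v; rewrite ripC -rip_adj// ripC.
Qed.

Lemma bounded_comp H K L (S : K -> L) (T : H -> K) :
  bounded_op S -> bounded_op T -> bounded_op (S \o T).
Proof.
move=> /bounded_opP[lS [k [k0 kS]]] /bounded_opP[lT [l [l0 lT']]].
apply/bounded_opP; split; first by move=> a u v /=; rewrite lT lS.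
exists (k * l); split; first exact: mulr_ge0.
move=> u /=; apply: (le_trans (kS _)).
by rewrite -mulrA ler_wpM2l.
Qed.

Lemma bounded_lin H K (a : R[i]) (S T : H -> K) :
  bounded_op S -> bounded_op T -> bounded_op (a *: S + T).
Proof.
move=> /bounded_opP[lS [k [k0 kS]]] /bounded_opP[lT [l [l0 lT']]].
apply/bounded_opP; split.
  move=> b u v; rewrite !fctE lS lT !scalerDr !scalerA mulrC addrACA.
  by [].
exists (cabs a * k + l); split; first by rewrite addr_ge0 ?mulr_ge0 ?cabs_ge0.
move=> u; rewrite !fctE; apply: (le_trans (nrm_triangle _ _)).
by rewrite mulrDl lerD// nrmZ -mulrA ler_wpM2l ?cabs_ge0.
Qed.

Lemma bounded_id H : bounded_op (id : H -> H).
Proof.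
apply/bounded_opP; split=> //; exists 1; split=> // u; by rewrite mul1r.
Qed.

Lemma bounded0 H K : bounded_op (0 : H -> K).
Proof.
have z u : (0 : H -> K) u = 0 by [].
apply/bounded_opP; split; first by move=> a u v; rewrite !z scaler0 addr0.
by exists 0; split=> // u; rewrite z nrm0 mul0r.
Qed.

Lemma adj_comp H K L (S : K -> L) (T : H -> K) :
  bounded_op S -> bounded_op T -> adj (S \o T) = adj T \o adj S.
Proof.
move=> bS bT; apply: adj_unique; first exact: bounded_comp.
by move=> u v /=; rewrite !rip_adj.
Qed.

Lemma adj_lin H K a (S T : H -> K) :
  bounded_op S -> bounded_op T -> adj (a *: S + T) = a^* *: adj S + adj T.
Proof.
move=> bS bT; apply: adj_unique; first exact: bounded_lin.
move=> u v; have -> : (a *: S + T) u = a *: S u + T u by [].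
have -> : (a^* *: adj S + adj T) v = a^* *: adj S v + adj T v by [].
rewrite ripDl ripDr (rip_adj _ _ bT); congr (_ + _).
by rewrite /rip ipZl ipZr conjCK adjP.
Qed.

Lemma adj_id H : adj (id : H -> H) = id.
Proof. by apply: adj_unique => //; exact: bounded_id. Qed.

End Adjoints.

(** * Von Neumann algebras *)

Section Operators.
Variables (R : realType) (H : hilbert R).
Implicit Types (A B : set (H -> H)) (S T : H -> H) (u v : H).

Lemma op_lin T : bounded_op T -> linear T. Proof. by case. Qed.
Lemma opB T : bounded_op T -> forall u v, T (u - v) = T u - T v.
Proof. by move=> /op_lin lT u v; exact: linearB_of. Qed.
Lemma opD T : bounded_op T -> forall u v, T (u + v) = T u + T v.
Proof. by move=> /op_lin lT u v; rewrite -[u]scale1r lT !scale1r. Qed.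
Lemma op0 T : bounded_op T -> T 0 = 0.
Proof. by move=> bT; rewrite -[X in T X](subrr 0) (opB bT) subrr. Qed.
Lemma opZ T : bounded_op T -> forall a u, T (a *: u) = a *: T u.
Proof. by move=> bT a u; have := op_lin bT a u 0; rewrite (op0 bT) !addr0. Qed.
Lemma opN T : bounded_op T -> forall u, T (- u) = - T u.
Proof. by move=> bT u; rewrite -scaleN1r (opZ bT) scaleN1r. Qed.
Lemma op_sum T : bounded_op T -> forall (J : Type) (r : seq J) (P : pred J) (F : J -> H),
  T (\sum_(j <- r | P j) F j) = \sum_(j <- r | P j) T (F j).
Proof. by move=> bT J r P F; apply: (big_morph T) => [x y|]; rewrite ?(opD bT) ?(op0 bT). Qed.

Lemma fun_sumE (J : Type) (r : seq J) (P : pred J) (F : J -> H -> H) u :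
  (\sum_(j <- r | P j) F j) u = \sum_(j <- r | P j) F j u.
Proof. by apply: (big_morph (fun T : H -> H => T u)). Qed.

Lemma commutantS A B : A `<=` B -> commutant B `<=` commutant A.
Proof. by move=> AB T [bT h]; split=> // S /AB; exact: h. Qed.

Lemma bicommutant_sub A : (forall T, A T -> bounded_op T) ->
  A `<=` commutant (commutant A).
Proof. by move=> bA T AT; split=> [|S [_ h]]; [exact: bA|rewrite h]. Qed.

Lemma tricommutant A : (forall T, A T -> bounded_op T) ->
  commutant (commutant (commutant A)) = commutant A.
Proof.
move=> bA; apply/seteqP; split; first exact/commutantS/bicommutant_sub.
by apply: bicommutant_sub => T [].
Qed.

Lemma commutant_id A : (forall T, A T -> bounded_op T) -> commutant A id.
Proof. by move=> bA; split=> [|S /bA]; [exact: bounded_id|]. Qed.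

Lemma commutant_comp A S T : commutant A S -> commutant A T -> commutant A (S \o T).
Proof.
move=> [bS hS] [bT hT]; split=> [|U AU]; first exact: bounded_comp.
by rewrite -compA hT// compA hS.
Qed.

Lemma commutant_lin A a S T : (forall T, A T -> bounded_op T) ->
  commutant A S -> commutant A T -> commutant A (a *: S + T).
Proof.
move=> bA [bS hS] [bT hT]; split=> [|U AU]; first exact: bounded_lin.
apply/funext => u /=; have bU := bA _ AU.
have -> : (a *: S + T) (U u) = a *: S (U u) + T (U u) by [].
have -> : (a *: S + T) u = a *: S u + T u by [].
by rewrite (opD bU) (opZ bU); congr (_ *: _ + _); [have /(congr1 (@^~ u)) := hS _ AU|
  have /(congr1 (@^~ u)) := hT _ AU].
Qed.

Lemma commutant_adj A T : (forall T, A T -> bounded_op T) ->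
  (forall S, A S -> A (adj S)) -> commutant A T -> commutant A (adj T).
Proof.
move=> bA sA [bT hT]; split=> [|S AS]; first exact: adj_bounded.
have bS := bA _ AS.
have bS' := adj_bounded bS.
have : adj (adj S \o T) = adj (T \o adj S) by rewrite (hT _ (sA _ AS)).
by rewrite (adj_comp bS' bT) (adj_comp bT bS') (adjK bS).
Qed.

Section VonNeumann.
Variable (N : set (H -> H)).
Hypothesis vN : vnalg N.
Let bN T : N T -> bounded_op T. Proof. exact: vnalg_bounded. Qed.
Let bN' T : commutant N T -> bounded_op T. Proof. by case. Qed.

Lemma vn_id : N id.
Proof. by rewrite -(vnalg_bicommutant vN); exact: commutant_id. Qed.
Lemma vn_comp S T : N S -> N T -> N (S \o T).
Proof. by rewrite -(vnalg_bicommutant vN); exact: commutant_comp. Qed.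
Lemma vn_lin a S T : N S -> N T -> N (a *: S + T).
Proof. by rewrite -(vnalg_bicommutant vN); exact: commutant_lin. Qed.
Lemma vn_0 : N 0.
Proof.
have -> : 0 = (-1) *: (id : H -> H) + id.
  by apply/funext => u; rewrite !fctE scaleN1r addNr.
by apply: vn_lin; exact: vn_id.
Qed.
Lemma vn_D S T : N S -> N T -> N (S + T).
Proof. by move=> NS NT; rewrite -[S]scale1r; exact: vn_lin. Qed.
Lemma vn_Z a S : N S -> N (a *: S).
Proof. by move=> NS; rewrite -[_ *: _]addr0; apply: vn_lin => //; exact: vn_0. Qed.
Lemma vn_B S T : N S -> N T -> N (S - T).
Proof. by move=> NS NT; rewrite addrC -scaleN1r; exact: vn_lin. Qed.
Lemma vn_sum (J : Type) (r : seq J) (F : J -> H -> H) :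
  (forall j, N (F j)) -> N (\sum_(j <- r) F j).
Proof. by move=> h; elim/big_ind : _ => //; [exact: vn_0|exact: vn_D]. Qed.

(** Commutation of [S] with [U] at the vector [u] involves only [S (U u)] and [S u], so
    approximation at two vectors at a time is enough. *)
Lemma vn_limit S : bounded_op S ->
  (forall u v e, 0 < e -> exists T, [/\ N T, nrm (S u - T u) <= e & nrm (S v - T v) <= e]) ->
  N S.
Proof.
move=> bS h; rewrite -(vnalg_bicommutant vN); split=> // U [bU hU].
apply/funext => u /=.
have [_ [k [k0 kU]]] := (bounded_opP U).1 bU.
apply/subr0_eq/(@nrm_small_eq0 _ _ _ (1 + k)) => e e0.
have [T [NT h1 h2]] := h (U u) u e e0.
have hT : T (U u) = U (T u) by have /(congr1 (@^~ u)) := hU _ NT.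
have -> : S (U u) - U (S u) = (S (U u) - T (U u)) - U (S u - T u).
  by rewrite (opB bU) hT opprB addrA subrK.
apply: (le_trans (nrmB_le _ _)); rewrite mulrDl mul1r lerD//.
by apply: (le_trans (kU _)); rewrite ler_wpM2l.
Qed.
End VonNeumann.

Lemma vnalg_bigcap (F : set (set (H -> H))) :
  F !=set0 -> (forall A, F A -> vnalg A) -> vnalg (\bigcap_(A in F) A).
Proof.
move=> [A0 FA0] vF.
have bI T : (\bigcap_(A in F) A) T -> bounded_op T.
  by move=> /(_ _ FA0); exact/vnalg_bounded/vF.
split=> //.
  by move=> T hT A FA; apply: (vnalg_adj (vF _ FA)); exact: hT.
apply/seteqP; split; last exact: bicommutant_sub.
move=> T hT A FA; rewrite -(vnalg_bicommutant (vF _ FA)).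
by apply: commutantS hT; apply: commutantS => S; apply.
Qed.

Lemma vnalg_setI A B : vnalg A -> vnalg B -> vnalg (A `&` B).
Proof.
move=> vA vB; have -> : A `&` B = \bigcap_(X in [set A; B]) X.
  by rewrite bigcap_setU1 bigcap_set1.
by apply: vnalg_bigcap => [|X []->//]; exists A; left.
Qed.

Lemma vnalg_bicomm A : (forall T, A T -> bounded_op T) ->
  (forall T, A T -> A (adj T)) -> vnalg (commutant (commutant A)).
Proof.
move=> bA sA; split.
- by move=> T [].
- move=> T hT; apply: commutant_adj hT => [S []//|S hS].
  exact: commutant_adj.
- by rewrite (tricommutant (A := commutant A))// => T [].
Qed.

Lemma Wstar_sub A : A `<=` Wstar A.
Proof. by move=> T AT B [_]; apply. Qed.

Lemma Wstar_min A B : vnalg B -> A `<=` B -> Wstar A `<=` B.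
Proof. by move=> vB AB T; apply; split. Qed.

Lemma Wstar_vnalg A B : vnalg B -> A `<=` B -> vnalg (Wstar A).
Proof. by move=> vB AB; apply: vnalg_bigcap => [|X []//]; exists B. Qed.

Lemma WstarS A B : A `<=` B -> Wstar A `<=` Wstar B.
Proof. by move=> AB T hT C [vC BC]; apply: hT; split=> // S /AB/BC. Qed.

Lemma Wstar_bicomm A : (forall T, A T -> bounded_op T) ->
  (forall T, A T -> A (adj T)) -> Wstar A `<=` commutant (commutant A).
Proof. by move=> bA sA; apply: Wstar_min; [exact: vnalg_bicomm|exact: bicommutant_sub]. Qed.

End Operators.

(** * Order, suprema of bounded nets *)

Section Order.
Variables (R : realType) (H : hilbert R).
Implicit Types (S T b k : H -> H) (u v : H) (F : set (H -> H)).

Definition sa T := bounded_op T /\ adj T = T.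
(** Only the real parts of the quadratic forms are compared; on self-adjoint operators this is
    [op_le], by [op_leE]. *)
Definition ole S T := forall u, rip (S u) u <= rip (T u) u.
(** Unlike projections, effects are stable under the compressions [S \o T \o S]; like them, they are
    stable under suprema of directed families. Both properties serve in the maximality arguments. *)
Definition eff T := [/\ sa T, ole 0 T & ole T id].

Lemma rip_sa T : sa T -> forall u v, rip (T u) v = rip u (T v).
Proof. by move=> [bT aT] u v; rewrite rip_adj// aT. Qed.

Lemma saP T : bounded_op T -> (forall u v, rip (T u) v = rip u (T v)) -> sa T.
Proof. by move=> bT h; split=> //; exact: adj_unique. Qed.

Lemma sa_Im T u : sa T -> complex.Im (ip (T u) u) = 0.
Proof.
move=> [bT aT]; have : ip (T u) u = (ip (T u) u)^* by rewrite -ip_conj adjP// aT.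
by move/(congr1 (@complex.Im _)); rewrite cIm_conj; lra.
Qed.

Lemma zero_opE u : (0 : H -> H) u = 0. Proof. by []. Qed.
Lemma add_opE S T u : (S + T) u = S u + T u. Proof. by []. Qed.
Lemma opp_opE S u : (- S) u = - S u. Proof. by []. Qed.
Lemma scale_opE a S u : (a *: S) u = a *: S u. Proof. by []. Qed.
Definition opE := (zero_opE, add_opE, opp_opE, scale_opE).

Lemma op_leE S T : sa S -> sa T -> (op_le S T <-> ole S T).
Proof.
move=> sS sT; split=> h u.
  by have /cge0P[_] := h u; rewrite -[dotp _ _ _]/(ip _ _) ipBl cReB subr_ge0.
apply/cge0P; split.
  by rewrite -[dotp _ _ _]/(ip _ _) ipBl cImB !sa_Im// subrr.
by rewrite -[dotp _ _ _]/(ip _ _) ipBl cReB subr_ge0; exact: h.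
Qed.

Lemma ole_refl T : ole T T. Proof. by move=> u. Qed.
Lemma ole_trans T S U : ole S T -> ole T U -> ole S U.
Proof. by move=> h1 h2 u; exact: le_trans (h1 u) (h2 u). Qed.

Lemma sa_quad_eq S T : sa S -> sa T ->
  (forall u, rip (S u) u = rip (T u) u) -> S = T.
Proof.
move=> sS sT h; apply/funext => u; apply: hilbert_ext => v.
have := h (u + v); rewrite (opD sS.1) (opD sT.1) !ripDl !ripDr !h.
rewrite (rip_sa sS v u) (rip_sa sT v u) [rip v (S u)]ripC [rip v (T u)]ripC; lra.
Qed.

Lemma ole_anti S T : sa S -> sa T -> ole S T -> ole T S -> S = T.
Proof. by move=> sS sT h1 h2; apply: sa_quad_eq => // u; apply/le_anti/andP. Qed.

Lemma sa_id : sa (id : H -> H).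
Proof. by split; [exact: bounded_id|exact: adj_id]. Qed.
Lemma sa_0 : sa (0 : H -> H).
Proof.
by apply: saP => [|u v]; [exact: bounded0|rewrite !opE rip0l rip0r].
Qed.
Lemma bounded_D S T : bounded_op S -> bounded_op T -> bounded_op (S + T).
Proof. by move=> bS bT; rewrite -[S]scale1r; exact: bounded_lin. Qed.
Lemma bounded_Z a S : bounded_op S -> bounded_op (a *: S).
Proof. by move=> bS; rewrite -[_ *: _]addr0; apply: bounded_lin => //; exact: bounded0. Qed.
Lemma bounded_B S T : bounded_op S -> bounded_op T -> bounded_op (S - T).
Proof. by move=> bS bT; rewrite addrC -scaleN1r; exact: bounded_lin. Qed.
Lemma sa_D S T : sa S -> sa T -> sa (S + T).
Proof.
move=> sS sT; apply: saP; first exact: bounded_D sS.1 sT.1.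
by move=> u v; rewrite !opE ripDl ripDr (rip_sa sS) (rip_sa sT).
Qed.
Lemma sa_B S T : sa S -> sa T -> sa (S - T).
Proof.
move=> sS sT; apply: saP; first exact: bounded_B sS.1 sT.1.
by move=> u v; rewrite !opE ripBl ripBr (rip_sa sS) (rip_sa sT).
Qed.
Lemma sa_Z (c : R) S : sa S -> sa (c%:C%C *: S).
Proof.
move=> sS; apply: saP; first exact: bounded_Z sS.1.
by move=> u v; rewrite !opE ripZl ripZr (rip_sa sS).
Qed.
Lemma sa_sandwich S T : sa S -> sa T -> sa (S \o T \o S).
Proof.
move=> sS sT; apply: saP; first exact: (bounded_comp (bounded_comp sS.1 sT.1) sS.1).
by move=> u v /=; rewrite (rip_sa sS) (rip_sa sT) (rip_sa sS).
Qed.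
Lemma sa_adjM T : bounded_op T -> sa (adj T \o T).
Proof.
move=> bT; have bT' := adj_bounded bT.
apply: saP; first exact: bounded_comp.
by move=> u v /=; rewrite (rip_adj _ _ bT') (adjK bT) rip_adj.
Qed.
Lemma quad_adjM T u : bounded_op T -> rip (adj T (T u)) u = rip (T u) (T u).
Proof. by move=> bT; rewrite -rip_adjr. Qed.

Lemma eff_ge0 T u : eff T -> 0 <= rip (T u) u.
Proof. by case=> _ /(_ u); rewrite opE rip0l. Qed.
Lemma eff_le1 T u : eff T -> rip (T u) u <= rip u u.
Proof. by case=> _ _ /(_ u). Qed.

(** In operator terms, the sum of [k^3 <= k^2] and [0 <= k (1 - k)^2]. *)
Lemma eff_sq k u : eff k -> rip (k u) (k u) <= rip (k u) u.
Proof.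
move=> ek; have [sk _ _] := ek.
have h1 := eff_le1 (k u) ek; have := eff_ge0 (u - k u) ek.
rewrite (opB sk.1) ripBl !ripBr (rip_sa sk (k u) u); lra.
Qed.

Lemma eff_contraction k : eff k -> bounded_by 1 k.
Proof.
move=> ek u; rewrite mul1r; apply: ler_nrm; first exact: nrm_ge0.
by rewrite nrm_sqr; apply: (le_trans (eff_sq u ek)); exact: eff_le1.
Qed.

Lemma eff_id : eff id.
Proof.
by split; [exact: sa_id|move=> u; rewrite opE rip0l rip_ge0|exact: ole_refl].
Qed.
Lemma eff_0 : eff 0.
Proof.
by split; [exact: sa_0|exact: ole_refl|move=> u; rewrite opE rip0l rip_ge0].
Qed.
Lemma eff_compl T : eff T -> eff (id - T).
Proof.
move=> eT; have [sT _ _] := eT; split; first exact: sa_B sa_id sT.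
  by move=> u; rewrite !opE ripBl rip0l subr_ge0 eff_le1.
by move=> u; rewrite !opE ripBl gerBl eff_ge0.
Qed.
Lemma eff_diff S T : eff S -> eff T -> ole S T -> eff (T - S).
Proof.
move=> eS eT ST; have [sS _ _] := eS; have [sT _ _] := eT; split; first exact: sa_B.
  by move=> u; rewrite !opE ripBl rip0l subr_ge0.
move=> u; rewrite !opE ripBl; have := eff_ge0 u eS; have := eff_le1 u eT; rewrite /=; lra.
Qed.

Definition directed F := F !=set0 /\
  forall S T, F S -> F T -> exists U, [/\ F U, ole S U & ole T U].

(** Strong convergence to [S] of [F], a net indexed by itself. That [S] is the least upper bound is
    a consequence: [ssup_ub] and [ssup_lub]. *)
Definition ssup F S := forall u e, 0 < e ->
  exists2 b, F b & forall b', F b' -> ole b b' -> nrm (S u - b' u) <= e.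

Lemma ssup_seq F S (s : seq H) e : directed F -> ssup F S -> 0 < e ->
  exists2 b, F b & forall b' u, F b' -> ole b b' -> u \in s -> nrm (S u - b' u) <= e.
Proof.
move=> [[b0 Fb0] dF] h e0; elim: s => [|u s [b Fb hb]]; first by exists b0.
have [c Fc hc] := h u e e0; have [d [Fd bd cd]] := dF _ _ Fb Fc.
exists d => // b' v Fb' db'; rewrite inE => /orP[/eqP ->|vs].
  by apply: hc => //; exact: ole_trans db'.
by apply: hb => //; exact: ole_trans db'.
Qed.

Lemma ssup_approx F S (s : seq H) e : directed F -> ssup F S -> 0 < e ->
  exists2 b, F b & forall u, u \in s -> nrm (S u - b u) <= e.
Proof.
move=> dF h e0; have [b Fb hb] := ssup_seq s dF h e0.
by exists b => // u us; apply: hb => //; exact: ole_refl.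
Qed.

Section Vigier.
Variable F : set (H -> H).
Hypothesis dF : directed F.
Hypothesis eF : forall b, F b -> eff b.

Let dist b b' u : F b -> F b' -> ole b b' ->
  nrm (b' u - b u) ^+ 2 <= rip (b' u) u - rip (b u) u.
Proof.
move=> Fb Fb' bb'; rewrite nrm_sqr -ripBl.
exact: (eff_sq u (eff_diff (eF Fb) (eF Fb') bb')).
Qed.

(** Vigier's theorem. The numbers [<b u, u>] increase with [b] and are at most [|u|^2]; past an
    almost maximal one, [dist] converts the small increments into small norms [|b' u - b u|]. *)
Lemma ssup_exists : exists S, ssup F S.
Proof.
suff /(@choice _ _ _)[S hS] : forall u, exists l, forall e, 0 < e ->
    exists2 b, F b & forall b', F b' -> ole b b' -> nrm (l - b' u) <= e.
  by exists S => u; exact: hS.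
move=> u.
pose Q d b := forall b', F b' -> ole b b' -> rip (b' u) u <= rip (b u) u + d ^+ 2.
have Qex d : 0 < d -> exists2 b, F b & Q d b.
  move=> d0; pose E := [set rip (b u) u | b in F].
  have hE : has_sup E.
    split; first by case: dF => -[b Fb] _; exists (rip (b u) u); exists b.
    by exists (rip u u) => _ [b Fb <-]; exact/eff_le1/eF.
  have [_ [b Fb <-] hb] := sup_adherent (exprn_gt0 2 d0) hE.
  exists b => // b' Fb' _; rewrite -lerBlDr.
  apply: (le_trans _ (ltW hb)); rewrite lerD2r; apply: ub_le_sup; last by exists b'.
  by case: hE.
have [|||l hl] := @complete_family _ H
    (fun d y => exists b, [/\ F b, Q d b & y = b u]) 1.
- by [].
- by move=> d d0; have [b Fb Qb] := Qex d d0; exists (b u), b.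
- move=> d d' _ _ d0 d0' [b [Fb Qb ->]] [b' [Fb' Qb' ->]]; rewrite mul1r.
  have [c [Fc bc b'c]] := dF.2 _ _ Fb Fb'.
  have aux b1 d1 : 0 < d1 -> F b1 -> Q d1 b1 -> ole b1 c -> nrm (c u - b1 u) <= d1.
    move=> d10 Fb1 Q1 b1c; rewrite -(ler_pXn2r (n := 2)) ?nnegrE ?nrm_ge0 ?(ltW d10)//.
    by apply: (le_trans (dist u Fb1 Fc b1c)); rewrite lerBlDl; exact: Q1.
  apply: (le_trans (nrmB_triangle _ (c u) _)); rewrite nrmB.
  by apply: lerD; exact: aux.
exists l => e e0; have [b Fb Qb] := Qex e e0.
exists b => // b' Fb' bb'; rewrite -[e]mul1r; apply: hl => //.
exists b'; split=> // c Fc b'c.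
apply: (le_trans (Qb _ Fc (ole_trans bb' b'c))).
by rewrite lerD2r; exact: bb'.
Qed.

Variable S : H -> H.
Hypothesis FS : ssup F S.

Lemma ssup_rip u v c : (forall b, F b -> rip (b u) v <= c) -> rip (S u) v <= c.
Proof.
move=> h; apply/ler_addgt0Pr => e e0.
have n1 : 0 < nrm v + 1 by rewrite ltr_wpDl ?nrm_ge0.
have [b Fb hb] := ssup_approx [:: u] dF FS (divr_gt0 e0 n1).
have := rip_le (S u - b u) v; rewrite ripBl => h1.
have h2 := hb u (mem_head _ _); have := h _ Fb => h3.
have h4 : nrm (S u - b u) * nrm v <= e.
  apply: (@le_trans _ _ (e / (nrm v + 1) * (nrm v + 1))).
    by apply: ler_pM; rewrite ?nrm_ge0 ?lerDl.
  by rewrite divfK// gt_eqF.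
lra.
Qed.

Lemma ssup_ub b : F b -> ole b S.
Proof.
move=> Fb u; apply/ler_addgt0Pr => e e0.
have n1 : 0 < nrm u + 1 by rewrite ltr_wpDl ?nrm_ge0.
have [c Fc hc] := ssup_seq [:: u] dF FS (divr_gt0 e0 n1).
have [d [Fd cd bd]] := dF.2 _ _ Fc Fb.
have h2 := hc d u Fd cd (mem_head _ _).
have := rip_cs (S u - d u) u; rewrite ripBl ler_norml => /andP[h1 _].
have h4 : nrm (S u - d u) * nrm u <= e.
  apply: (@le_trans _ _ (e / (nrm u + 1) * (nrm u + 1))).
    by apply: ler_pM; rewrite ?nrm_ge0 ?lerDl.
  by rewrite divfK// gt_eqF.
by have := bd u; lra.
Qed.

Lemma ssup_lub T : (forall b, F b -> ole b T) -> ole S T.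
Proof. by move=> h u; apply: ssup_rip => b /h /(_ u). Qed.

Lemma ssup_eff : eff S.
Proof.
have [[b0 Fb0] _] := dF.
have lS : linear S.
  move=> a u v; apply/subr0_eq/(@nrm_small_eq0 _ _ _ (1 + cabs a + 1)) => e e0.
  have [b Fb hb] := ssup_approx [:: a *: u + v; u; v] dF FS e0.
  have [[bb _] _ _] := eF Fb.
  have h1 := hb (a *: u + v); have h2 := hb u; have h3 := hb v.
  rewrite !inE !eqxx !orbT in h1 h2 h3.
  have -> : S (a *: u + v) - (a *: S u + S v) = (S (a *: u + v) - b (a *: u + v))
      - a *: (S u - b u) - (S v - b v).
    apply: hilbert_ext => w; rewrite (opD bb) (opZ bb) scalerBr.
    by rewrite !(ripBl, ripDl); ring.
  apply: (le_trans (nrmB_le _ _)); rewrite mulrDl mul1r lerD ?h3//.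
  apply: (le_trans (nrmB_le _ _)); rewrite mulrDl mul1r lerD ?h1//.
  by rewrite nrmZ ler_wpM2l ?cabs_ge0 ?h2.
have bS : bounded_op S.
  apply/bounded_opP; split=> //; exists 1; split=> // u; rewrite mul1r.
  apply/ler_addgt0Pr => e e0.
  have [b Fb hb] := ssup_approx [:: u] dF FS e0.
  have := nrm_triangle (S u - b u) (b u); rewrite subrK.
  have := eff_contraction (eF Fb) u; rewrite mul1r.
  have := hb u (mem_head _ _); lra.
have sS : sa S.
  apply: saP => // u v; apply/subr0_eq/normr0_eq0.
  apply: (@small_eq0 _ _ (nrm v + nrm u)) => // e e0.
  have [b Fb hb] := ssup_approx [:: u; v] dF FS e0.
  have [sb _ _] := eF Fb.
  have h1 := hb u; have h2 := hb v; rewrite !inE !eqxx !orbT in h1 h2.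
  have -> : rip (S u) v - rip u (S v) = rip (S u - b u) v - rip u (S v - b v).
    by rewrite ripBl ripBr (rip_sa sb); ring.
  apply: (le_trans (ler_normB _ _)); rewrite mulrDl lerD//.
    by apply: (le_trans (rip_cs _ _)); rewrite mulrC ler_wpM2l ?nrm_ge0 ?h1.
  by apply: (le_trans (rip_cs _ _)); rewrite ler_wpM2l ?nrm_ge0 ?h2.
split=> //.
  by move=> u; apply: le_trans (ssup_ub Fb0 u); have [_ /(_ u)] := eF Fb0.
by apply: ssup_lub => b /eF[].
Qed.
End Vigier.
End Order.

(** * Maximal effects, traces *)

Section Effects.
Variables (R : realType) (H : hilbert R).
Implicit Types (S T b k p q : H -> H) (u v : H) (F Phi N : set (H -> H)).

Lemma vn_ssup N F S : vnalg N -> F `<=` N -> directed F -> (forall b, F b -> eff b) ->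
  ssup F S -> N S.
Proof.
move=> vN FN dF eF FS; have [sS _ _] := ssup_eff dF eF FS.
apply: (vn_limit vN sS.1) => u v e e0.
have [b Fb hb] := ssup_approx [:: u; v] dF FS e0.
by exists b; split; [exact: FN| |]; apply: hb; rewrite !inE eqxx ?orbT.
Qed.

Definition sup_closed Phi := forall F S, F `<=` Phi -> directed F ->
  ssup F S -> eff S -> (forall b, F b -> ole b S) -> Phi S.

(** Zorn's lemma on the members of [Phi] above [b0]: a chain is directed, and its strong supremum
    stays in [Phi]. *)
Lemma eff_maximal Phi b0 : (forall b, Phi b -> eff b) -> sup_closed Phi -> Phi b0 ->
  exists m, [/\ Phi m, ole b0 m & forall b, Phi b -> ole m b -> b = m].
Proof.
move=> eP cP Pb0.
pose X := {b | Phi b /\ ole b0 b}.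
pose r (s t : X) : bool := `[< ole (sval s) (sval t) >].
have x0 : X by exists b0; split=> //; exact: ole_refl.
have [||||m hm] := @Zorn X r.
- by move=> t; apply/asboolP; exact: ole_refl.
- by move=> t s w /asboolP h1 /asboolP h2; apply/asboolP; exact: ole_trans h2.
- move=> [s Ps] [t Pt] /asboolP /= h1 /asboolP /= h2.
  have [es _ _] := eP _ Ps.1; have [et _ _] := eP _ Pt.1.
  have st := ole_anti es et h1 h2; rewrite st in Ps *.
  by congr exist; exact: Prop_irrelevance.
- move=> A tA; have [A0|A0] := pselect (A !=set0); last first.
    by exists x0 => s As; exfalso; apply: A0; exists s.
  pose F := [set sval s | s in A].
  have dF : directed F.
    split; first by case: A0 => s As; exists (sval s), s.
    move=> _ _ [s As <-] [t At <-]; have [st|ts] := tA s t As At.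
      by exists (sval t); split; [exists t|exact/asboolP|exact: ole_refl].
    by exists (sval s); split; [exists s|exact: ole_refl|exact/asboolP].
  have FP : F `<=` Phi by move=> _ [s _ <-]; exact: (svalP s).1.
  have eF b : F b -> eff b by move=> /FP/eP.
  have [S FS] := ssup_exists dF eF.
  have ub := ssup_ub dF FS.
  have PS : Phi S by apply: (cP F) => //; exact: ssup_eff FS.
  have bS : ole b0 S.
    have [s As] := A0; apply: (ole_trans (svalP s).2); apply: ub; by exists s.
  exists (exist _ S (conj PS bS)) => s As; apply/asboolP => /=.
  by apply: ub; exists s.
exists (sval m); split; [exact: (svalP m).1|exact: (svalP m).2|].
move=> b Pb mb.
have bb : ole b0 b by exact: ole_trans (svalP m).2 mb.
have := hm (exist _ b (conj Pb bb)).
by move=> /(_ (asboolT mb)) /(congr1 sval).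
Qed.

Lemma eff_sandwich S T : eff S -> eff T ->
  [/\ eff (S \o T \o S), ole (S \o T \o S) (S \o S) & ole (S \o S) S].
Proof.
move=> eS eT; have [sS _ _] := eS; have [sT _ _] := eT.
have h1 : ole (S \o T \o S) (S \o S).
  by move=> u /=; rewrite (rip_sa sS (T _)) (rip_sa sS (S u) u); exact: eff_le1.
have h2 : ole (S \o S) S by move=> u /=; rewrite (rip_sa sS (S u) u); exact: eff_sq.
split=> //; split; first exact: sa_sandwich.
  by move=> u /=; rewrite !opE rip0l (rip_sa sS (T _)) eff_ge0.
by apply: ole_trans h1 (ole_trans h2 _); case: eS.
Qed.

Lemma projP p : bounded_op p -> adj p = p -> p \o p = p -> eff p.
Proof.
move=> bp ap pp; have sp : sa p by [].
have e u : rip (p u) u = rip (p u) (p u).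
  by rewrite -(rip_sa sp) -[p (p u)]/((p \o p) u) pp.
split=> //; first by move=> u; rewrite opE rip0l e rip_ge0.
move=> u; rewrite e; have := rip_ge0 (u - p u).
by rewrite ripBl !ripBr [rip u (p u)]ripC e; lra.
Qed.

Lemma proj_eff N p : (forall T, N T -> bounded_op T) -> projection N p -> eff p.
Proof. by move=> bN [Np pp ap]; apply: projP => //; exact: bN. Qed.

(** The form of [q] vanishes at [v = q u - u], hence so does that of [b], and [|b v|^2 <= <b v, v>].
    The second identity is the adjoint of the first. *)
Lemma eff_below_proj b q : eff b -> eff q -> q \o q = q -> ole b q ->
  b \o q = b /\ q \o b = b.
Proof.
move=> eb eq qq bq; have [sb _ _] := eb; have [sq _ _] := eq.
have h : b \o q = b.
  apply/funext => u /=; apply/subr0_eq/nrm_eq0.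
  rewrite -(opB sb.1); have : rip (b (q u - u)) (q u - u) <= 0.
    apply: (le_trans (bq _)); rewrite (opB sq.1).
    by rewrite -[q (q u)]/((q \o q) u) qq subrr rip0l.
  move=> h; apply/eqP; rewrite eq_le nrm_ge0 andbT; apply: ler_nrm => //.
  by rewrite expr0n; apply: (le_trans (eff_sq _ eb)).
split=> //; apply/funext => u; apply: hilbert_ext => v /=.
by rewrite !(rip_sa sq, rip_sa sb) -[b (q v)]/((b \o q) v) h.
Qed.

Lemma sub_proj p q : bounded_op p -> bounded_op q -> adj p = p -> adj q = q ->
  q \o p = p -> p \o q = p -> p \o p = p -> q \o q = q ->
  (q - p) \o (q - p) = q - p.
Proof.
move=> bp bq ap aq qp pq pp qq; apply/funext => u /=; rewrite !opE.
rewrite (opB bp) (opB bq) -[q (q u)]/((q \o q) u) -[q (p u)]/((q \o p) u).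
by rewrite -[p (q u)]/((p \o q) u) -[p (p u)]/((p \o p) u) qq qp pq pp subrr subr0.
Qed.

End Effects.

Section Trace.
Variables (R : realType) (H : hilbert R) (M N : set (H -> H)) (tau : (H -> H) -> R[i]).
Hypothesis vM : vnalg M.
Hypothesis tM : tracial_state M tau.
Hypothesis vN : vnalg N.
Hypothesis NM : N `<=` M.
Implicit Types (S T : H -> H).

Definition retr T : R := complex.Re (tau T).

Lemma tauD S T : N S -> N T -> tau (S + T) = tau S + tau T.
Proof.
move=> NS NT; have := tau_linear tM 1 (NM NS) (NM NT).
by rewrite scale1r mul1r.
Qed.
Lemma tau0 : tau 0 = 0.
Proof.
have N0 := vn_0 vN; have := tauD N0 N0; rewrite addr0 => h.
by apply: (addrI (tau 0)); rewrite addr0.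
Qed.
Lemma tauZ a S : N S -> tau (a *: S) = a * tau S.
Proof.
by move=> NS; have := tau_linear tM a (NM NS) (NM (vn_0 vN)); rewrite tau0 !addr0.
Qed.
Lemma tauN S : N S -> tau (- S) = - tau S.
Proof. by move=> NS; rewrite -scaleN1r tauZ// mulN1r. Qed.
Lemma tauB S T : N S -> N T -> tau (S - T) = tau S - tau T.
Proof.
move=> NS NT; rewrite tauD ?tauN//.
by rewrite -scaleN1r; exact: (vn_Z vN).
Qed.
Lemma tau_sum (J : Type) (r : seq J) (F : J -> H -> H) : (forall j, N (F j)) ->
  tau (\sum_(j <- r) F j) = \sum_(j <- r) tau (F j).
Proof.
move=> hF; elim: r => [|j r IH]; first by rewrite !big_nil tau0.
by rewrite !big_cons tauD ?IH//; exact: (vn_sum vN).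
Qed.
Lemma tau_comm S T : N S -> N T -> tau (S \o T) = tau (T \o S).
Proof. by move=> /NM MS /NM MT; exact: (tau_trace tM). Qed.

Lemma retrB S T : N S -> N T -> retr (S - T) = retr S - retr T.
Proof. by move=> NS NT; rewrite /retr tauB// cReB. Qed.
Lemma retrD S T : N S -> N T -> retr (S + T) = retr S + retr T.
Proof. by move=> NS NT; rewrite /retr tauD// cReD. Qed.
Lemma retrZ (c : R) S : N S -> retr (c%:C%C *: S) = c * retr S.
Proof. by move=> NS; rewrite /retr tauZ// cRe_Zr. Qed.
Lemma retr_id : retr id = 1.
Proof. by rewrite /retr (tau_unit tM). Qed.

Lemma op_le_refl T : op_le T T.
Proof. by move=> u; rewrite subrr -[dotp _ _ _]/(ip _ _) ip0l. Qed.

(* Positivity on all positive operators follows from normality for {0, a}. *)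
Lemma tau_ge0 a : N a -> sa a -> ole 0 a -> 0 <= tau a.
Proof.
move=> Na sa_a a0; have le0 : op_le 0 a by apply/(op_leE (@sa_0 _ _) sa_a).
have [] := @tau_normal _ _ _ _ tM [set 0; a] a.
- by move=> _ [->|->]; apply: NM => //; exact: (vn_0 vN).
- split; first by exists a; right.
  move=> S T [->|->] [->|->]; exists a; split=> //; try (by right); exact: op_le_refl.
- by move=> T [->|->]//; exact: op_le_refl.
- split; first exact: NM.
    by move=> T [->|->]//; exact: op_le_refl.
  by move=> S' _; apply; right.
by move=> ub _; have := ub (tau 0) (ex_intro2 _ _ 0 (or_introl erefl) erefl); rewrite tau0.
Qed.

Lemma retr_ge0 a : N a -> sa a -> ole 0 a -> 0 <= retr a.
Proof. by move=> Na sa_a a0; have /cge0P[] := tau_ge0 Na sa_a a0. Qed.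

Lemma retr_le a b : N a -> N b -> sa a -> sa b -> ole a b -> retr a <= retr b.
Proof.
move=> Na Nb sa_a sb ab; rewrite -subr_ge0 -retrB//.
apply: retr_ge0; [exact: (vn_B vN)|exact: sa_B|].
by move=> u; rewrite !opE rip0l ripBl subr_ge0.
Qed.

Lemma tau_Im a : N a -> eff a -> complex.Im (tau a) = 0.
Proof. by move=> Na [sa_a a0 _]; have /cge0P[] := tau_ge0 Na sa_a a0. Qed.

Lemma retr_normal F S e : F `<=` N -> directed F -> (forall b, F b -> eff b) ->
  ssup F S -> 0 < e -> exists2 b, F b & retr S - e <= retr b.
Proof.
move=> FN dF eF FS e0; have NS := vn_ssup vN FN dF eF FS.
have eS := ssup_eff dF eF FS; have [sS _ _] := eS.
have sF b : F b -> sa b by case/eF.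
apply: contrapT => hn.
have [] := @tau_normal _ _ _ _ tM F S.
- by move=> T /FN/NM.
- split; first by case: dF.
  move=> A B FA FB; have [U [FU AU BU]] := dF.2 _ _ FA FB.
  by exists U; split=> //; apply/op_leE => //; exact: sF.
- by move=> T FT; apply/op_leE; [exact: sa_0|exact: sF|case: (eF _ FT)].
- split; first exact: NM.
    by move=> T FT; apply/op_leE => //; [exact: sF|exact: (ssup_ub dF FS)].
  (* The competing bound [S'] ranges over [M] and is not known to be self-adjoint; [op_le] with a
     member of [F] makes its quadratic form real. *)
  move=> S' MS' hS' u; have [[b Fb] _] := dF.
  have bS' := vnalg_bounded vM MS'.
  have hh T : F T -> complex.Im (ip (S' u) u) = 0 /\ rip (T u) u <= rip (S' u) u.
    move=> FT; have := hS' _ FT u; rewrite -[dotp _ _ _]/(ip _ _) ipBl => /cge0P[].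
    rewrite cReB cImB (sa_Im u (sF _ FT)).
    by rewrite /rip; split; lra.
  apply/cge0P; rewrite -[dotp _ _ _]/(ip _ _) ipBl; split.
    rewrite cImB (sa_Im u sS).
    by have [-> _] := hh _ Fb; lra.
  rewrite cReB subr_ge0; apply: (ssup_rip dF FS) => T FT.
  by have [] := hh _ FT.
(* If every [retr b] were below [retr S - e], then [tau S - e] would bound all the [tau b], against
   normality. *)
move=> _ lub; have : tau S <= tau S - e%:C%C.
  apply: lub => _ [b Fb <-]; rewrite -subr_ge0; apply/cge0P; split.
    rewrite !cImB /= !tau_Im//; [lra|exact: FN|exact: eF].
  rewrite !cReB /=; rewrite leNgt; apply/negP => hlt; apply: hn; exists b => //.
  by rewrite /retr; lra.
by rewrite -subr_ge0 addrAC subrr sub0r => /cge0P[_ /=]; lra.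
Qed.

End Trace.

(** * Left and right multiplications on the completion *)

Section L2.
Variables (R : realType) (H : hilbert R) (M N : set (H -> H)) (tau : (H -> H) -> R[i]).
Hypothesis tM : tracial_state M tau.
Hypothesis vN : vnalg N.
Hypothesis NM : N `<=` M.
Variable L : l2space N tau.
Implicit Types (S T : H -> H) (u v : L).
Notation emb := (l2_emb L).

Let bN T : N T -> bounded_op T. Proof. exact: vnalg_bounded. Qed.
Let aN T : N T -> N (adj T). Proof. exact: vnalg_adj. Qed.
Let cN S T : N S -> N T -> N (S \o T). Proof. exact: vn_comp. Qed.

Lemma sub_N : lin_subspace N.
Proof. by split; [exact: vn_0|move=> a S T; exact: vn_lin]. Qed.

Lemma emb_lin a S T : N S -> N T -> emb (a *: S + T) = a *: emb S + emb T.
Proof. exact: l2_linear. Qed.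
Lemma emb0 : emb 0 = 0.
Proof.
have N0 := vn_0 vN; apply: (addrI (emb 0)); rewrite addr0.
by have := emb_lin 1 N0 N0; rewrite !scale1r addr0.
Qed.
Lemma embD S T : N S -> N T -> emb (S + T) = emb S + emb T.
Proof. by move=> NS NT; have := emb_lin 1 NS NT; rewrite !scale1r. Qed.
Lemma embZ a S : N S -> emb (a *: S) = a *: emb S.
Proof. by move=> NS; have := emb_lin a NS (vn_0 vN); rewrite emb0 !addr0. Qed.
Lemma embB S T : N S -> N T -> emb (S - T) = emb S - emb T.
Proof. by move=> NS NT; rewrite addrC -scaleN1r emb_lin// scaleN1r addrC. Qed.
Lemma emb_sum (J : Type) (r : seq J) (F : J -> H -> H) : (forall j, N (F j)) ->
  emb (\sum_(j <- r) F j) = \sum_(j <- r) emb (F j).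
Proof.
move=> hF; elim: r => [|j r IH]; first by rewrite !big_nil emb0.
by rewrite !big_cons embD ?IH//; exact: (vn_sum vN).
Qed.

Lemma ip_emb S T : N S -> N T -> ip (emb S) (emb T) = tau (adj T \o S).
Proof. exact: l2_dot. Qed.
Lemma nrm_emb S : N S -> nrm (emb S) ^+ 2 = retr tau (adj S \o S).
Proof. by move=> NS; rewrite nrm_sqr /rip ip_emb. Qed.

Lemma nrm_emb_adj S : N S -> nrm (emb (adj S)) = nrm (emb S).
Proof.
move=> NS; apply: (@pexpIrn _ 2); rewrite ?nnegrE ?nrm_ge0// !nrm_emb//; last exact: aN.
by rewrite (adjK (bN NS)) /retr (tau_comm tM NM)//; exact: aN.
Qed.

Lemma nrm_emb_lmul k S T : 0 <= k -> bounded_by k T -> N T -> N S ->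
  nrm (emb (T \o S)) <= k * nrm (emb S).
Proof.
move=> k0 kT NT NS.
rewrite -(ler_pXn2r (n := 2)) ?nnegrE ?mulr_ge0 ?nrm_ge0// exprMn !nrm_emb//; last exact: cN.
rewrite -(retrZ tM vN NM); last by apply: cN => //; exact: aN.
have bTS := bounded_comp (bN NT) (bN NS).
apply: (retr_le tM vN NM).
- by apply: cN; [apply: aN|]; exact: cN.
- by apply: (vn_Z vN); apply: cN => //; exact: aN.
- exact: sa_adjM.
- by apply: sa_Z; apply: sa_adjM; exact: bN.
move=> u; rewrite !opE ripZl /= (quad_adjM _ bTS) (quad_adjM _ (bN NS)).
by rewrite -!nrm_sqr -exprMn ler_pXn2r ?nnegrE ?mulr_ge0 ?nrm_ge0//; exact: kT.
Qed.

Lemma nrm_emb_rmul k S T : 0 <= k -> bounded_by k T -> N T -> N S ->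
  nrm (emb (S \o T)) <= k * nrm (emb S).
Proof.
move=> k0 kT NT NS; rewrite -(nrm_emb_adj (cN NS NT)) -(nrm_emb_adj NS).
rewrite (adj_comp (bN NS) (bN NT)); apply: nrm_emb_lmul => //; try exact: aN.
by apply: adj_bounded_by => //; exact: bN.
Qed.

Lemma N_bound T : N T -> exists2 k, 0 <= k & bounded_by k T.
Proof. by move=> /bN/bounded_opP[_ [k [k0 kT]]]; exists k. Qed.

Lemma emb_dense u e : 0 < e -> exists2 S, N S & nrm (u - emb S) <= e.
Proof.
move=> e0; have [_ [S NS <-] h] := (denseP _).1 (@l2_dense R H N tau L) u e e0.
by exists S.
Qed.

Lemma emb_ext (K : hilbert R) (U U' : L -> K) : bounded_op U -> bounded_op U' ->
  (forall S, N S -> U (emb S) = U' (emb S)) -> U = U'.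
Proof.
by move=> bU bU' h; apply: (dense_ext_unique (@l2_dense R H N tau L)) => // _ [S NS <-]; exact: h.
Qed.

Lemma emb_extend (B : (H -> H) -> L) k : 0 <= k ->
  (forall a S T, N S -> N T -> B (a *: S + T) = a *: B S + B T) ->
  (forall S, N S -> nrm (B S) <= k * nrm (emb S)) ->
  exists U : L -> L, [/\ bounded_op U, bounded_by k U & forall S, N S -> U (emb S) = B S].
Proof.
move=> k0 lB bB.
have [U UE] := @ext_exists R L L _ N emb B k sub_N emb_lin lB k0 bB.
exists U; split; [|exact: ext_bound UE|exact: ext_val UE].
by apply/bounded_opP; split; [exact: ext_lin UE|exists k; split=> //; exact: ext_bound UE].
Qed.

Lemma comp_lin a S T (U : H -> H) : (a *: S + T) \o U = a *: (S \o U) + (T \o U).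
Proof. by []. Qed.
Lemma comp_linr a S T (U : H -> H) : bounded_op U -> U \o (a *: S + T) = a *: (U \o S) + (U \o T).
Proof. by move=> bU; apply/funext => u; rewrite /= !opE /= (opD bU) (opZ bU). Qed.

(** Mirror image of [l2_lmul]; for [T] in [N] the default value is never taken, by [rmulP].
    Boundedness comes from the trace property, which makes the adjoint isometric for the 2-norm. *)
Definition rmul T : L -> L :=
  xget (0 : L -> L) [set U : L -> L | bounded_op U /\
    forall S, N S -> U (emb S) = emb (S \o T)].
Definition lmul T : L -> L := @l2_lmul R H N tau L T.

Lemma lmulP T k : N T -> 0 <= k -> bounded_by k T ->
  [/\ bounded_op (lmul T), bounded_by k (lmul T) &
    forall S, N S -> lmul T (emb S) = emb (T \o S)].
Proof.
move=> NT k0 kT.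
have [|S NS|U [bU kU hU]] := @emb_extend (fun S => emb (T \o S)) k k0.
- by move=> a S S' NS NS'; rewrite comp_linr ?emb_lin//; [exact: cN|exact: cN|exact: bN].
- exact: nrm_emb_lmul.
have [blT hlT] : bounded_op (lmul T) /\ forall S, N S -> lmul T (emb S) = emb (T \o S).
  by rewrite /lmul /l2_lmul; case: xgetP => [U' _ []//|/(_ U)]; case.
have -> // : lmul T = U by apply: emb_ext => // S NS; rewrite hlT ?hU.
Qed.

Lemma rmulP T k : N T -> 0 <= k -> bounded_by k T ->
  [/\ bounded_op (rmul T), bounded_by k (rmul T) &
    forall S, N S -> rmul T (emb S) = emb (S \o T)].
Proof.
move=> NT k0 kT.
have [|S NS|U [bU kU hU]] := @emb_extend (fun S => emb (S \o T)) k k0.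
- by move=> a S S' NS NS'; rewrite comp_lin emb_lin//; exact: cN.
- exact: nrm_emb_rmul.
have [blT hlT] : bounded_op (rmul T) /\ forall S, N S -> rmul T (emb S) = emb (S \o T).
  by rewrite /rmul; case: xgetP => [U' _ []//|/(_ U)]; case.
have -> // : rmul T = U by apply: emb_ext => // S NS; rewrite hlT ?hU.
Qed.

Lemma lmul_bounded T : N T -> bounded_op (lmul T).
Proof. by move=> NT; have [k k0 kT] := N_bound NT; have [] := lmulP NT k0 kT. Qed.
Lemma lmulE T S : N T -> N S -> lmul T (emb S) = emb (T \o S).
Proof. by move=> NT NS; have [k k0 kT] := N_bound NT; have [_ _ ->] := lmulP NT k0 kT. Qed.
Lemma lmul_bounded_by T k : N T -> 0 <= k -> bounded_by k T -> bounded_by k (lmul T).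
Proof. by move=> NT k0 kT; have [] := lmulP NT k0 kT. Qed.
Lemma rmul_bounded T : N T -> bounded_op (rmul T).
Proof. by move=> NT; have [k k0 kT] := N_bound NT; have [] := rmulP NT k0 kT. Qed.
Lemma rmulE T S : N T -> N S -> rmul T (emb S) = emb (S \o T).
Proof. by move=> NT NS; have [k k0 kT] := N_bound NT; have [_ _ ->] := rmulP NT k0 kT. Qed.
Lemma rmul_bounded_by T k : N T -> 0 <= k -> bounded_by k T -> bounded_by k (rmul T).
Proof. by move=> NT k0 kT; have [] := rmulP NT k0 kT. Qed.

Lemma adj_op (U U' : L -> L) : bounded_op U -> bounded_op U' ->
  (forall S T, N S -> N T -> ip (U (emb S)) (emb T) = ip (emb S) (U' (emb T))) ->
  adj U = U'.
Proof.
move=> bU bU' h; apply: emb_ext => // [|T NT]; first exact: adj_bounded.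
apply/subr0_eq/(@nrm_small_eq0 _ _ _ (nrm (adj U (emb T) - U' (emb T)) + 1)) => e e0.
set w := adj U (emb T) - U' (emb T).
have [S NS hS] := emb_dense w e0.
have : rip (emb S) w = 0.
  by rewrite ripBr -rip_adj// /rip h// subrr.
have := rip_le (w - emb S) w; rewrite ripBl -nrm_sqr => h1 h2.
have h3 : nrm (w - emb S) * nrm w <= e * nrm w by rewrite ler_wpM2r ?nrm_ge0.
have [->|n0] := eqVneq (nrm w) 0; first by rewrite add0r mul1r ltW.
have np : 0 < nrm w by rewrite lt_neqAle eq_sym n0 nrm_ge0.
have : nrm w ^+ 2 <= e * nrm w by move: h1 h3; rewrite h2; lra.
rewrite expr2 ler_pM2r// => h4; apply: (le_trans h4).
by rewrite ler_peMl ?lerDr ?nrm_ge0 ?ltW.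
Qed.

Lemma adj_lmul T : N T -> adj (lmul T) = lmul (adj T).
Proof.
move=> NT; have NT' := aN NT.
apply: adj_op; [exact: lmul_bounded|exact: lmul_bounded|].
move=> S S' NS NS'; rewrite !lmulE// !ip_emb//; [|exact: cN|exact: cN].
by rewrite (adj_comp (bN NT') (bN NS')) (adjK (bN NT)).
Qed.

Lemma adj_rmul T : N T -> adj (rmul T) = rmul (adj T).
Proof.
move=> NT; have NT' := aN NT.
apply: adj_op; [exact: rmul_bounded|exact: rmul_bounded|].
move=> S S' NS NS'; have NS'' := aN NS'.
rewrite !rmulE// !ip_emb//; [|exact: cN|exact: cN].
rewrite (adj_comp (bN NS') (bN NT')) (adjK (bN NT)).
by rewrite -compA [RHS](tau_comm tM NM)//; exact: cN.
Qed.

Lemma rip_lmul T u v : N T -> rip (lmul T u) v = rip u (lmul (adj T) v).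
Proof. by move=> NT; rewrite -adj_lmul// rip_adj//; exact: lmul_bounded. Qed.
Lemma rip_rmul T u v : N T -> rip (rmul T u) v = rip u (rmul (adj T) v).
Proof. by move=> NT; rewrite -adj_rmul// rip_adj//; exact: rmul_bounded. Qed.
Lemma ip_lmul T u v : N T -> ip (lmul T u) v = ip u (lmul (adj T) v).
Proof. by move=> NT; rewrite -adj_lmul// adjP//; exact: lmul_bounded. Qed.

Lemma ip_rmul T u v : N T -> ip (rmul T u) v = ip u (rmul (adj T) v).
Proof. by move=> NT; rewrite -adj_rmul// adjP//; exact: rmul_bounded. Qed.

Lemma rmul_comp S T u : N S -> N T -> rmul (S \o T) u = rmul T (rmul S u).
Proof.
move=> NS NT; suff -> : rmul (S \o T) = rmul T \o rmul S by [].
apply: emb_ext => [||U NU]; first exact/rmul_bounded/cN.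
  by apply: bounded_comp; exact: rmul_bounded.
by rewrite /= !rmulE//; exact: cN.
Qed.
Lemma rmul_id u : rmul id u = u.
Proof.
suff -> : rmul id = id by [].
apply: emb_ext => [||S NS]; [exact/rmul_bounded/(vn_id vN)|exact: bounded_id|].
by rewrite rmulE//; exact: vn_id.
Qed.
Lemma rmul_sum (J : Type) (r : seq J) (F : J -> H -> H) u : (forall j, N (F j)) ->
  rmul (\sum_(j <- r) F j) u = \sum_(j <- r) rmul (F j) u.
Proof.
move=> hF; have hs s : N (\sum_(j <- s) F j) by exact: (vn_sum vN).
have b0 : rmul 0 = 0.
  apply: emb_ext => [||S NS]; [exact/rmul_bounded/(vn_0 vN)|exact: bounded0|].
  rewrite rmulE//; last exact: (vn_0 vN).
  have -> : S \o (0 : H -> H) = 0 by apply/funext => w /=; rewrite (op0 (bN NS)).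
  by rewrite emb0.
elim: r => [|j r IH]; first by rewrite !big_nil b0.
rewrite !big_cons -IH.
suff -> : rmul (F j + \sum_(i <- r) F i) = rmul (F j) + rmul (\sum_(i <- r) F i) by [].
apply: emb_ext => [||S NS].
- by apply/rmul_bounded/(vn_D vN).
- by apply: bounded_D; exact: rmul_bounded.
rewrite rmulE//; last exact: (vn_D vN).
rewrite opE !rmulE// -embD//; [|exact: cN|exact: cN]; congr emb.
by apply/funext => w; rewrite /= !opE /= (opD (bN NS)).
Qed.

End L2.
Arguments lmul {R H N tau} L T _.
Arguments rmul {R H N tau} L T _.

(** * Density *)

Section Density.
Variables (R : realType) (H : hilbert R) (M N : set (H -> H)) (tau : (H -> H) -> R[i]).
Hypothesis vM : vnalg M.
Hypothesis tM : tracial_state M tau.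
Hypothesis vN : vnalg N.
Hypothesis NM : N `<=` M.
Variable L : l2space N tau.
Implicit Types (S T : H -> H) (V : H -> L).
Notation emb := (l2_emb L).
Notation lmul := (lmul L).
Notation rmul := (rmul L).

Let bN T : N T -> bounded_op T. Proof. exact: vnalg_bounded. Qed.
Let aN T : N T -> N (adj T). Proof. exact: vnalg_adj. Qed.
Let cN S T : N S -> N T -> N (S \o T). Proof. exact: vn_comp. Qed.

Lemma eff_nrm_emb k : N k -> eff k -> nrm (emb k) ^+ 2 <= retr tau k.
Proof.
move=> Nk ek; have [[bk ak] _ _] := ek; rewrite nrm_emb// ak.
have [e1 _ e2] := eff_sandwich ek (eff_id H).
by apply: (retr_le tM vN NM) => //; [exact: cN|case: e1].
Qed.

(* Vectors of the form [V h], with [V] an intertwiner, are shown to span a dense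
   subspace: otherwise the ideal of all [c] with [emb c] in the span is proper. *)
Definition intertwiner V := bounded_op V /\ forall T h, N T -> V (T h) = lmul T (V h).
Definition iperp (z : L) := forall V h, intertwiner V -> rip (V h) z = 0.
Definition ideal (c : H -> H) := N c /\ forall z, iperp z -> rip (emb c) z = 0.

Lemma iperp_lmul z T : N T -> iperp z -> iperp (lmul T z).
Proof.
move=> NT hz V h iV; rewrite ripC (rip_lmul tM vN NM)// ripC.
by rewrite -iV.2 ?hz//; exact: aN.
Qed.

Lemma ideal_l c T : N T -> ideal c -> ideal (T \o c).
Proof.
move=> NT [Nc hc]; split; first exact: cN.
move=> z hz; rewrite -(lmulE tM vN NM)// (rip_lmul tM vN NM)//.
by apply: hc; apply: iperp_lmul => //; exact: aN.
Qed.

Lemma ideal_D c d : ideal c -> ideal d -> ideal (c + d).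
Proof.
move=> [Nc hc] [Nd hd]; split; first exact: (vn_D vN).
by move=> z hz; rewrite embD// ripDl hc ?hd ?addr0.
Qed.

(** [|S - b|_2^2 <= tau (S - b)] for the effect [S - b], and the right side is small by normality;
    so [emb S] is a limit of vectors [emb b]. *)
Lemma ideal_sup : sup_closed [set b | eff b /\ ideal b].
Proof.
move=> F S FP dF FS eS ub.
have eF b : F b -> eff b by move=> /FP[].
have FN : F `<=` N by move=> b /FP[_ []].
have NS := vn_ssup vN FN dF eF FS.
split=> //; split=> // z hz; apply/normr0_eq0.
apply: (@small_eq0 _ _ (nrm z)) => // e e0.
have [b Fb hb] := retr_normal vM tM vN NM FN dF eF FS (exprn_gt0 2 e0).
have Nb := FN _ Fb; have [_ [_ Ib]] := FP _ Fb.
have -> : rip (emb S) z = rip (emb (S - b)) z by rewrite embB// ripBl Ib// subr0.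
apply: (le_trans (rip_cs _ _)); rewrite mulrC ler_wpM2l ?nrm_ge0//.
rewrite -(ler_pXn2r (n := 2)) ?nnegrE ?nrm_ge0 ?(ltW e0)//.
have eSb : eff (S - b) by apply: eff_diff => //; [exact: eF|exact: ub].
apply: (le_trans (eff_nrm_emb (vn_B vN NS Nb) eSb)).
by rewrite (retrB tM vN NM)//; lra.
Qed.

(** The map [t w |-> emb (t \o c)] is a contraction on [N w]. Extended by 0 on the orthogonal
    complement, it stays [N]-linear, because the closure of [N w] is invariant under [N] and [N] is
    closed under adjoints. *)
Lemma intertwiner_exists (w : H) (c : H -> H) : N c ->
  (forall t, N t -> nrm (emb (t \o c)) <= nrm (t w)) ->
  exists2 V, intertwiner V & V w = emb c.
Proof.
move=> Nc hc.
have [||||V VE] := @ext_exists R H L _ N (fun t => t w) (fun t => emb (t \o c)) 1 (sub_N vN).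
- by [].
- by move=> a s t Ns Nt; rewrite comp_lin emb_lin//; exact: cN.
- by [].
- by move=> t Nt; rewrite mul1r; exact: hc.
have Vw : V w = emb c by have := ext_val VE (vn_id vN).
exists V => //; split.
  by apply/bounded_opP; split; [exact: ext_lin VE|exists 1; split=> //; exact: ext_bound VE].
move=> T h NT; have [k k0 kT] := N_bound vN NT.
apply: (ext_intertwine ler01 VE (Sa := adj T) (k := k)) => //.
- exact: op_lin (bN NT).
- exact: op_lin (lmul_bounded tM vN NM L NT).
- by move=> u v; apply: rip_adj; exact: bN.
- by apply: adj_bounded_by => //; exact: bN.
- exact: (lmul_bounded_by tM vN NM).
- move=> t e Nt e0; have e1 := ltW e0.
  have -> : lmul T (emb (t \o c)) = emb ((T \o t) \o c).
    by rewrite (lmulE tM vN NM L NT (cN Nt Nc)).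
  by exists (T \o t); rewrite !subrr !nrm0; split=> //; exact: cN.
- move=> t e Nt e0; exists (adj T \o t); first by apply: cN => //; exact: aN.
  by rewrite subrr nrm0; exact: ltW.
Qed.

(* Let [c = id - b], with [b] a maximal effect in the ideal, and [c h <> 0]. A
   comparison of [tau (c _ c)] with the vector functional at [w], by a maximal
   effect [x], yields [y = id - x] and an intertwiner sending [y w] to [y c]. Then
   [b + c y^2 c] is in the ideal, whence [y c = 0], a contradiction. *)
Lemma ideal_id : ideal id.
Proof.
have I0 : ideal 0.
  by split=> [|z _]; [exact: (vn_0 vN)|rewrite (emb0 vN) rip0l].
have [|||b [[eb Ib] _ maxb]] := @eff_maximal R H [set b | eff b /\ ideal b] 0.
- by move=> ? [].
- exact: ideal_sup.
- by split=> //; exact: eff_0.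
have Nb := Ib.1.
pose c : H -> H := id - b.
have ec : eff c := eff_compl eb; have Nc : N c by exact: (vn_B vN (vn_id vN)).
have [sc _ _] := ec.
have [c0|] := pselect (forall h, c h = 0).
  suff -> : id = b by [].
  by apply/funext => h; apply/subr0_eq; exact: c0.
move=> /existsNP[h ch]; exfalso.
have Ncc := cN Nc Nc.
have [e1 _ e2] := eff_sandwich ec (eff_id H).
have tcc : 0 <= retr tau (c \o c).
  by apply: (retr_ge0 tM vN NM) => //; case: e1.
have np : 0 < nrm (c h) ^+ 2.
  rewrite exprn_gt0// lt_neqAle nrm_ge0 andbT eq_sym; apply/eqP => /nrm_eq0.
  exact: ch.
(* The factor [l] is at least 1 and makes [|w|^2 = l^2 |c h|^2] exceed [tau (c c)]; this strict
   inequality is what the maximal [x] contradicts in the end. *)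
pose l := 1 + (retr tau (c \o c) + 1) / nrm (c h) ^+ 2.
pose w := c (l%:C%C *: h).
have hw : retr tau (c \o c) < rip w w.
  rewrite /w (opZ sc.1) ripZl ripZr -nrm_sqr /l.
  set t := retr tau _ in tcc *; set n := nrm _ ^+ 2 in np *; set q := (t + 1) / n.
  have q1 : q * n = t + 1 by rewrite divfK// gt_eqF.
  have q0 : 0 <= q by rewrite divr_ge0 ?(ltW np)// addr_ge0.
  nra.
have NccT x : N x -> N (c \o x \o c) by move=> Nx; apply: cN => //; exact: cN.
have c0c : c \o 0 \o c = 0.
  by apply/funext => u /=; rewrite !opE (op0 sc.1).
pose P2 := [set x | [/\ N x, eff x & rip (x w) w <= retr tau (c \o x \o c)]].
have [|||x [[Nx ex hx] _ maxx]] := @eff_maximal R H P2 0.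
- by move=> ? [].
- move=> F S FP dF FS eS ub.
  have eF z : F z -> eff z by move=> /FP[].
  have FN : F `<=` N by move=> z /FP[].
  have NS := vn_ssup vN FN dF eF FS; split=> //.
  apply: (ssup_rip dF FS) => z Fz; have [Nz ez hz] := FP _ Fz.
  apply: (le_trans hz); apply: (retr_le tM vN NM) => //; try exact: NccT.
  + by apply: sa_sandwich => //; case: ez.
  + by apply: sa_sandwich => //; case: eS.
  + move=> u /=; rewrite (rip_sa sc (z _)) (rip_sa sc (S _)); exact: ub.
- split; [exact: (vn_0 vN)|exact: eff_0|].
  by rewrite opE rip0l c0c /retr (tau0 tM vN NM).
pose y : H -> H := id - x.
have ey : eff y := eff_compl ex; have Ny : N y by exact: (vn_B vN (vn_id vN)).
have [sy _ _] := ey; have Nyc := cN Ny Nc.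
(* Otherwise [x + y z y] would be a larger member of [P2]; it is still an effect because
   [y z y <= y^2 <= y = 1 - x]. *)
have key z : N z -> eff z ->
    retr tau (c \o (y \o z \o y) \o c) <= rip ((y \o z \o y) w) w.
  move=> Nz ez; rewrite leNgt; apply/negP => hlt.
  have [es es1 es2] := eff_sandwich ey ez.
  have Ns : N (y \o z \o y) by apply: cN => //; exact: cN.
  have xs : x + (y \o z \o y) = x.
    apply: maxx; last by move=> u; rewrite !opE ripDl lerDl eff_ge0.
    split; first exact: (vn_D vN).
      split; first by apply: sa_D; [case: ex|case: es].
        by move=> u; rewrite !opE rip0l ripDl addr_ge0 ?eff_ge0.
      move=> u; rewrite opE ripDl.
      have yE : rip (y u) u = rip u u - rip (x u) u by rewrite /y !opE ripBl.
      by move: (es1 u) (es2 u); rewrite yE /=; lra.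
    have -> : c \o (x + (y \o z \o y)) \o c =
        (c \o x \o c) + (c \o (y \o z \o y) \o c).
      by apply/funext => u; rewrite /= !opE /= (opD sc.1).
    rewrite (retrD tM NM); [|exact: NccT|exact: NccT].
    by rewrite opE ripDl; apply: lerD => //; exact: ltW.
  have s0 : y \o z \o y = 0 by apply: (addrI x); rewrite addr0.
  by move: hlt; rewrite s0 c0c /retr (tau0 tM vN NM) opE rip0l ltxx.
have [V iV Vw] : exists2 V, intertwiner V & V (y w) = emb (y \o c).
  apply: intertwiner_exists => // t Nt.
  have [k k0 kt] := N_bound vN Nt; have bt := bN Nt.
  have kp : 0 < k ^+ 2 + 1 by rewrite ltr_wpDl// sqr_ge0.
  (* [key] concerns effects, so [adj t \o t] is scaled down by more than its norm; the factor
     cancels at the end. *)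
  pose z : H -> H := ((k ^+ 2 + 1)^-1)%:C%C *: (adj t \o t).
  have Ntt : N (adj t \o t) by apply: cN => //; exact: aN.
  have Nz : N z by exact: (vn_Z vN).
  have zE u : rip (z u) u = (k ^+ 2 + 1)^-1 * nrm (t u) ^+ 2.
    by rewrite /z opE ripZl /= (quad_adjM _ bt) nrm_sqr.
  have ez : eff z.
    split; first by apply: sa_Z; exact: sa_adjM.
      by move=> u; rewrite zE opE rip0l mulr_ge0 ?sqr_ge0// invr_ge0 ltW.
    move=> u; rewrite zE ler_pdivrMl// -nrm_sqr.
    apply: (@le_trans _ _ ((k * nrm u) ^+ 2)).
      by rewrite ler_pXn2r ?nnegrE ?mulr_ge0 ?nrm_ge0//; exact: kt.
    by rewrite exprMn mulrDl mul1r lerDl sqr_ge0.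
  rewrite -(ler_pXn2r (n := 2)) ?nnegrE ?nrm_ge0// nrm_emb//; last exact: cN.
  have := key _ Nz ez.
  have -> : c \o (y \o z \o y) \o c =
      ((k ^+ 2 + 1)^-1)%:C%C *: (adj (t \o (y \o c)) \o (t \o (y \o c))).
    rewrite (adj_comp bt (bounded_comp sy.1 sc.1)) (adj_comp sy.1 sc.1) sy.2 sc.2.
    by apply/funext => u; rewrite /= /z !opE /= (opZ sy.1) (opZ sc.1).
  rewrite (retrZ tM vN NM); last first.
    by apply: cN; [apply: aN; exact: cN|exact: cN].
  rewrite /= (rip_sa sy) zE ler_pM2l ?invr_gt0//.
have Iyc : ideal (y \o c) by split=> // z hz; rewrite -Vw; exact: hz.
have Id : ideal (c \o (y \o y) \o c).
  by have := ideal_l Nc (ideal_l Ny Iyc); rewrite !compA.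
have eyy : eff (y \o y) by have [] := eff_sandwich ey (eff_id H).
have [ed ed1 ed2] := eff_sandwich ec eyy.
have bd : b + (c \o (y \o y) \o c) = b.
  apply: maxb; last by move=> u; rewrite !opE ripDl lerDl eff_ge0.
  split; last exact: ideal_D.
  split; first by apply: sa_D; [case: eb|case: ed].
    by move=> u; rewrite !opE rip0l ripDl addr_ge0 ?eff_ge0.
  move=> u; rewrite opE ripDl.
  have cE : rip (c u) u = rip u u - rip (b u) u by rewrite /c !opE ripBl.
  by move: (ed1 u) (ed2 u); rewrite cE /=; lra.
have d0 : c \o (y \o y) \o c = 0 by apply: (addrI b); rewrite addr0.
have ycz u : x (c u) = c u.
  suff : y (c u) = 0 by rewrite /y !opE => /subr0_eq.
  apply: nrm_eq0; rewrite /nrm -(rip_sa sy) -(rip_sa sc).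
  by rewrite -[c (y (y (c u)))]/((c \o (y \o y) \o c) u) d0 opE rip0l sqrtr0.
move: hx; rewrite {1}/w ycz -/w.
have -> : c \o x \o c = c \o c by apply/funext => u /=; rewrite ycz.
by rewrite leNgt hw.
Qed.

Lemma iperp_eq0 z : iperp z -> z = 0.
Proof.
move=> hz; apply: (@nrm_small_eq0 _ _ _ 1) => e e0; rewrite mul1r.
have [S NS hS] := emb_dense z e0.
have [_ /(_ _ hz) h] : ideal S := ideal_l NS ideal_id.
have [->|n0] := eqVneq (nrm z) 0; first exact: ltW.
have np : 0 < nrm z by rewrite lt_neqAle eq_sym n0 nrm_ge0.
rewrite -(ler_pM2r np) -expr2 nrm_sqr -[rip z z]subr0 -h -ripBl.
by apply: (le_trans (rip_le _ _)); rewrite ler_wpM2r ?nrm_ge0.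
Qed.

End Density.

Section BicommutantDensity.
Variables (R : realType) (H : hilbert R) (M N : set (H -> H)) (tau : (H -> H) -> R[i]).
Hypothesis vM : vnalg M.
Hypothesis tM : tracial_state M tau.
Hypothesis vN : vnalg N.
Hypothesis NM : N `<=` M.
Variable L : l2space N tau.
Notation emb := (l2_emb L).
Notation lmul := (lmul L).

Inductive gen_alg (G : set (H -> H)) : (H -> H) -> Prop :=
| gen_id : gen_alg G id
| gen_mul S T : G S -> gen_alg G T -> gen_alg G (S \o T)
| gen_lin a S T : gen_alg G S -> gen_alg G T -> gen_alg G (a *: S + T).

Variable G : set (H -> H).
Hypothesis GN : G `<=` N.
Hypothesis aG : forall T, G T -> G (adj T).

Let bN T : N T -> bounded_op T. Proof. exact: vnalg_bounded. Qed.

Lemma gen_alg_N T : gen_alg G T -> N T.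
Proof.
elim=> [|S U /GN NS _ NU|a S U _ NS _ NU].
- exact: (vn_id vN).
- exact: (vn_comp vN).
- exact: (vn_lin vN).
Qed.

(* For intertwiners V1, V2 : H -> L and e the projection onto the closure of
   gen_alg G, the operator V2^* e V1 commutes with G, hence with T. *)
Lemma bicommutant_dense T e : N T -> commutant (commutant G) T -> 0 < e ->
  exists2 S, gen_alg G S & nrm (emb T - emb S) <= e.
Proof.
move=> NT GT e0.
have sG : lin_subspace (gen_alg G).
  split; last exact: gen_lin.
  have -> : 0 = (-1) *: (id : H -> H) + id.
    by apply/funext => u; rewrite !opE scaleN1r addNr.
  by apply: gen_lin; exact: gen_id.
have le a S S' : gen_alg G S -> gen_alg G S' ->
    emb (a *: S + S') = a *: emb S + emb S'.
  by move=> /gen_alg_N NS /gen_alg_N NS'; exact: emb_lin.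
have b1 S : gen_alg G S -> nrm (emb S) <= 1 * nrm (emb S) by rewrite mul1r.
have [E EE] := @ext_exists R L L _ (gen_alg G) emb emb 1 sG le le ler01 b1.
have bE : bounded_op E.
  by apply/bounded_opP; split; [exact: ext_lin EE|exists 1; split=> //; exact: ext_bound EE].
have EG S v : G S -> E (lmul S v) = lmul S (E v).
  move=> GS; have NS := GN GS; have NS' := GN (aG GS).
  have [k k0 kS] := N_bound vN NS.
  have lb := lmul_bounded tM vN NM L NS.
  apply: (ext_intertwine ler01 EE (Sa := lmul (adj S)) (k := k)) => //.
  - exact: op_lin.
  - exact: op_lin.
  - by move=> u w; exact: (rip_lmul tM vN NM).
  - apply: (lmul_bounded_by tM vN NM) => //.
    by apply: adj_bounded_by => //; exact: bN.
  - exact: (lmul_bounded_by tM vN NM).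
  - move=> t d Dt d0; exists (S \o t); have Nt := gen_alg_N Dt.
    rewrite (lmulE tM vN NM L NS Nt) subrr nrm0.
    by split; [exact: gen_mul|exact: ltW|exact: ltW].
  - move=> t d Dt d0; exists (adj S \o t); first by apply: gen_mul => //; exact: aG.
    by rewrite (lmulE tM vN NM L NS' (gen_alg_N Dt)) subrr nrm0; exact: ltW.
pose lT := lmul T; have blT : bounded_op lT by exact: (lmul_bounded tM vN NM).
have lE : linear E := op_lin bE.
pose B : L -> L := (lT \o E) - (E \o lT).
have bB : bounded_op B by apply: bounded_B; exact: bounded_comp.
have BV (V : H -> L) h : @intertwiner R H N tau L V -> B (V h) = 0.
  move=> [bV iV]; apply: (iperp_eq0 vM tM vN NM) => V2 g [bV2 iV2].
  pose X := adj V2 \o (E \o V).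
  have V2l S y : N S -> S (adj V2 y) = adj V2 (lmul S y).
    move=> NS; apply: hilbert_ext => w.
    have NS' := vnalg_adj vN NS.
    rewrite (rip_adj _ _ (bN NS)) -(rip_adjr _ _ bV2) iV2//.
    by rewrite -(rip_lmul tM vN NM)// (rip_adjr _ _ bV2).
  have XG : commutant G X.
    split; first by apply: bounded_comp; [exact: adj_bounded|exact: bounded_comp].
    move=> S GS; apply/funext => w /=; have NS := GN GS.
    by rewrite /X /= (V2l S _ NS) (iV S w NS) (EG S _ GS).
  have /(congr1 (@^~ h)) := GT.2 _ XG.
  rewrite /X /= (V2l T _ NT) (iV T h NT) => hX.
  by rewrite /B !opE ripBr !(rip_adj _ _ bV2) /= hX subrr.
have B0 v : B v = 0.
  apply: hilbert_ext => y; rewrite (rip_adj _ _ bB) rip0l.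
  rewrite (iperp_eq0 vM tM vN NM (z := adj B y)) ?rip0r//.
  by move=> V h iV; rewrite -(rip_adj _ _ bB) BV// rip0l.
(* [E] fixes [emb id], so [emb T = T (E (emb id)) = E (emb T)]: [emb T] lies in the closure of the
   algebra. *)
have := B0 (emb id); rewrite /B !opE /= (ext_val EE); last exact: gen_id.
rewrite /lT (lmulE tM vN NM)//; last exact: (vn_id vN).
rewrite -[T \o id]/T => /subr0_eq hE.
have [t [Dt _ ht]] := ext_near EE (emb T) e0.
by exists t => //; rewrite {1}hE -[e]mul1r.
Qed.

End BicommutantDensity.

(** * The tensor square *)

Section Tensor.
Variable R : realType.
Local Notation C := R[i].

(** Schur's product theorem, by Gram-Schmidt in [K]: removing from the second components their part
    along [b0] kills the first pair, leaving a shorter list, and what is removed contributes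
    [|sum of l x * x.1|^2 |b0|^2]. *)
Lemma gram_ge0 (P : prehilb R) (K : hilbert R) (s : seq (P * K)) :
  0 <= complex.Re (\sum_(x <- s) \sum_(y <- s) ip x.1 y.1 * ip x.2 y.2).
Proof.
elim: {s}(size s) {-2}s (erefl (size s)) => [|n IH] [|[a0 b0] s] // hs.
- by rewrite big_nil.
- have [b00|b00] := eqVneq b0 0.
    rewrite big_cons /= big1 ?add0r; last by move=> y _; rewrite b00 ip0l mulr0.
    rewrite (eq_bigr (fun x => \sum_(y <- s) ip x.1 y.1 * ip x.2 y.2)).
      by apply: IH; case: hs.
    by move=> x _; rewrite big_cons /= b00 ip0r mulr0 add0r.
  have bb : ip b0 b0 != 0.
    apply/eqP => h; move/eqP: b00; apply; apply: nrm_eq0.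
    by rewrite /nrm /rip h sqrtr0.
  pose l (x : P * K) : C := ip x.2 b0 / ip b0 b0.
  have [f f1 f2] : exists2 f : P * K -> P * K, forall x, (f x).1 = x.1 &
    forall x, (f x).2 = x.2 - l x *: b0 by exists (fun x => (x.1, x.2 - l x *: b0)).
  set t := (a0, b0) :: s.
  have fo x : ip (f x).2 b0 = 0 by rewrite f2 ipBl ipZl divfK// subrr.
  have fo' x : ip b0 (f x).2 = 0 by rewrite ip_conj fo rmorph0.
  have fE x y : ip x.2 y.2 = ip (f x).2 (f y).2 + l x * (l y)^* * ip b0 b0.
    have e z : z.2 = (f z).2 + l z *: b0 by rewrite f2 subrK.
    move: (fo x) (fo' y) (e x) (e y).
    move: (f x).2 (f y).2 (l x) (l y) => p q lx ly h1 h2 -> ->.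
    by rewrite ipDl !ipDr !ipZr !ipZl h1 h2; ring.
  have -> : \sum_(x <- t) \sum_(y <- t) ip x.1 y.1 * ip x.2 y.2 =
      \sum_(x <- map f s) \sum_(y <- map f s) ip x.1 y.1 * ip x.2 y.2 +
      ip (\sum_(x <- t) l x *: x.1) (\sum_(x <- t) l x *: x.1) * ip b0 b0.
    rewrite (eq_bigr (fun x => \sum_(y <- t) ip x.1 y.1 * ip (f x).2 (f y).2 +
        \sum_(y <- t) ip x.1 y.1 * (l x * (l y)^* * ip b0 b0))); last first.
      by move=> x _; rewrite -big_split; apply: eq_bigr => y _; rewrite fE mulrDr.
    rewrite big_split /=; congr (_ + _).
      have f0 : (f (a0, b0)).2 = 0 by rewrite f2 /l /= divff// scale1r subrr.
      rewrite /t big_cons big1 ?add0r; last by move=> y _; rewrite f0 ip0l mulr0.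
      rewrite big_map; apply: eq_bigr => x _; rewrite big_cons big_map.
      rewrite f0 ip0r mulr0 add0r; apply: eq_bigr => y _; by rewrite !f1.
    rewrite ip_suml mulr_suml; apply: eq_bigr => x _.
    rewrite ip_sumr mulr_suml; apply: eq_bigr => y _.
    by rewrite ipZl ipZr; ring.
  rewrite cReD addr_ge0//; first by apply: IH; rewrite size_map; case: hs.
  rewrite cReM !Im_ip.
  have im0 (V : prehilb R) (u : V) : rip u ('i%C *: u) = 0.
    rewrite -Im_ip; have := ip_conj u u => /(congr1 (@complex.Im _)).
    by rewrite cIm_conj; lra.
  by rewrite !im0 mul0r subr0 mulr_ge0// ip_ge0.
Qed.

Section KernelForm.
Variables (T : choiceType) (k : T -> T -> C).
Implicit Types z w : {malg C[T]}.

(** [lin_ext] is linear; conjugating inside and outside makes the form conjugate-linear in [w]. *)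
Definition kform z w : C :=
  lin_ext (fun s => (lin_ext (fun t => (k s t)^* : C^o) w)^* : C^o) z.

Lemma kformE z w : kform z w =
  \sum_(s <- msupp z) \sum_(t <- msupp w) z@_s * (w@_t)^* * k s t.
Proof.
apply: eq_bigr => s _.
rewrite /lin_ext rmorph_sum /= /GRing.scale /= mulr_sumr.
by apply: eq_bigr => t _; rewrite rmorphM /= conjCK mulrA.
Qed.

Lemma kform_lin a z z' w : kform (a *: z + z') w = a * kform z w + kform z' w.
Proof. by rewrite /kform linearP. Qed.

Hypothesis kC : forall s t, k t s = (k s t)^*.

Lemma kform_conj z w : kform w z = (kform z w)^*.
Proof.
rewrite !kformE exchange_big rmorph_sum; apply: eq_bigr => s _ /=.
rewrite rmorph_sum; apply: eq_bigr => t _ /=.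
by rewrite !rmorphM /= conjCK kC; ring.
Qed.

Definition kform_prehilb (h : forall z, 0 <= complex.Re (kform z z)) : prehilb R :=
  @Prehilb R {malg C[T]} kform kform_lin kform_conj h.
End KernelForm.

Variable (K : hilbert R).

Section Positivity.
Variable P : prehilb R.
(** Only one factor is a Hilbert space: the other is to carry the degenerate form [gap], on either
    side of the tensor. *)
Lemma kform_ge0l z :
  0 <= complex.Re (kform (fun s t : P * K => ip s.1 t.1 * ip s.2 t.2) z z).
Proof.
rewrite kformE.
have := @gram_ge0 P K [seq (z@_s *: s.1, s.2) | s <- msupp z].
rewrite big_map => h; apply: (le_trans h); rewrite le_eqVlt; apply/orP; left; apply/eqP.
congr complex.Re; apply: eq_bigr => s _; rewrite big_map; apply: eq_bigr => t _ /=.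
by rewrite ipZl ipZr; ring.
Qed.
Lemma kform_ge0r z :
  0 <= complex.Re (kform (fun s t : K * P => ip s.1 t.1 * ip s.2 t.2) z z).
Proof.
rewrite kformE.
have := @gram_ge0 P K [seq (z@_s *: s.2, s.1) | s <- msupp z].
rewrite big_map => h; apply: (le_trans h); rewrite le_eqVlt; apply/orP; left; apply/eqP.
congr complex.Re; apply: eq_bigr => s _; rewrite big_map; apply: eq_bigr => t _ /=.
by rewrite ipZl ipZr; ring.
Qed.
End Positivity.

Lemma tens_kernelC (s t : K * K) :
  ip t.1 s.1 * ip t.2 s.2 = (ip s.1 t.1 * ip s.2 t.2)^*.
Proof. by rewrite rmorphM /= -!ip_conj. Qed.

(* Algebraic tensor square: formal combinations of pairs. Tensor relations such
   as (a + b) ** c = a ** c + b ** c hold up to vectors of norm 0 only. *)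
Definition tens : prehilb R :=
  kform_prehilb tens_kernelC (@kform_ge0l K).

Definition el (h g : K) : tens := << (h, g) >>.
Definition tl (S : K -> K) (z : tens) : tens :=
  lin_ext (fun s : K * K => el (S s.1) s.2) z.
Definition tr (S : K -> K) (z : tens) : tens :=
  lin_ext (fun s : K * K => el s.1 (S s.2)) z.

Lemma ip_tensE (z w : tens) : ip z w =
  \sum_(s <- msupp z) \sum_(t <- msupp w)
    z@_s * (w@_t)^* * (ip s.1 t.1 * ip s.2 t.2).
Proof. exact: kformE. Qed.

Lemma ip_lin_extl (T : choiceType) (f : T -> tens) z w :
  ip (lin_ext f z : tens) w = \sum_(s <- msupp z) z@_s * ip (f s) w.
Proof. by rewrite /lin_ext ip_suml; apply: eq_bigr => s _; rewrite ipZl. Qed.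

Lemma ip_lin_extr (T : choiceType) (f : T -> tens) z w :
  ip w (lin_ext f z : tens) = \sum_(s <- msupp z) (z@_s)^* * ip w (f s).
Proof. by rewrite /lin_ext ip_sumr; apply: eq_bigr => s _; rewrite ipZr. Qed.

Lemma ip_elr (z : tens) h g :
  ip z (el h g) = lin_ext (fun s : K * K => ip s.1 h * ip s.2 g : C^o) z.
Proof.
rewrite /ip /= /kform; apply: eq_bigr => s _; congr (_ *: _).
by rewrite lin_extU /= conjCK.
Qed.

Lemma ip_el h g h' g' : ip (el h g) (el h' g') = ip h h' * ip g g'.
Proof. by rewrite ip_elr lin_extU. Qed.

Lemma tens_decomp (z : tens) : z = \sum_(s <- msupp z) z@_s *: el s.1 s.2.
Proof.
by rewrite {1}[z]monalgE; apply: eq_bigr => -[h g] _; rewrite malgUZ.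
Qed.

Lemma nrm_el h g : nrm (el h g) = nrm h * nrm g.
Proof.
apply: (@pexpIrn _ 2); rewrite ?nnegrE ?mulr_ge0 ?nrm_ge0//.
rewrite exprMn !nrm_sqr /rip ip_el cReM !Im_ip.
have im0 (V : prehilb R) (u : V) : rip u ('i%C *: u) = 0.
  rewrite -Im_ip; have := ip_conj u u => /(congr1 (@complex.Im _)).
  by rewrite cIm_conj; lra.
by rewrite !im0 mul0r subr0.
Qed.

Lemma nrm_elBl h h' g : nrm (el h g - el h' g) = nrm (h - h') * nrm g.
Proof.
rewrite -nrm_el /nrm /rip; congr (Num.sqrt (complex.Re _)).
rewrite [LHS]ipBl 2![in LHS]ipBr; do 4 rewrite [in LHS]ip_el.
by rewrite [in RHS]ip_el !ipBl !ipBr; ring.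
Qed.
Lemma nrm_elBr h g g' : nrm (el h g - el h g') = nrm h * nrm (g - g').
Proof.
rewrite -nrm_el /nrm /rip; congr (Num.sqrt (complex.Re _)).
rewrite [LHS]ipBl 2![in LHS]ipBr; do 4 rewrite [in LHS]ip_el.
by rewrite [in RHS]ip_el !ipBl !ipBr; ring.
Qed.

Lemma tl_lin S : linear (tl S). Proof. by move=> a u v; rewrite /tl linearP. Qed.
Lemma tr_lin S : linear (tr S). Proof. by move=> a u v; rewrite /tr linearP. Qed.
Lemma tl_el S h g : tl S (el h g) = el (S h) g. Proof. exact: lin_extU. Qed.
Lemma tr_el S h g : tr S (el h g) = el h (S g). Proof. exact: lin_extU. Qed.

Lemma ip_decompl (z w : tens) :
  ip z w = \sum_(s <- msupp z) z@_s * ip (el s.1 s.2) w.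
Proof.
transitivity (ip (\sum_(s <- msupp z) z@_s *: el s.1 s.2) w).
  by congr ip; exact: tens_decomp.
by rewrite ip_suml; apply: eq_bigr => s _; rewrite ipZl.
Qed.
Lemma ip_decompr (z w : tens) :
  ip z w = \sum_(s <- msupp w) (w@_s)^* * ip z (el s.1 s.2).
Proof.
transitivity (ip z (\sum_(s <- msupp w) w@_s *: el s.1 s.2)).
  by congr ip; exact: tens_decomp.
by rewrite ip_sumr; apply: eq_bigr => s _; rewrite ipZr.
Qed.

Lemma tl_adj S S' : (forall u v, ip (S u) v = ip u (S' v)) ->
  forall z w, ip (tl S z) w = ip z (tl S' w).
Proof.
move=> h z w; rewrite ip_lin_extl [RHS]ip_decompl.
apply: eq_bigr => s _; congr (_ * _).
rewrite ip_lin_extr [LHS]ip_decompr.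
by apply: eq_bigr => t _; rewrite (ip_el (S s.1)) (ip_el s.1) (h s.1 t.1).
Qed.
Lemma tr_adj S S' : (forall u v, ip (S u) v = ip u (S' v)) ->
  forall z w, ip (tr S z) w = ip z (tr S' w).
Proof.
move=> h z w; rewrite ip_lin_extl [RHS]ip_decompl.
apply: eq_bigr => s _; congr (_ * _).
rewrite ip_lin_extr [LHS]ip_decompr.
by apply: eq_bigr => t _; rewrite (ip_el s.1 (S s.2)) (ip_el s.1 s.2) (h s.2 t.2).
Qed.

Section ActionBound.
Variables (S : K -> K) (c : R).
Hypothesis lS : linear S.
Hypothesis c0 : 0 <= c.
Hypothesis cS : bounded_by c S.

(** The form of [c^2 - S^* S], nonnegative because [c] bounds [S]. Then [c^2 |z|^2 - |tl S z|^2] is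
    the tensor form of [gap] with the inner product of [K], nonnegative by Schur's theorem; likewise
    for [tr]. *)
Definition gap (u v : K) : C := (c ^+ 2)%:C%C * ip u v - ip (S u) (S v).
Lemma gap_lin a u v w : gap (a *: u + v) w = a * gap u w + gap v w.
Proof. by rewrite /gap lS !ip_lin; ring. Qed.
Lemma gap_conj u v : gap v u = (gap u v)^*.
Proof.
rewrite /gap (ip_conj u v) (ip_conj (S u) (S v)); apply: complex_ext.
  by rewrite cRe_conj !cReB !cRe_Zr !cRe_conj.
by rewrite cIm_conj !cImB !cIm_Zr !cIm_conj; ring.
Qed.
Lemma gap_ge0 u : 0 <= complex.Re (gap u u).
Proof.
rewrite /gap cReB cRe_Zr -[complex.Re (ip u u)]/(rip u u).
rewrite -[complex.Re (ip (S u) _)]/(rip (S u) (S u)) -!nrm_sqr -exprMn subr_ge0.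
by rewrite ler_pXn2r ?nnegrE ?mulr_ge0 ?nrm_ge0.
Qed.
Let gapP : prehilb R := @Prehilb R K gap gap_lin gap_conj gap_ge0.

Lemma tl_bound : bounded_by c (tl S).
Proof.
move=> z; apply: ler_nrm; first by rewrite mulr_ge0 ?nrm_ge0.
rewrite exprMn nrm_sqr -subr_ge0.
apply: (le_trans (@kform_ge0l gapP z)); rewrite kformE le_eqVlt; apply/orP; left; apply/eqP.
rewrite /rip -cRe_Zr -cReB; congr complex.Re.
rewrite ip_tensE ip_lin_extl mulr_sumr -sumrB; apply: eq_bigr => s _.
rewrite ip_lin_extr !mulr_sumr -sumrB; apply: eq_bigr => t _.
by rewrite ip_el /= /gap /=; ring.
Qed.
Lemma tr_bound : bounded_by c (tr S).
Proof.
move=> z; apply: ler_nrm; first by rewrite mulr_ge0 ?nrm_ge0.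
rewrite exprMn nrm_sqr -subr_ge0.
apply: (le_trans (@kform_ge0r gapP z)); rewrite kformE le_eqVlt; apply/orP; left; apply/eqP.
rewrite /rip -cRe_Zr -cReB; congr complex.Re.
rewrite ip_tensE ip_lin_extl mulr_sumr -sumrB; apply: eq_bigr => s _.
rewrite ip_lin_extr !mulr_sumr -sumrB; apply: eq_bigr => t _.
by rewrite ip_el /= /gap /=; ring.
Qed.
End ActionBound.
End Tensor.

Section Product.
Variables (R : realType) (P Q : prehilb R).
Definition prod_ip (u v : P * Q) : R[i] := ip u.1 v.1 + ip u.2 v.2.
Lemma prod_ip_lin a u v w : prod_ip (a *: u + v) w = a * prod_ip u w + prod_ip v w.
Proof. by rewrite /prod_ip /= !ip_lin; ring. Qed.
Lemma prod_ip_conj u v : prod_ip v u = (prod_ip u v)^*.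
Proof. by rewrite /prod_ip rmorphD /= -!ip_conj. Qed.
Lemma prod_ip_ge0 u : 0 <= complex.Re (prod_ip u u).
Proof. by rewrite /prod_ip cReD addr_ge0 ?ip_ge0. Qed.
Definition prodh : prehilb R :=
  @Prehilb R (P * Q)%type prod_ip prod_ip_lin prod_ip_conj prod_ip_ge0.

Lemma rip_prod (u v : prodh) : rip u v = rip u.1 v.1 + rip u.2 v.2.
Proof. by rewrite /rip /= /prod_ip cReD. Qed.
Lemma nrm_prod (u : prodh) : nrm u ^+ 2 = nrm u.1 ^+ 2 + nrm u.2 ^+ 2.
Proof. by rewrite !nrm_sqr rip_prod. Qed.
Lemma nrm_prod_fst (u : prodh) : nrm u.1 <= nrm u.
Proof.
by rewrite -(ler_pXn2r (n := 2)) ?nnegrE ?nrm_ge0// nrm_prod lerDl sqr_ge0.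
Qed.
Lemma nrm_prod_snd (u : prodh) : nrm u.2 <= nrm u.
Proof.
by rewrite -(ler_pXn2r (n := 2)) ?nnegrE ?nrm_ge0// nrm_prod lerDr sqr_ge0.
Qed.
Lemma nrm_prod_le (u : prodh) : nrm u <= nrm u.1 + nrm u.2.
Proof.
rewrite -(ler_pXn2r (n := 2)) ?nnegrE ?addr_ge0 ?nrm_ge0// nrm_prod sqrrD.
by rewrite lerD2r lerDl mulrn_wge0 ?mulr_ge0 ?nrm_ge0.
Qed.
End Product.

(** * The difference quotient *)

Section Derivation.
Variables (R : realType) (H : hilbert R) (M N : set (H -> H)) (tau : (H -> H) -> R[i]).
Hypothesis tM : tracial_state M tau.
Hypothesis vN : vnalg N.
Hypothesis NM : N `<=` M.
Variable L : l2space N tau.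
Variables (I : choiceType) (x : I -> H -> H).
Hypothesis Nx : forall i, N (x i).
Variable k : I.

Notation emb := (l2_emb L).
Notation lm := (lmul L).
Notation rm := (rmul L).
Notation poly := {malg R[i][{fmonom I}]}.
Notation poly2 := {malg R[i][({fmonom I} * {fmonom I})%type]}.
Notation ev := (eval_poly x).
Notation ew := (eval_word x).
Notation E := (tens L).
Implicit Types (p q : poly) (w : {fmonom I}) (T S : H -> H).

Let bN T : N T -> bounded_op T. Proof. exact: vnalg_bounded. Qed.
Let aN T : N T -> N (adj T). Proof. exact: vnalg_adj. Qed.
Let cN S T : N S -> N T -> N (S \o T). Proof. exact: vn_comp. Qed.

Lemma N_word w : N (ew w).
Proof.
case: w => s; rewrite /eval_word /=.
by elim: s => [|i s IH] /=; [exact: (vn_id vN)|exact: cN].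
Qed.
Lemma word_mul u v : ew (mmul u v) = ew u \o ew v.
Proof.
case: u => u; case: v => v; rewrite fmulE /eval_word /=.
by elim: u => [|i u /= ->].
Qed.
Lemma N_poly p : N (ev p).
Proof.
apply: (big_ind N); [exact: (vn_0 vN)|by move=> *; exact: (vn_D vN)|].
by move=> w _; apply: (vn_Z vN); exact: N_word.
Qed.
Lemma ev_lin a p q : ev (a *: p + q) = a *: ev p + ev q.
Proof. by rewrite /eval_poly linearP. Qed.
Lemma evU w : ev << w >> = ew w. Proof. exact: lin_extU. Qed.
Lemma evE p : ev p = \sum_(w <- msupp p) p@_w *: ew w. Proof. by []. Qed.

Lemma emb_ev_l p T : N T ->
  emb (ev p \o T) = \sum_(w <- msupp p) p@_w *: emb (ew w \o T).
Proof.
move=> NT; rewrite evE.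
have -> : (\sum_(w <- msupp p) p@_w *: ew w) \o T =
    \sum_(w <- msupp p) p@_w *: (ew w \o T).
  by apply/funext => u; rewrite /= !fun_sumE.
rewrite (emb_sum vN); last by move=> w; apply: (vn_Z vN); apply: cN => //; exact: N_word.
by apply: eq_bigr => w _; rewrite (embZ vN)//; apply: cN => //; exact: N_word.
Qed.
Lemma emb_ev_r p T : N T ->
  emb (T \o ev p) = \sum_(w <- msupp p) p@_w *: emb (T \o ew w).
Proof.
move=> NT; rewrite evE.
have -> : T \o (\sum_(w <- msupp p) p@_w *: ew w) =
    \sum_(w <- msupp p) p@_w *: (T \o ew w).
  apply/funext => u; rewrite /= !fun_sumE (op_sum (bN NT)).
  by apply: eq_bigr => w _; rewrite /= opE (opZ (bN NT)).
rewrite (emb_sum vN); last by move=> w; apply: (vn_Z vN); apply: cN => //; exact: N_word.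
by apply: eq_bigr => w _; rewrite (embZ vN)//; apply: cN => //; exact: N_word.
Qed.

Lemma evM p q : ev (p * q) = ev p \o ev q.
Proof.
rewrite malgME /eval_poly (linear_sum (lin_ext _)) /= -/(eval_poly x p).
apply/funext => u; rewrite fun_sumE /= evE fun_sumE; apply: eq_bigr => v _.
rewrite (linear_sum (lin_ext _)) /= fun_sumE opE -/(eval_poly x q) evE fun_sumE.
have bv := bN (N_word v).
rewrite (op_sum bv) scaler_sumr; apply: eq_bigr => w _.
by rewrite malgUZ linearZ /= lin_extU word_mul !opE (opZ bv) scalerA.
Qed.

Lemma lin_extE (K : choiceType) (V : lmodType R[i]) (f : K -> V) (g : {malg R[i][K]}) :
  lin_ext f g = \sum_(s <- msupp g) g@_s *: f s.
Proof. by []. Qed.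

Definition dEl (T : poly2) : E :=
  lin_ext (fun s : {fmonom I} * {fmonom I} => el (emb (ew s.1)) (emb (ew s.2))) T.
Definition dE p : E := dEl (fdq k p).

Lemma dE_lin a p q : dE (a *: p + q) = a *: dE p + dE q.
Proof. by rewrite /dE /dEl /fdq !linearP. Qed.

Definition word_test (h g : L) (s : {fmonom I} * {fmonom I}) : R[i]^o :=
  ip (emb (ew s.1)) h * ip (emb (ew s.2)) g.

Lemma ip_dEl (T : poly2) h g : ip (dEl T) (el h g) = lin_ext (word_test h g) T.
Proof. by rewrite ip_lin_extl; apply: eq_bigr => s _; rewrite ip_el. Qed.

Lemma tens_test (K : hilbert R) (z w : tens K) :
  (forall h g, ip z (el h g) = ip w (el h g)) -> nrm (z - w) = 0.
Proof.
move=> h; rewrite /nrm /rip ip_decompr big1 ?sqrtr0// => s _.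
by rewrite ipBl h subrr mulr0.
Qed.

Lemma tl_dEl (S : L -> L) (T : poly2) h g : ip (tl S (dEl T)) (el h g) =
  \sum_(s <- msupp T) T@_s * (ip (S (emb (ew s.1))) h * ip (emb (ew s.2)) g).
Proof.
rewrite /dEl /tl {2}/lin_ext (linear_sum (lin_ext _)) ip_suml; apply: eq_bigr => s _.
by rewrite (linearZ_LR (lin_ext _)) ipZl [X in ip X _]tl_el ip_el.
Qed.
Lemma tr_dEl (S : L -> L) (T : poly2) h g : ip (tr S (dEl T)) (el h g) =
  \sum_(s <- msupp T) T@_s * (ip (emb (ew s.1)) h * ip (S (emb (ew s.2))) g).
Proof.
rewrite /dEl /tr {2}/lin_ext (linear_sum (lin_ext _)) ip_suml; apply: eq_bigr => s _.
by rewrite (linearZ_LR (lin_ext _)) ipZl [X in ip X _]tr_el ip_el.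
Qed.

Lemma lm_ev_word p w :
  lm (ev p) (emb (ew w)) = \sum_(u <- msupp p) p@_u *: emb (ew (mmul u w)).
Proof.
rewrite (lmulE tM vN NM L (N_poly p) (N_word w)) (emb_ev_l _ (N_word w)).
by apply: eq_bigr => u _; rewrite word_mul.
Qed.
Lemma rm_ev_word p w :
  rm (ev p) (emb (ew w)) = \sum_(u <- msupp p) p@_u *: emb (ew (mmul w u)).
Proof.
rewrite (rmulE tM vN NM L (N_poly p) (N_word w)) (emb_ev_r _ (N_word w)).
by apply: eq_bigr => u _; rewrite word_mul.
Qed.

(** Equality only up to norm 0: on the left the product of words is expanded outside the symbol of a
    pair, on the right inside its first entry. *)
Lemma dEl_lact p (T : poly2) : nrm (dEl (lact p T) - tl (lm (ev p)) (dEl T)) = 0.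
Proof.
apply: tens_test => h g; rewrite ip_dEl tl_dEl /lact {2}/lin_ext linear_sum /=.
rewrite [RHS](eq_bigr (fun s => \sum_(u <- msupp p) T@_s *
    (p@_u * ip (emb (ew (mmul u s.1))) h * ip (emb (ew s.2)) g))); last first.
  move=> s _; rewrite lm_ev_word ip_suml mulr_suml mulr_sumr.
  by apply: eq_bigr => u _; rewrite ipZl.
rewrite exchange_big /=; apply: eq_bigr => u _.
rewrite (linearZ_LR (lin_ext _)) [lin_ext _ T]lin_extE (linear_sum (lin_ext _)).
transitivity (p@_u * \sum_(s <- msupp T) T@_s * word_test h g (mmul u s.1, s.2)).
  apply: (congr1 (fun z => p@_u * z)); apply: eq_bigr => s _.
  rewrite (linearZ_LR (lin_ext _)); apply: (congr1 (fun z => T@_s * z)).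
  exact: lin_extU.
by rewrite mulr_sumr; apply: eq_bigr => s _; rewrite /word_test /=; ring.
Qed.
Lemma dEl_ract p (T : poly2) : nrm (dEl (ract T p) - tr (rm (ev p)) (dEl T)) = 0.
Proof.
apply: tens_test => h g; rewrite ip_dEl tr_dEl /ract {2}/lin_ext linear_sum /=.
rewrite [RHS](eq_bigr (fun s => \sum_(u <- msupp p) T@_s *
    (ip (emb (ew s.1)) h * (p@_u * ip (emb (ew (mmul s.2 u))) g)))); last first.
  move=> s _; rewrite rm_ev_word ip_suml !mulr_sumr.
  by apply: eq_bigr => u _; rewrite ipZl.
rewrite exchange_big /=; apply: eq_bigr => u _.
rewrite (linearZ_LR (lin_ext _)) [lin_ext _ T]lin_extE (linear_sum (lin_ext _)).
transitivity (p@_u * \sum_(s <- msupp T) T@_s * word_test h g (s.1, mmul s.2 u)).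
  apply: (congr1 (fun z => p@_u * z)); apply: eq_bigr => s _.
  rewrite (linearZ_LR (lin_ext _)); apply: (congr1 (fun z => T@_s * z)).
  exact: lin_extU.
by rewrite mulr_sumr; apply: eq_bigr => s _; rewrite /word_test /=; ring.
Qed.

Lemma leibniz p q :
  nrm (dE (p * q) - (tr (rm (ev q)) (dE p) + tl (lm (ev p)) (dE q))) = 0.
Proof.
have e : dE (p * q) = dEl (ract (fdq k p) q) + dEl (lact p (fdq k q)).
  by rewrite /dE fdqM /dEl linearD.
rewrite e {e}.
have h1 : nrm (dEl (ract (fdq k p) q) - tr (rm (ev q)) (dE p)) = 0 := dEl_ract _ _.
have h2 : nrm (dEl (lact p (fdq k q)) - tl (lm (ev p)) (dE q)) = 0 := dEl_lact _ _.
have h := nrmDB (dEl (ract (fdq k p) q)) (dEl (lact p (fdq k q)))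
  (tr (rm (ev q)) (dE p)) (tl (lm (ev p)) (dE q)).
apply/eqP; rewrite eq_le nrm_ge0 andbT; apply: (le_trans h).
rewrite -[leRHS]addr0; apply: lerD; first by rewrite h1.
by rewrite h2.
Qed.

(* The properties of the tensor square and of the difference quotient used
   below; the record keeps the formal combinations of pairs out of sight. *)
Record calculus := Calculus {
  tc_car :> prehilb R;
  tc_el : L -> L -> tc_car;
  tc_tl : (L -> L) -> tc_car -> tc_car;
  tc_tr : (L -> L) -> tc_car -> tc_car;
  tc_ip : forall h g h' g', ip (tc_el h g) (tc_el h' g') = ip h h' * ip g g';
  tc_nrm : forall h g, nrm (tc_el h g) = nrm h * nrm g;
  tc_tl_lin : forall S : L -> L, linear (tc_tl S);
  tc_tr_lin : forall S : L -> L, linear (tc_tr S);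
  tc_tl_el : forall (S : L -> L) h g, tc_tl S (tc_el h g) = tc_el (S h) g;
  tc_tr_el : forall (S : L -> L) h g, tc_tr S (tc_el h g) = tc_el h (S g);
  tc_tl_adj : forall S S' : L -> L, (forall u v, ip (S u) v = ip u (S' v)) ->
    forall z z', ip (tc_tl S z) z' = ip z (tc_tl S' z');
  tc_tr_adj : forall S S' : L -> L, (forall u v, ip (S u) v = ip u (S' v)) ->
    forall z z', ip (tc_tr S z) z' = ip z (tc_tr S' z');
  tc_tl_bound : forall (S : L -> L) c, linear S -> 0 <= c -> bounded_by c S -> bounded_by c (tc_tl S);
  tc_tr_bound : forall (S : L -> L) c, linear S -> 0 <= c -> bounded_by c S -> bounded_by c (tc_tr S);
  tc_elBl : forall h h' g, nrm (tc_el h g - tc_el h' g) = nrm (h - h') * nrm g;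
  tc_elBr : forall h g g', nrm (tc_el h g - tc_el h g') = nrm h * nrm (g - g');
  tc_d : poly -> tc_car;
  tc_d_lin : linear tc_d;
  tc_leibniz : forall p q,
    nrm (tc_d (p * q) - (tc_tr (rm (ev q)) (tc_d p) + tc_tl (lm (ev p)) (tc_d q))) = 0;
  tc_decomp : forall p, exists s : seq (R[i] * ({fmonom I} * {fmonom I})),
    tc_d p = \sum_(t <- s) t.1 *: tc_el (emb (ew t.2.1)) (emb (ew t.2.2));
  tc_pair : forall p, ip (tc_d p) (tc_el (emb id) (emb id)) = eval_tau2 x tau (fdq k p);
  tc_d1 : tc_d 1 = 0;
  tc_dU : forall j, tc_d << fmu j >> = if k == j then tc_el (emb id) (emb id) else 0 }.

Lemma calculus_exists : inhabited calculus.
Proof.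
constructor; apply: (@Calculus E (@el R L) (@tl R L) (@tr R L) _ _ _ _ _ _ _ _ _ _ _ _ dE).
- exact: ip_el.
- exact: nrm_el.
- exact: tl_lin.
- exact: tr_lin.
- exact: tl_el.
- exact: tr_el.
- exact: tl_adj.
- exact: tr_adj.
- exact: tl_bound.
- exact: tr_bound.
- exact: nrm_elBl.
- exact: nrm_elBr.
- exact: dE_lin.
- exact: leibniz.
- move=> p; exists [seq ((fdq k p)@_t, t) | t <- msupp (fdq k p)].
  by rewrite big_map.
- move=> p; rewrite /dE ip_dEl /eval_tau2; apply: eq_bigr => s _.
  congr (_ *: _); rewrite /word_test !ip_emb//; try exact: (vn_id vN); try exact: N_word.
  by rewrite adj_id.
- have -> : (1 : poly) = << mone >> by [].
  rewrite /dE fdq_word [mone]fmoneE /= big_mkcond big_ord0.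
  by rewrite /dEl linear0.
- move=> j; rewrite /dE fdqU; case: eqP => _; last by rewrite /dEl linear0.
  by rewrite /dEl lin_extU /= [mone]fmoneE.
Qed.

End Derivation.

(** * The closure of the difference quotient *)

Section Graph.
Variables (R : realType) (H : hilbert R) (M N : set (H -> H)) (tau : (H -> H) -> R[i]).
Hypothesis vM : vnalg M.
Hypothesis tM : tracial_state M tau.
Hypothesis vN : vnalg N.
Hypothesis NM : N `<=` M.
Variable L : l2space N tau.
Variables (I : choiceType) (x : I -> H -> H).
Hypothesis Nx : forall i, N (x i).
Variable k : I.
Variable E : calculus L x k.

Notation emb := (l2_emb L).
Notation lm := (lmul L).
Notation rm := (rmul L).
Notation poly := {malg R[i][{fmonom I}]}.
Notation ev := (eval_poly x).
Notation ew := (eval_word x).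
Notation el := (@tc_el _ _ _ _ _ _ _ _ E).
Notation tl := (@tc_tl _ _ _ _ _ _ _ _ E).
Notation tr := (@tc_tr _ _ _ _ _ _ _ _ E).
Notation d := (@tc_d _ _ _ _ _ _ _ _ E).
Notation ee := (prodh L E).
Implicit Types (p q : poly) (T S : H -> H) (v : ee).

Let bN T : N T -> bounded_op T. Proof. exact: vnalg_bounded. Qed.
Let aN T : N T -> N (adj T). Proof. exact: vnalg_adj. Qed.
Let cN S T : N S -> N T -> N (S \o T). Proof. exact: vn_comp. Qed.
Let Nev p : N (ev p). Proof. exact: N_poly. Qed.
Let New w : N (ew w). Proof. exact: N_word. Qed.
Let Nid : N id. Proof. exact: (vn_id vN). Qed.

Definition graph_pt p : ee := (emb (ev p), d p).
Definition pt : E := el (emb id) (emb id).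

Lemma graph_pt_lin a p q : graph_pt (a *: p + q) = a *: graph_pt p + graph_pt q.
Proof.
by rewrite /graph_pt ev_lin (emb_lin L a (Nev p) (Nev q)) tc_d_lin.
Qed.

Definition closed_graph v := forall e, 0 < e -> exists p, nrm (v - graph_pt p) <= e.

Lemma closed_graph_pt p : closed_graph (graph_pt p).
Proof. by move=> e e0; exists p; rewrite subrr nrm0 ltW. Qed.

Lemma closed_graph_limit v : (forall e, 0 < e -> exists2 v', closed_graph v' & nrm (v - v') <= e) -> closed_graph v.
Proof.
move=> h e e0; have e2 : 0 < e / 2 by rewrite divr_gt0.
have [v' /(_ _ e2)[p hp] hv] := h _ e2.
exists p; apply: (le_trans (nrmB_triangle _ v' _)).
by rewrite [leRHS](splitr e); exact: lerD.
Qed.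

Lemma closed_graph_lin a u v : closed_graph u -> closed_graph v -> closed_graph (a *: u + v).
Proof.
move=> hu hv e e0.
have c0 : 0 < cabs a + 1 by rewrite ltr_wpDl ?cabs_ge0.
have e1 : 0 < e / (cabs a + 1) by rewrite divr_gt0.
have [p hp] := hu _ e1; have [q hq] := hv _ e1.
exists (a *: p + q); rewrite graph_pt_lin; apply: (le_trans (nrmDB _ _ _ _)).
rewrite -scalerBr nrmZ.
have -> : e = cabs a * (e / (cabs a + 1)) + e / (cabs a + 1).
  by rewrite -[X in _ = _ + X]mul1r -mulrDl mulrC divfK// gt_eqF.
by apply: lerD => //; rewrite ler_wpM2l ?cabs_ge0.
Qed.

Definition lact_ T v : ee := (lm T v.1, tl (lm T) v.2).
Definition ract_ T v : ee := (rm T v.1, tr (rm T) v.2).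

Lemma lact_lin T : N T -> linear (lact_ T).
Proof.
move=> NT a u v; rewrite /lact_ /= (op_lin (lmul_bounded tM vN NM L NT)).
by rewrite tc_tl_lin.
Qed.
Lemma ract_lin T : N T -> linear (ract_ T).
Proof.
move=> NT a u v; rewrite /ract_ /= (op_lin (rmul_bounded tM vN NM L NT)).
by rewrite tc_tr_lin.
Qed.

Lemma prod_bound (c : R) (f : L -> L) (g : E -> E) : 0 <= c ->
  bounded_by c f -> bounded_by c g ->
  bounded_by c (fun v : ee => (f v.1, g v.2) : ee).
Proof.
move=> c0 hf hg v.
rewrite -(ler_pXn2r (n := 2)) ?nnegrE ?mulr_ge0 ?nrm_ge0// exprMn !nrm_prod mulrDr.
by rewrite -!exprMn lerD// ler_pXn2r ?nnegrE ?mulr_ge0 ?nrm_ge0//=.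
Qed.

Lemma lact_bound T c : N T -> 0 <= c -> bounded_by c T -> bounded_by c (lact_ T).
Proof.
move=> NT c0 cT; have h := lmul_bounded_by tM vN NM NT c0 cT.
apply: prod_bound => //; apply: tc_tl_bound => //.
exact: (op_lin (lmul_bounded tM vN NM L NT)).
Qed.
Lemma ract_bound T c : N T -> 0 <= c -> bounded_by c T -> bounded_by c (ract_ T).
Proof.
move=> NT c0 cT; have h := rmul_bounded_by tM vN NM NT c0 cT.
apply: prod_bound => //; apply: tc_tr_bound => //.
exact: (op_lin (rmul_bounded tM vN NM L NT)).
Qed.

Lemma lact_adj T u v : N T -> rip (lact_ T u) v = rip u (lact_ (adj T) v).
Proof.
move=> NT; rewrite !rip_prod /= (rip_lmul tM vN NM)//; congr (_ + _).
by rewrite /rip (tc_tl_adj (S' := lm (adj T)))// => a b; exact: (ip_lmul tM vN NM).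
Qed.
Lemma ract_adj T u v : N T -> rip (ract_ T u) v = rip u (ract_ (adj T) v).
Proof.
move=> NT; rewrite !rip_prod /= (rip_rmul tM vN NM)//; congr (_ + _).
by rewrite /rip (tc_tr_adj (S' := rm (adj T)))// => a b; exact: (ip_rmul tM vN NM).
Qed.

Let tl0 (U : L -> L) : tl U 0 = 0.
Proof. by have := tc_tl_lin U (-1) (0 : E) 0; rewrite scaler0 add0r scaleN1r addNr. Qed.
Let tr0 (U : L -> L) : tr U 0 = 0.
Proof. by have := tc_tr_lin U (-1) (0 : E) 0; rewrite scaler0 add0r scaleN1r addNr. Qed.

(** Elements of [ker] are approximated in 2-norm only. This is enough for the left action on [d p],
    a finite combination of pairs of words: [|(S - T) w|_2 <= |w| |S - T|_2] with the operator norm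
    of [w]. *)
Lemma tl_cont p : exists2 c, 0 <= c & forall S T, N S -> N T ->
  nrm (tl (lm S) (d p) - tl (lm T) (d p)) <= c * nrm (emb S - emb T).
Proof.
have [s ->] := tc_decomp E p; elim: s => [|t s [c c0 hc]].
  exists 0 => // S T NS NT; rewrite big_nil mul0r.
  by rewrite !tl0 subrr nrm0.
have [kw kw0 hkw] := N_bound vN (New t.2.1).
exists (cabs t.1 * (kw * nrm (emb (ew t.2.2))) + c).
  by rewrite addr_ge0// !mulr_ge0 ?cabs_ge0 ?nrm_ge0.
move=> S T NS NT; rewrite big_cons !tc_tl_lin !tc_tl_el.
apply: (le_trans (nrmDB _ _ _ _)); rewrite mulrDl; apply: lerD; last exact: hc.
rewrite -scalerBr nrmZ -mulrA ler_wpM2l ?cabs_ge0// tc_elBl.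
rewrite mulrAC ler_wpM2r ?nrm_ge0//.
rewrite !(lmulE tM vN NM L)// -(embB L)//; [|exact: cN|exact: cN].
rewrite -(embB L)//; have -> : (S \o ew t.2.1) - (T \o ew t.2.1) = (S - T) \o ew t.2.1 by [].
by apply: (nrm_emb_rmul tM vN NM L) => //; exact: (vn_B vN).
Qed.

Lemma tr_cont p : exists2 c, 0 <= c & forall S T, N S -> N T ->
  nrm (tr (rm S) (d p) - tr (rm T) (d p)) <= c * nrm (emb S - emb T).
Proof.
have [s ->] := tc_decomp E p; elim: s => [|t s [c c0 hc]].
  exists 0 => // S T NS NT; rewrite big_nil mul0r.
  by rewrite !tr0 subrr nrm0.
have [kw kw0 hkw] := N_bound vN (New t.2.2).
exists (cabs t.1 * (kw * nrm (emb (ew t.2.1))) + c).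
  by rewrite addr_ge0// !mulr_ge0 ?cabs_ge0 ?nrm_ge0.
move=> S T NS NT; rewrite big_cons !tc_tr_lin !tc_tr_el.
apply: (le_trans (nrmDB _ _ _ _)); rewrite mulrDl; apply: lerD; last exact: hc.
rewrite -scalerBr nrmZ -mulrA ler_wpM2l ?cabs_ge0// tc_elBr.
rewrite mulrC mulrAC ler_wpM2r ?nrm_ge0//.
rewrite !(rmulE tM vN NM L)// -(embB L)//; [|exact: cN|exact: cN].
rewrite -(embB L)//.
have -> : (ew t.2.2 \o S) - (ew t.2.2 \o T) = ew t.2.2 \o (S - T).
  by apply/funext => u; rewrite /= !opE /= (opB (bN (New _))).
by apply: (nrm_emb_lmul tM vN NM L) => //; exact: (vn_B vN).
Qed.

Definition ker T := N T /\ closed_graph (emb T, 0).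

Lemma ker_near T e : ker T -> 0 < e ->
  exists p, nrm (emb T - emb (ev p)) <= e /\ nrm (d p) <= e.
Proof.
move=> [NT h] e0; have [p hp] := h _ e0; exists p; split.
  exact: le_trans (nrm_prod_fst _) hp.
by apply: le_trans hp; rewrite -(nrmN (d p)) -sub0r; exact: (nrm_prod_snd ((_, 0) - graph_pt p)).
Qed.

(** Let [q] be close to [T] with [d q] small. In [d (q p) = (d q) p + q (d p)] the first term is
    small and the second is close to [T (d p)] by [tl_cont]; so [graph_pt (q * p)] is the
    approximation. The constant [kp + (c + kp)] adds up the three errors. *)
Lemma ker_lact_graph_pt T p : ker T -> closed_graph (lact_ T (graph_pt p)).
Proof.
move=> kT e e0; have NT := kT.1.
have [c c0 hc] := tl_cont p.
have [kp kp0 hkp] := N_bound vN (Nev p).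
have m0 : 0 < kp + (c + kp) + 1 by rewrite ltr_wpDl// !addr_ge0.
have [q [h1 h2]] := ker_near kT (divr_gt0 e0 m0).
set e1 := e / _ in h1 h2.
exists (q * p); apply: (le_trans (nrm_prod_le _)) => /=.
have a1 : nrm (lm T (emb (ev p)) - emb (ev (q * p))) <= kp * e1.
  rewrite (lmulE tM vN NM L NT (Nev p)) (evM vN Nx) -(embB L); [|exact: cN|exact: cN].
  have -> : (T \o ev p) - (ev q \o ev p) = (T - ev q) \o ev p by [].
  have NTq := vn_B vN NT (Nev q).
  apply: (le_trans (nrm_emb_rmul tM vN NM L kp0 hkp (Nev p) NTq)).
  by rewrite ler_wpM2l// (embB L).
have a2 : nrm (tl (lm T) (d p) - d (q * p)) <= c * e1 + kp * e1.
  apply: (le_trans (nrmB_triangle _ (tr (rm (ev p)) (d q) + tl (lm (ev q)) (d p)) _)).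
  rewrite [X in _ + X]nrmB tc_leibniz addr0.
  rewrite -[tl (lm T) (d p)]add0r; apply: (le_trans (nrmDB _ _ _ _)).
  rewrite sub0r nrmN addrC; apply: lerD.
    by apply: (le_trans (hc _ _ NT (Nev q))); rewrite ler_wpM2l.
  have lr := op_lin (rmul_bounded tM vN NM L (Nev p)).
  have h := tc_tr_bound lr kp0 (rmul_bounded_by tM vN NM (Nev p) kp0 hkp) (d q).
  apply: (le_trans h).
  by rewrite ler_wpM2l.
apply: (le_trans (lerD a1 a2)); rewrite -!mulrDl /e1 mulrCA.
by rewrite ger_pMr// ler_pdivrMr// mul1r lerDl.
Qed.

Lemma ker_ract_graph_pt T p : ker T -> closed_graph (ract_ T (graph_pt p)).
Proof.
move=> kT e e0; have NT := kT.1.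
have [c c0 hc] := tr_cont p.
have [kp kp0 hkp] := N_bound vN (Nev p).
have m0 : 0 < kp + (c + kp) + 1 by rewrite ltr_wpDl// !addr_ge0.
have [q [h1 h2]] := ker_near kT (divr_gt0 e0 m0).
set e1 := e / _ in h1 h2.
exists (p * q); apply: (le_trans (nrm_prod_le _)) => /=.
have a1 : nrm (rm T (emb (ev p)) - emb (ev (p * q))) <= kp * e1.
  rewrite (rmulE tM vN NM L NT (Nev p)) (evM vN Nx) -(embB L); [|exact: cN|exact: cN].
  have -> : (ev p \o T) - (ev p \o ev q) = ev p \o (T - ev q).
    by apply/funext => u; rewrite /= !opE /= (opB (bN (Nev _))).
  have NTq := vn_B vN NT (Nev q).
  apply: (le_trans (nrm_emb_lmul tM vN NM L kp0 hkp (Nev p) NTq)).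
  by rewrite ler_wpM2l// (embB L).
have a2 : nrm (tr (rm T) (d p) - d (p * q)) <= c * e1 + kp * e1.
  apply: (le_trans (nrmB_triangle _ (tr (rm (ev q)) (d p) + tl (lm (ev p)) (d q)) _)).
  rewrite [X in _ + X]nrmB tc_leibniz addr0.
  rewrite -[tr (rm T) (d p)]addr0; apply: (le_trans (nrmDB _ _ _ _)).
  rewrite sub0r nrmN; apply: lerD.
    by apply: (le_trans (hc _ _ NT (Nev q))); rewrite ler_wpM2l.
  have lr := op_lin (lmul_bounded tM vN NM L (Nev p)).
  have h := tc_tl_bound lr kp0 (lmul_bounded_by tM vN NM (Nev p) kp0 hkp) (d q).
  apply: (le_trans h).
  by rewrite ler_wpM2l.
apply: (le_trans (lerD a1 a2)); rewrite -!mulrDl /e1 mulrCA.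
by rewrite ger_pMr// ler_pdivrMr// mul1r lerDl.
Qed.

Lemma closed_graph_map (f : ee -> ee) c : linear f -> 0 <= c -> bounded_by c f ->
  (forall p, closed_graph (f (graph_pt p))) -> forall v, closed_graph v -> closed_graph (f v).
Proof.
move=> lf c0 bf h v hv; apply: closed_graph_limit => e e0.
have c1 : 0 < c + 1 by rewrite ltr_wpDl.
have [p hp] := hv _ (divr_gt0 e0 c1); exists (f (graph_pt p)) => //.
rewrite -(linearB_of _ _ lf); apply: (le_trans (bf _)).
apply: (@le_trans _ _ (c * (e / (c + 1)))); first by rewrite ler_wpM2l.
by rewrite mulrCA ger_pMr// ler_pdivrMr// mul1r lerDl.
Qed.

Lemma ker_lact T v : ker T -> closed_graph v -> closed_graph (lact_ T v).
Proof.
move=> kT; have NT := kT.1; have [c c0 cT] := N_bound vN NT.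
apply: (closed_graph_map (c := c)) => //; [exact: lact_lin|exact: lact_bound|].
by move=> p; exact: ker_lact_graph_pt.
Qed.
Lemma ker_ract T v : ker T -> closed_graph v -> closed_graph (ract_ T v).
Proof.
move=> kT; have NT := kT.1; have [c c0 cT] := N_bound vN NT.
apply: (closed_graph_map (c := c)) => //; [exact: ract_lin|exact: ract_bound|].
by move=> p; exact: ker_ract_graph_pt.
Qed.

Lemma ker_comp S T : ker S -> ker T -> ker (S \o T).
Proof.
move=> kS kT; split; first exact: cN kS.1 kT.1.
have := ker_lact kS kT.2.
by rewrite /lact_ /= tl0 (lmulE tM vN NM L kS.1 kT.1).
Qed.

Lemma ker_lin a S T : ker S -> ker T -> ker (a *: S + T).
Proof.
move=> [NS hS] [NT hT]; split; first exact: (vn_lin vN).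
have := closed_graph_lin a hS hT; rewrite (emb_lin L a NS NT).
by have -> : a *: ((emb S, 0) : ee) + (emb T, 0) = (a *: emb S + emb T, a *: 0 + 0) by [];
  rewrite scaler0 addr0.
Qed.

Lemma ker_id : ker id.
Proof.
split=> //; have := closed_graph_pt 1; rewrite /graph_pt tc_d1.
have -> // : ev 1 = id.
have -> : ev 1 = ew mone by exact: evU.
by rewrite [mone]fmoneE.
Qed.

Lemma ker_closed T : N T ->
  (forall e, 0 < e -> exists2 S, ker S & nrm (emb T - emb S) <= e) -> ker T.
Proof.
move=> NT h; split=> //; apply: closed_graph_limit => e e0.
have [S [NS hS] hTS] := h e e0; exists (emb S, 0) => //.
apply: (le_trans (nrm_prod_le _)) => /=.
by rewrite subrr nrm0 addr0.
Qed.

Lemma graph_pt_var j : graph_pt << fmu j >> = (emb (x j), if k == j then pt else 0).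
Proof. by rewrite /graph_pt evU tc_dU /eval_word fmuE. Qed.

Lemma ker_var j : k != j -> ker (x j).
Proof. by move=> kj; split=> //; have := closed_graph_pt << fmu j >>; rewrite graph_pt_var (negbTE kj). Qed.

Lemma ker_gen (G : set (H -> H)) T : G `<=` ker -> (forall S, G S -> G (adj S)) ->
  N T -> commutant (commutant G) T -> ker T.
Proof.
move=> Gk aG NT GT; apply: ker_closed => // e e0.
have GN : G `<=` N by move=> S /Gk[].
have [S gS hS] := bicommutant_dense vM tM vN NM L GN aG NT GT e0.
exists S => //; elim: gS => [|A B /Gk kA _ kB|a A B _ kA _ kB].
- exact: ker_id.
- exact: ker_comp.
- exact: ker_lin.
Qed.

Variable Cf : R.
Hypothesis Cf0 : 0 <= Cf.
Hypothesis fisher : forall p, cabs (eval_tau2 x tau (fdq k p)) <= Cf * nrm (emb (ev p)).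

Lemma nrm_emb_id : nrm (emb id) = 1.
Proof.
apply: (@pexpIrn _ 2); rewrite ?nnegrE ?nrm_ge0// nrm_emb// adj_id expr1n.
exact: (retr_id tM).
Qed.
Lemma nrm_pt : nrm pt = 1.
Proof. by rewrite /pt tc_nrm nrm_emb_id mulr1. Qed.

Lemma closed_graph_fisher v : closed_graph v -> cabs (ip v.2 pt) <= Cf * nrm v.1.
Proof.
move=> hv; apply/ler_addgt0Pr => e e0.
have c0 : 0 < Cf + 1 by rewrite ltr_wpDl.
have [p hp] := hv _ (divr_gt0 e0 c0).
have h1 := le_trans (nrm_prod_fst _) hp; have h2 := le_trans (nrm_prod_snd _) hp.
rewrite /= in h1 h2; set e1 := e / _ in h1 h2.
have -> : ip v.2 pt = ip (v.2 - d p) pt + ip (d p) pt by rewrite -ipDl subrK.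
apply: (le_trans (cabsD _ _)).
have a1 : cabs (ip (v.2 - d p) pt) <= e1.
  by apply: (le_trans (ip_cs _ _)); rewrite nrm_pt mulr1.
have a2 : cabs (ip (d p) pt) <= Cf * (nrm v.1 + e1).
  rewrite tc_pair; apply: (le_trans (fisher p)); rewrite ler_wpM2l//.
  have := nrm_triangle (emb (ev p) - v.1) v.1; rewrite subrK [nrm (_ - v.1)]nrmB.
  by move=> h; apply: (le_trans h); rewrite addrC lerD2l.
apply: (le_trans (lerD a1 a2)); rewrite mulrDr addrCA lerD2l.
have : (Cf + 1) * e1 = e by rewrite mulrC divfK// gt_eqF.
by rewrite mulrDl mul1r addrC => ->.
Qed.

(** Otherwise the closed graph contains the difference [(0, pt)] of [(x k, pt)] and [(x k, 0)], and
    the bound on it reads [1 <= 0]. *)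
Lemma not_ker : ~ ker (x k).
Proof.
move=> [Nk h]; have := closed_graph_lin (-1) h (closed_graph_pt << fmu k >>).
rewrite graph_pt_var eqxx.
have -> : (-1) *: ((emb (x k), 0) : ee) + (emb (x k), pt) = (0, pt).
  transitivity ((-1) *: emb (x k) + emb (x k), (-1) *: 0 + pt) => //.
  by rewrite scaler0 add0r [(-1) *: emb _]scaleN1r addNr.
move=> /closed_graph_fisher; rewrite nrm0 mulr0.
rewrite /pt tc_ip (ip_emb L)// adj_id -[id \o id]/id (tau_unit tM) mulr1 cabs1.
by rewrite ler10.
Qed.

End Graph.

(** * The projection onto the closed graph *)

Section Coupling.
Variables (R : realType) (H : hilbert R) (M N : set (H -> H)) (tau : (H -> H) -> R[i]).
Hypothesis tM : tracial_state M tau.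
Hypothesis vN : vnalg N.
Hypothesis NM : N `<=` M.
Variable L : l2space N tau.
Variables (I : choiceType) (x : I -> H -> H).
Hypothesis Nx : forall i, N (x i).
Variable k : I.
Variable E : calculus L x k.

Notation emb := (l2_emb L).
Notation lm := (lmul L).
Notation rm := (rmul L).
Notation poly := {malg R[i][{fmonom I}]}.
Notation ev := (eval_poly x).
Notation ew := (eval_word x).
Notation el := (@tc_el _ _ _ _ _ _ _ _ E).
Notation d := (@tc_d _ _ _ _ _ _ _ _ E).
Notation ee := (prodh L E).
Notation graph_pt := (graph_pt E).
Notation ker := (ker E).
Notation closed_graph := (@closed_graph _ _ _ _ _ _ _ _ E).
Notation lact_ := (@lact_ _ _ _ _ _ _ _ _ E).
Notation ract_ := (@ract_ _ _ _ _ _ _ _ _ E).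
Implicit Types (p q : poly) (T S : H -> H) (v : ee).

Let bN T : N T -> bounded_op T. Proof. exact: vnalg_bounded. Qed.
Let aN T : N T -> N (adj T). Proof. exact: vnalg_adj. Qed.
Let cN S T : N S -> N T -> N (S \o T). Proof. exact: vn_comp. Qed.
Let Nev p : N (ev p). Proof. exact: N_poly. Qed.
Let New w : N (ew w). Proof. exact: N_word. Qed.

Hypothesis dens : forall T e, N T -> 0 < e -> exists p, nrm (emb T - emb (ev p)) <= e.

(* U is the first component of the projection onto the closed graph of d. *)
Definition is_proj (U : ee -> L) := is_ext setT graph_pt (fun p => emb (ev p)) 1 U.

Lemma proj_exists : exists U, is_proj U.
Proof.
apply: ext_exists => //.
- by move=> a p q _ _; rewrite (graph_pt_lin vN Nx).
- by move=> a p q _ _; rewrite ev_lin emb_lin.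
- by move=> p _; rewrite mul1r; exact: (nrm_prod_fst (graph_pt p)).
Qed.

Variable U : ee -> L.
Hypothesis UP : is_proj U.

(** The adjoint must be in [ker] as well, so that the action of [T] preserves both the closed graph
    and its orthogonal complement. *)
Lemma proj_lact T v : ker T -> ker (adj T) -> U (lact_ T v) = lm T (U v).
Proof.
move=> kT kT'; have NT := kT.1; have [c c0 cT] := N_bound vN NT.
have cT' := adj_bounded_by (bN NT) c0 cT.
apply: (ext_intertwine ler01 UP (Sa := lact_ (adj T)) (k := c)) => //.
- exact: (lact_lin tM vN NM).
- exact: op_lin (lmul_bounded tM vN NM L NT).
- by move=> u w; exact: (lact_adj tM vN NM).
- exact: (lact_bound tM vN NM kT'.1 c0 cT').
- exact: (lmul_bounded_by tM vN NM).
- move=> p e _ e0; have [q hq] := ker_lact_graph_pt tM vN NM Nx p kT e0.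
  by exists q; split=> //; exact: le_trans (nrm_prod_fst _) hq.
- by move=> p e _ e0; have [q hq] := ker_lact_graph_pt tM vN NM Nx p kT' e0; exists q.
Qed.

Lemma proj_ract T v : ker T -> ker (adj T) -> U (ract_ T v) = rm T (U v).
Proof.
move=> kT kT'; have NT := kT.1; have [c c0 cT] := N_bound vN NT.
have cT' := adj_bounded_by (bN NT) c0 cT.
apply: (ext_intertwine ler01 UP (Sa := ract_ (adj T)) (k := c)) => //.
- exact: (ract_lin tM vN NM).
- exact: op_lin (rmul_bounded tM vN NM L NT).
- by move=> u w; exact: (ract_adj tM vN NM).
- exact: (ract_bound tM vN NM kT'.1 c0 cT').
- exact: (rmul_bounded_by tM vN NM).
- move=> p e _ e0; have [q hq] := ker_ract_graph_pt tM vN NM Nx p kT e0.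
  by exists q; split=> //; exact: le_trans (nrm_prod_fst _) hq.
- by move=> p e _ e0; have [q hq] := ker_ract_graph_pt tM vN NM Nx p kT' e0; exists q.
Qed.

Definition W (a b : H -> H) : L := U (0, el (emb a) (emb b)).

Lemma W_bound a b : nrm (W a b) <= nrm (emb a) * nrm (emb b).
Proof.
apply: (le_trans (ext_bound UP _)); rewrite mul1r -(tc_nrm E).
by apply: (le_trans (nrm_prod_le _)); rewrite /= nrm0 add0r.
Qed.

Lemma W_lmul T a b : ker T -> ker (adj T) -> N a -> lm T (W a b) = W (T \o a) b.
Proof.
move=> kT kT' Na; rewrite /W -proj_lact// /lact_ /= tc_tl_el.
by rewrite (lmulE tM vN NM L kT.1 Na) (op0 (lmul_bounded tM vN NM L kT.1)).
Qed.
Lemma W_rmul T a b : ker T -> ker (adj T) -> N b -> rm T (W a b) = W a (b \o T).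
Proof.
move=> kT kT' Nb; rewrite /W -proj_ract// /ract_ /= tc_tr_el.
by rewrite (rmulE tM vN NM L kT.1 Nb) (op0 (rmul_bounded tM vN NM L kT.1)).
Qed.

Lemma proj_d_decomp (u : L) p : (forall a b, N a -> N b -> ip u (W a b) = 0) ->
  ip u (U (0, d p)) = 0.
Proof.
move=> h; have lU := ext_lin UP; have [s ->] := tc_decomp E p.
elim: s => [|t s IH].
  rewrite big_nil; have := lU (-1) 0 0; rewrite scaler0 add0r scaleN1r addNr => z.
  by rewrite -[(0, 0)]/(0 : ee) z ip0r.
rewrite big_cons.
have -> : ((0, t.1 *: el (emb (ew t.2.1)) (emb (ew t.2.2)) +
    \sum_(j <- s) j.1 *: el (emb (ew j.2.1)) (emb (ew j.2.2))) : ee) =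
    t.1 *: ((0, el (emb (ew t.2.1)) (emb (ew t.2.2))) : ee) +
    (0, \sum_(j <- s) j.1 *: el (emb (ew j.2.1)) (emb (ew j.2.2))).
  transitivity ((t.1 *: (0 : L) + 0,  t.1 *: el (emb (ew t.2.1)) (emb (ew t.2.2)) +
    \sum_(j <- s) j.1 *: el (emb (ew j.2.1)) (emb (ew j.2.2))) : ee) => //.
  by rewrite scaler0 addr0.
by rewrite lU ipDr ipZr IH h ?mulr0 ?addr0//; exact: New.
Qed.

Lemma northo_graph_pt r e : northo [set graph_pt p | p in setT] e r ->
  forall q, `|rip r (graph_pt q)| <= e * nrm (graph_pt q).
Proof.
move=> h q; apply: (northo_abs _ h); last by exists q.
split; first by exists 0 => //; rewrite -(subrr 0) -scaleN1r addrC (graph_pt_lin vN Nx) scaleN1r addNr.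
by move=> a _ _ [s _ <-] [t _ <-]; exists (a *: s + t) => //; rewrite (graph_pt_lin vN Nx).
Qed.

(** Let [(f, d f)] be the projection of [(u, 0)] onto the closed graph. Then [|d f|^2] is its
    pairing with [(0, d f)], that is [<u, U (0, d f)>], which is 0 by hypothesis. So [(u - f, 0)] is
    orthogonal to the graph, [u - f] is orthogonal to the dense set of polynomials, and [u = f]. The
    proof runs this argument on a near projection [graph_pt p]. *)
Lemma ker_of_ortho u : N u ->
  (forall a b, N a -> N b -> ip (emb u) (W a b) = 0) -> ker u.
Proof.
move=> Nu hu; split=> // eta eta0.
have e30 : 0 < eta / 3 by rewrite divr_gt0.
have [g hg] := dens Nu e30; set y := eta / 3 in e30 hg *.
(* [g] is fixed before [e], so that [e] can be chosen against the size of [graph_pt g]: the errors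
   in [F1] and [F2] then add up to at most [c e <= y^2], which gives [|f| <= 2 y] and, with
   [|d p| <= y], the total [3 y = eta]. *)
pose c := 2 * nrm (graph_pt g) + nrm (emb u) + 1.
have c0 : 0 < c by rewrite ltr_wpDl// addr_ge0 ?mulr_ge0 ?nrm_ge0.
have [e [e0 e1 ey ec]] : exists e, [/\ 0 < e, e <= 1, e <= y & c * e <= y ^+ 2].
  exists (Num.min (Num.min 1 y) (y ^+ 2 / c)); split.
  - by rewrite !lt_min ltr01 e30 divr_gt0 ?exprn_gt0.
  - by rewrite !ge_min lexx.
  - by rewrite !ge_min lexx orbT.
  - by rewrite mulrC -ler_pdivlMr// ge_min lexx orbT.
pose v : ee := (emb u, 0).
have [p [_ hp _]] := ext_near UP v e0.
set r := v - graph_pt p in hp.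
have hr := northo_graph_pt hp.
have dp : nrm (d p) <= e.
  have [->|n0] := eqVneq (nrm (d p)) 0; first exact: ltW.
  have np : 0 < nrm (d p) by rewrite lt_neqAle eq_sym n0 nrm_ge0.
  rewrite -(ler_pM2r np) -expr2 nrm_sqr.
  apply/ler_addgt0Pr => s s0.
  pose K := nrm (emb u) + e + nrm (graph_pt p) + 1.
  have K0 : 0 < K by rewrite ltr_wpDl// !addr_ge0 ?nrm_ge0// ltW.
  have [q [_ hq bq]] := ext_near UP ((0, d p) : ee) (divr_gt0 s0 K0).
  set f := s / K in hq bq.
  have f0 : 0 < f by rewrite divr_gt0.
  rewrite mul1r in bq.
  have E1 : rip (d p) (d p) = rip (graph_pt p) ((0, d p) : ee).
    by rewrite rip_prod /= rip0r add0r.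
  have E2 : rip (graph_pt p) ((0, d p) : ee) =
      rip v (graph_pt q) - rip r (graph_pt q) + rip ((0, d p) - graph_pt q : ee) (graph_pt p).
    by rewrite /r ripBl [rip (_ - graph_pt q) _]ripBl (ripC _ (graph_pt p)) (ripC (graph_pt q)); ring.
  have b1 : rip v (graph_pt q) <= nrm (emb u) * f.
    have -> : rip v (graph_pt q) = rip (emb u) (emb (ev q) - U (0, d p)).
      rewrite rip_prod /= rip0l addr0 ripBr /rip (proj_d_decomp p hu) /=.
      by rewrite subr0.
    by apply: (le_trans (rip_le _ _)); rewrite ler_wpM2l ?nrm_ge0// nrmB.
  have b2 : nrm (graph_pt q) <= nrm (d p) + f.
    have nw : nrm ((0, d p) : ee) <= nrm (d p).
      by apply: (le_trans (nrm_prod_le _)); rewrite /= nrm0 add0r.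
    apply: (le_trans (near_nrm (ltW f0) (northo_graph_pt hq q))).
    by rewrite lerD2r.
  have b3 : rip ((0, d p) - graph_pt q : ee) (graph_pt p) <= f * nrm (graph_pt p).
    by apply: hq; exists p.
  have b4 : - rip r (graph_pt q) <= e * (nrm (d p) + f).
    have := hr q; rewrite ler_norml => /andP[h _].
    have : e * nrm (graph_pt q) <= e * (nrm (d p) + f) by rewrite ler_wpM2l// ltW.
    lra.
  rewrite E1 E2.
  have : f * K = s by rewrite divfK// gt_eqF.
  rewrite /K; nra.
have gp : nrm (graph_pt p) <= nrm (emb u) + e.
  have nv : nrm v <= nrm (emb u).
    by apply: (le_trans (nrm_prod_le _)); rewrite /= nrm0 addr0.
  by apply: (le_trans (near_nrm (ltW e0) (hr p))); rewrite lerD2r.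
pose f := emb u - emb (ev p).
have rE q : rip r (graph_pt q) = rip f (emb (ev q)) - rip (d p) (d q).
  by rewrite rip_prod /= -/f sub0r ripNl.
have F1 : rip f (emb (ev g)) <= e * nrm (graph_pt g) + e * nrm (graph_pt g).
  have := hr g; rewrite ler_norml rE => /andP[_ h1].
  have h2 := rip_le (d p) (d g).
  have h3 : nrm (d p) * nrm (d g) <= e * nrm (graph_pt g).
    by apply: ler_pM; rewrite ?nrm_ge0//; exact: (nrm_prod_snd (graph_pt g)).
  lra.
have F2 : - rip f (emb (ev p)) <= e * nrm (graph_pt p).
  have := hr p; rewrite ler_norml rE => /andP[h1 _].
  have := rip_ge0 (d p); lra.
have F3 : rip f (emb u - emb (ev g)) <= nrm f * y.
  by apply: (le_trans (rip_le _ _)); rewrite ler_wpM2l ?nrm_ge0.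
have F4 : nrm f ^+ 2 <= y * nrm f + y ^+ 2.
  have -> : nrm f ^+ 2 = rip f (emb u - emb (ev g)) + rip f (emb (ev g)) - rip f (emb (ev p)).
    by rewrite nrm_sqr {2}/f !ripBr; ring.
  have : e * nrm (graph_pt p) <= e * (nrm (emb u) + 1).
    by rewrite ler_wpM2l ?(ltW e0)//; apply: (le_trans gp); rewrite lerD2l.
  move: ec; rewrite /c; lra.
have F5 : nrm f <= 2 * y by have := nrm_ge0 f; nra.
exists p; apply: (le_trans (nrm_prod_le _)); rewrite /= -/f sub0r nrmN.
have -> : eta = 3 * y by rewrite /y; field.
lra.
Qed.

End Coupling.

(** * Partitions of 1 and membership in the kernel *)

Section Partitions.
Variables (R : realType) (H : hilbert R) (M N : set (H -> H)) (tau : (H -> H) -> R[i]).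
Hypothesis tM : tracial_state M tau.
Hypothesis vN : vnalg N.
Hypothesis NM : N `<=` M.
Variable L : l2space N tau.

Notation emb := (l2_emb L).
Notation lm := (lmul L).
Notation rm := (rmul L).
Implicit Types (T S : H -> H).

Let bN T : N T -> bounded_op T. Proof. exact: vnalg_bounded. Qed.
Let aN T : N T -> N (adj T). Proof. exact: vnalg_adj. Qed.
Let cN S T : N S -> N T -> N (S \o T). Proof. exact: vn_comp. Qed.

Lemma nrm_emb_proj e : projection N e -> nrm (emb e) ^+ 2 = retr tau e.
Proof. by move=> [Ne ee ae]; rewrite nrm_emb// ae ee. Qed.

Lemma rm_partition n (e : 'I_n -> H -> H) (h : L) :
  (forall i, projection N (e i)) -> \sum_i e i = id ->
  \sum_i nrm (rm (e i) h) ^+ 2 = nrm h ^+ 2.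
Proof.
move=> pe se.
have hE : h = \sum_i rm (e i) h.
  rewrite -(rmul_sum tM vN NM) ?se ?(rmul_id tM vN NM)// => i; by case: (pe i).
transitivity (rip h (\sum_i rm (e i) h)); last by rewrite -hE nrm_sqr.
rewrite rip_sumr; apply: eq_bigr => i _; have [Ne ee ae] := pe i.
rewrite nrm_sqr (rip_rmul tM vN NM)// ae.
by rewrite -(rmul_comp tM vN NM)// ee.
Qed.

Lemma lm_partition n (f : 'I_n -> H -> H) a : N a ->
  (forall i, projection N (f i)) -> \sum_i f i = id ->
  \sum_i nrm (emb (f i \o a)) ^+ 2 = nrm (emb a) ^+ 2.
Proof.
move=> Na pf sf.
have aE : a = \sum_i (f i \o a).
  by apply/funext => u; rewrite fun_sumE -[LHS]/(id (a u)) -sf fun_sumE.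
transitivity (rip (emb a) (\sum_i emb (f i \o a))); last first.
  rewrite -(emb_sum vN) -?aE ?nrm_sqr// => i.
  by apply: cN => //; case: (pf i).
rewrite rip_sumr; apply: eq_bigr => i _; have [Nf ff af] := pf i.
rewrite nrm_sqr -{1}(lmulE tM vN NM L Nf Na) (rip_lmul tM vN NM)// af.
by rewrite (lmulE tM vN NM L)//; [rewrite compA ff|exact: cN].
Qed.

Variables (I : choiceType) (x : I -> H -> H).
Hypothesis Nx : forall i, N (x i).
Variable k : I.
Variable E : calculus L x k.
Notation ker := (ker E).
Notation ev := (eval_poly x).
Hypothesis dens : forall T e, N T -> 0 < e -> exists p, nrm (emb T - emb (ev p)) <= e.

(* [<u, W (a, b)>] is the sum of the [<u e_i, W (f_i a, b e_i)>], and
   [|b e_i| <= |b| d]. *)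
Lemma ker_of_partition u : N u ->
  (forall d, 0 < d -> exists n (e f : 'I_n -> H -> H),
    [/\ forall i, projection ker (e i), forall i, projection ker (f i),
        \sum_i e i = id, \sum_i f i = id &
        forall i, u \o e i = f i \o u /\ retr tau (e i) <= d ^+ 2]) ->
  ker u.
Proof.
move=> Nu hu.
have [U UP] := proj_exists vN Nx E.
apply: (ker_of_ortho vN Nx dens UP) => // a b Na Nb.
have [kb kb0 hkb] := N_bound vN Nb.
apply/cabs_eq0/(@small_eq0 _ _ (kb * (nrm (emb u) ^+ 2 + nrm (emb a) ^+ 2))).
  exact: cabs_ge0.
move=> d d0; have [n [e [f [pe pf se sf uef]]]] := hu d d0.
have pe' i : projection N (e i) by case: (pe i) => -[].
have pf' i : projection N (f i) by case: (pf i) => -[].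
set z := W U a b.
have key i : ip (rm (e i) (emb u)) z = ip (emb (u \o e i)) (W U (f i \o a) (b \o e i)).
  have [ke ee ae] := pe i; have [kf ff af] := pf i; have Ne := ke.1; have Nf := kf.1.
  have [ueq _] := uef i.
  (* By idempotence [u e_i = f_i (u e_i) e_i]; the outer factors then move across the pairing onto
     [W]. *)
  have e1 : rm (e i) (emb u) = lm (f i) (rm (e i) (emb (u \o e i))).
    rewrite (rmulE tM vN NM L)// (rmulE tM vN NM L)//; last exact: cN.
    rewrite (lmulE tM vN NM L)//; last by apply: cN => //; exact: cN.
    by rewrite -compA ee ueq compA ff.
  rewrite e1 (ip_lmul tM vN NM)// af (ip_rmul tM vN NM)// ae /z.
  rewrite (W_lmul tM vN NM Nx UP)// ?af// (W_rmul tM vN NM Nx UP) ?ae//.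
have -> : ip (emb u) z = \sum_i ip (emb (u \o e i)) (W U (f i \o a) (b \o e i)).
  rewrite -{1}(rmul_id tM vN NM (emb u)) -se (rmul_sum tM vN NM); last by move=> i; case: (pe' i).
  by rewrite ip_suml; apply: eq_bigr => i _; exact: key.
apply: (le_trans (cabs_sum _ _ _)).
have -> : kb * (nrm (emb u) ^+ 2 + nrm (emb a) ^+ 2) * d =
    \sum_i kb * d * (nrm (rm (e i) (emb u)) ^+ 2 + nrm (emb (f i \o a)) ^+ 2).
  by rewrite -mulr_sumr big_split /= (rm_partition _ pe' se) (lm_partition Na pf' sf); ring.
apply: ler_sum => i _; have [Ne ee ae] := pe' i; have [_ te] := uef i.
apply: (le_trans (ip_cs _ _)); rewrite (rmulE tM vN NM L)//.
have h1 := W_bound UP (f i \o a) (b \o e i).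
have h2 : nrm (emb (b \o e i)) <= kb * d.
  apply: (le_trans (nrm_emb_lmul tM vN NM L kb0 hkb Nb Ne)); rewrite ler_wpM2l//.
  by apply: ler_nrm; [exact: ltW|rewrite -nrm_sqr nrm_emb_proj].
have := nrm_ge0 (emb (u \o e i)); have := nrm_ge0 (emb (f i \o a)).
set A := nrm (emb (u \o e i)) in h1 *; set B := nrm (emb (f i \o a)) in h1 *.
move=> B0 A0.
have h3 : B * nrm (emb (b \o e i)) <= B * (kb * d) by rewrite ler_wpM2l.
have h4 : A * nrm (W U (f i \o a) (b \o e i)) <= A * (B * (kb * d)).
  by rewrite ler_wpM2l//; exact: le_trans h1 h3.
apply: (le_trans h4).
have kd : 0 <= kb * d by rewrite mulr_ge0// ltW.
(* The squares of [A] and [B] add up over [i] to [|u|^2] and [|a|^2], independently of the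
   partition. *)
have : A * B <= A ^+ 2 + B ^+ 2 by nra.
by move/(ler_wpM2l kd); lra.
Qed.

End Partitions.

(** * Diffuse algebras *)

Section DiffusePartition.
Variables (R : realType) (H : hilbert R) (M B : set (H -> H)) (tau : (H -> H) -> R[i]).
Hypothesis vM : vnalg M.
Hypothesis tM : tracial_state M tau.
Hypothesis vB : vnalg B.
Hypothesis BM : B `<=` M.
Implicit Types (p q r S T : H -> H).

Let bB T : B T -> bounded_op T. Proof. exact: vnalg_bounded. Qed.
Let projB p : projection B p -> eff p. Proof. exact: proj_eff. Qed.

Lemma proj_ole_comp p q : projection B p -> projection B q -> ole p q ->
  p \o q = p /\ q \o p = p.
Proof. by move=> pp pq; apply: eff_below_proj; [exact: projB|exact: projB|case: pq]. Qed.

Lemma proj_sub p q : projection B p -> projection B q -> ole p q ->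
  projection B (q - p).
Proof.
move=> pp pq h; have [h1 h2] := proj_ole_comp pp pq h.
have [Bp p2 ap] := pp; have [Bq q2 aq] := pq.
split; [exact: (vn_B vB)|exact: sub_proj (bB Bp) (bB Bq) ap aq h2 h1 p2 q2|].
by have [_ ->] : sa (q - p) by apply: sa_B; split=> //; exact: bB.
Qed.

Lemma proj_id : projection B id.
Proof. by split=> //; [exact: (vn_id vB)|exact: adj_id]. Qed.
Lemma proj_0 : projection B 0.
Proof. by split=> //; [exact: (vn_0 vB)|exact: (sa_0 H).2]. Qed.

Lemma proj_ssup F S : F `<=` projection B -> directed F -> ssup F S -> projection B S.
Proof.
move=> FP dF FS; have eF b : F b -> eff b by move=> /FP/projB.
have eS := ssup_eff dF eF FS; have [[bS aS] _ _] := eS.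
split=> //; first by apply: (vn_ssup vB _ dF eF FS) => b /FP[].
apply/funext => u /=; apply/subr0_eq/(@nrm_small_eq0 _ _ _ 3) => e e0.
have [b Fb hb] := ssup_approx [:: u; S u] dF FS e0.
have [Bb bb _] := FP _ Fb.
have h1 := hb u; have h2 := hb (S u); rewrite !inE !eqxx !orbT in h1 h2.
have h3 := eff_contraction (eF _ Fb) (S u - b u).
rewrite (opB (bB Bb)) -[b (b u)]/((b \o b) u) bb mul1r in h3.
have t1 := nrmB_triangle (S (S u)) (b (S u)) (S u).
have t2 := nrmB_triangle (b (S u)) (b u) (S u).
have := h1 isT; have := h2 isT; rewrite [nrm (S u - b u)]nrmB in h3 *; lra.
Qed.

Hypothesis dB : diffuse B.

(** As [q] is not minimal it has a proper nonzero subprojection [r], and [r] or [q - r] has at most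
    half of the trace. *)
Lemma proj_halve q : projection B q -> q <> 0 -> exists r,
  [/\ projection B r, r <> 0, ole r q & retr tau r <= retr tau q / 2].
Proof.
move=> pq q0.
have [r [pr rq r0 rnq]] : exists r, [/\ projection B r, ole r q, r <> 0 & r <> q].
  apply: contrapT => h; apply: dB; exists q; split=> // r pr /op_leE rq.
  have srq : ole r q.
    by apply: rq; [case: (projB pr)|case: (projB pq)].
  have [->|r0] := pselect (r = 0); first by left.
  by right; apply: contrapT => rnq; apply: h; exists r.
have pqr := proj_sub pr pq rq.
have [Br _ _] := pr; have [Bq _ _] := pq.
have tq : retr tau (q - r) = retr tau q - retr tau r by rewrite (retrB tM vB BM).
have [h|h] := leP (retr tau r) (retr tau q / 2); first by exists r.
exists (q - r); split=> //.
- by move=> /subr0_eq qr; apply: rnq.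
- by move=> u; rewrite !opE ripBl gerBl; exact/eff_ge0/projB.
- by rewrite tq; lra.
Qed.

Lemma proj_small q e : projection B q -> q <> 0 -> 0 < e -> exists r,
  [/\ projection B r, r <> 0, ole r q & retr tau r <= e].
Proof.
move=> pq q0 e0.
have hn n : exists r, [/\ projection B r, r <> 0, ole r q & retr tau r <= retr tau q / 2 ^+ n].
  elim: n => [|n [r [pr r0 rq tr]]].
    by exists q; split=> //; rewrite expr0 divr1.
  have [r' [pr' r0' rq' tr']] := proj_halve pr r0.
  exists r'; split=> //; first exact: ole_trans rq' rq.
  by rewrite exprS invfM mulrCA; lra.
have [r [pr r0 rq tr]] := hn (Num.truncn (retr tau q / e)).+1.
exists r; split=> //; apply: (le_trans tr).
have e2 : 0 < 2 ^+ (Num.truncn (retr tau q / e)).+1 :> R by rewrite exprn_gt0.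
rewrite ler_pdivrMr// mulrC -ler_pdivrMr//.
apply: (le_trans (ltW (truncnS_gt _))).
by rewrite -natrX ler_nat; apply/ltnW/ltn_expl.
Qed.

(** Zorn's lemma for the finite sums of small projections. They are closed under suprema: by
    normality some [b] in the family satisfies [tau (S - b) <= e], so adding the single piece
    [S - b] to the finite sum for [b] gives [S]. A maximal sum is 1, since otherwise [proj_small]
    provides a further piece below its complement. *)
Lemma diffuse_partition e : 0 < e -> exists n (f : 'I_n -> H -> H),
  [/\ forall i, projection B (f i), \sum_i f i = id & forall i, retr tau (f i) <= e].
Proof.
move=> e0.
pose P := [set p | projection B p /\ exists s : seq (H -> H),
  (forall q, q \in s -> projection B q /\ retr tau q <= e) /\ \sum_(q <- s) q = p].
suff [_ [s [hs ss]]] : P id.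
  exists (size s), (tnth (in_tuple s)); split.
  - by move=> i; have [] := hs _ (mem_tnth i (in_tuple s)).
  - by rewrite -[RHS]ss (big_tnth _ _ s).
  - by move=> i; have [] := hs _ (mem_tnth i (in_tuple s)).
have [|||m [[pm [s [hs ss]]] _ maxm]] := @eff_maximal R H P 0.
- by move=> b [/projB].
- move=> F S FP dF FS eS ub.
  have FPr : F `<=` projection B by move=> b /FP[].
  have eF b : F b -> eff b by move=> /FPr/projB.
  have FB : F `<=` B by move=> b /FPr[].
  have pS := proj_ssup FPr dF FS; split=> //.
  have [b Fb tb] := retr_normal vM tM vB BM FB dF eF FS e0.
  have [pb [s [hs ss]]] := FP _ Fb.
  exists ((S - b) :: s); split; last by rewrite big_cons ss subrK.
  move=> q; rewrite inE => /orP[/eqP ->|/hs//].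
  have pSb : projection B (S - b) by apply: proj_sub => //; exact: ub.
  split=> //; rewrite (retrB tM vB BM); [lra|by case: pS|exact: FB].
- by split; [exact: proj_0|exists [::]; split=> //; rewrite big_nil].
have [<-|m1] := pselect (m = id); first by split=> //; exists s.
have em := projB pm.
have mid : ole m id by case: em.
have pq := proj_sub pm proj_id mid.
have q0 : id - m <> 0 by move=> /subr0_eq h; apply: m1.
have [r [pr r0 rq tr]] := proj_small pq q0 e0.
have [r1 r2] := proj_ole_comp pr pq rq.
have [Bm mm am] := pm; have [Br rr ar] := pr.
have mr u : m (r u) = 0.
  have /(congr1 (@^~ u)) := r2; rewrite /= !opE => /(congr1 (fun v => v - r u)).
  by rewrite subrr addrAC subrr sub0r => /eqP; rewrite oppr_eq0 => /eqP.
have rm u : r (m u) = 0.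
  have /(congr1 (@^~ u)) := r1; rewrite /= !opE (opB (bB Br)) => /(congr1 (fun v => v - r u)).
  by rewrite subrr addrAC subrr sub0r => /eqP; rewrite oppr_eq0 => /eqP.
exfalso; apply: r0; apply: (addrI m); rewrite addr0; apply: maxm.
  split.
    split; first exact: (vn_D vB).
      apply/funext => u; rewrite /= !opE (opD (bB Bm)) (opD (bB Br)) mr rm addr0 add0r.
      by rewrite -[m (m u)]/((m \o m) u) -[r (r u)]/((r \o r) u) mm rr.
    by have [_ ->] : sa (m + r) by apply: sa_D; split=> //; exact: bB.
  exists (r :: s); split; last by rewrite big_cons ss addrC.
  by move=> q; rewrite inE => /orP[/eqP ->|/hs].
by move=> u; rewrite !opE ripDl lerDl; exact/eff_ge0/projB.
Qed.

End DiffusePartition.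

(** * Minimal projections *)

Section MinimalProjection.
Variables (R : realType) (H : hilbert R) (M N B : set (H -> H)) (tau : (H -> H) -> R[i]).
Hypothesis vM : vnalg M.
Hypothesis tM : tracial_state M tau.
Hypothesis vN : vnalg N.
Hypothesis NM : N `<=` M.
Variable L : l2space N tau.
Hypothesis vB : vnalg B.
Hypothesis BN : B `<=` N.
Hypothesis abB : abelian_alg B.
Implicit Types (a b c p x y z m S T : H -> H).
Notation emb := (l2_emb L).

Let bB T : B T -> bounded_op T. Proof. exact: vnalg_bounded. Qed.
Let cB S T : B S -> B T -> B (S \o T). Proof. exact: vn_comp. Qed.
Let cN S T : N S -> N T -> N (S \o T). Proof. exact: vn_comp. Qed.
Let BM : B `<=` M. Proof. by move=> T /BN/NM. Qed.

Lemma ssup_retr_le F S c : F `<=` B -> directed F -> (forall b, F b -> eff b) ->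
  ssup F S -> N c -> (forall b, F b -> retr tau (b \o c) <= 0) -> retr tau (S \o c) <= 0.
Proof.
move=> FB dF eF FS Nc h.
have BS : B S by exact: (vn_ssup vB FB dF eF FS).
case: leP => // hlt; suff h0 : retr tau (S \o c) = 0 by rewrite h0 ltxx in hlt.
apply: (@small_eq0 _ _ (nrm (emb c))); first exact: ltW.
move=> e e0; have [b Fb hb] := retr_normal vM tM vB BM FB dF eF FS (exprn_gt0 2 e0).
have Bb := FB _ Fb.
have ed : eff (S - b).
  by apply: eff_diff; [exact: eF|exact: ssup_eff FS|exact: (ssup_ub dF FS)].
have Bd : B (S - b) by exact: (vn_B vB).
have td : nrm (emb (S - b)) <= e.
  apply: ler_nrm; first exact: ltW.
  rewrite -nrm_sqr; apply: (le_trans (eff_nrm_emb tM vN NM L (BN Bd) ed)).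
  by rewrite (retrB tM vB BM)//; lra.
have -> : S \o c = (b \o c) + ((S - b) \o c).
  by apply/funext => u; rewrite /= !opE /= addrC subrK.
rewrite (retrD tM NM); [|exact: cN (BN Bb) Nc|exact: cN (BN Bd) Nc].
apply: (@le_trans _ _ (retr tau ((S - b) \o c))); first by rewrite gerDr; exact: h.
have [[_ ad] _ _] := ed.
have -> : retr tau ((S - b) \o c) = rip (emb c) (emb (S - b)).
  by rewrite /rip (ip_emb L)//; [rewrite ad|exact: BN].
by apply: (le_trans (rip_le _ _)); rewrite ler_wpM2l ?nrm_ge0.
Qed.

Definition lower_part p (C : set (H -> H)) : set (H -> H) :=
  [set b | [/\ B b, eff b, ole b p & forall c, C c -> retr tau (b \o c) <= 0]].

Lemma lower_part_closed p C : C `<=` N -> sup_closed (lower_part p C).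
Proof.
move=> CN F S FP dF FS eS ub.
have FB : F `<=` B by move=> b /FP[].
have eF b : F b -> eff b by move=> /FP[].
split=> //; first exact: (vn_ssup vB FB dF eF FS).
  by apply: (ssup_lub dF FS) => b /FP[].
by move=> c Cc; apply: (ssup_retr_le FB dF eF FS (CN _ Cc)) => b /FP[_ _ _]; exact.
Qed.

Lemma eff_scale z k : sa z -> ole 0 z -> 0 < k -> bounded_by k z ->
  eff ((k^-1)%:C%C *: z).
Proof.
move=> sz z0 k0 hk; split; first exact: sa_Z.
  by move=> u; rewrite !opE ripZl rip0l mulr_ge0 ?invr_ge0 ?(ltW k0)//;
    have := z0 u; rewrite opE rip0l.
move=> u; rewrite opE ripZl ler_pdivrMl//.
apply: (le_trans (rip_le _ _)); rewrite -nrm_sqr expr2 mulrA.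
by rewrite ler_wpM2r ?nrm_ge0.
Qed.

Lemma bounded_pos T : B T -> exists2 k, 0 < k & bounded_by k T.
Proof.
move=> BT; have [k k0 hk] := N_bound vN (BN BT).
exists (k + 1); first by rewrite ltr_wpDl.
by move=> u; apply: (le_trans (hk u)); rewrite ler_wpM2r ?nrm_ge0// lerDl.
Qed.

(* The cubic [m (3 - m)^2 / 4] dominates [m] on [0, 1], with equality at 0 and
   1 only, and is [m] times a square. *)
Definition bump m := (4^-1 : R)%:C%C *: ((id + id + id - m) \o m \o (id + id + id - m)).

(** [4 (bump m - m) = m (1 - m)^2 + 4 m (1 - m)] and [4 (1 - bump m) = 4 (1 - m)^2 - m (1 - m)^2],
    where [0 <= m (1 - m)^2 <= (1 - m)^2]. The numbers [t0] to [t3] are the moments of [m] at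
    [u]. *)
Lemma bump_eff m : eff m -> [/\ eff (bump m), ole m (bump m) & bump m = m -> m \o m = m].
Proof.
move=> em; have [sm _ _] := em.
have sw : sa (id + id + id - m).
  by apply: sa_B => //; do !apply: sa_D; exact: sa_id.
have sb : sa (bump m) by apply: sa_Z; exact: sa_sandwich.
pose t0 (u : H) := rip u u; pose t1 u := rip (m u) u.
pose t2 u := rip (m u) (m u); pose t3 u := rip (m (m u)) (m u).
have bE u : rip (bump m u) u = 4^-1 * (9 * t1 u - 6 * t2 u + t3 u).
  rewrite /bump opE ripZl /= (rip_sa sw (m _)) !opE (opB sm.1) !(opD sm.1).
  rewrite !ripBl !ripDl !ripBr !ripDr [rip (m (m u)) u](rip_sa sm).
  by rewrite /t1 /t2 /t3; ring.
have h1 u : 0 <= t1 u - 2 * t2 u + t3 u.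
  have := eff_ge0 (u - m u) em; rewrite (opB sm.1) ripBl !ripBr.
  by rewrite [rip (m (m u)) u](rip_sa sm) /t1 /t2 /t3; lra.
have h2 u : t1 u - 2 * t2 u + t3 u <= t0 u - 2 * t1 u + t2 u.
  have := eff_le1 (u - m u) em; rewrite (opB sm.1) !ripBl !ripBr.
  rewrite [rip (m (m u)) u](rip_sa sm) -[rip u (m u)](rip_sa sm).
  by rewrite /t0 /t1 /t2 /t3; lra.
have h3 u : t2 u <= t1 u by exact: eff_sq.
have h4 u : 0 <= t1 u by exact: eff_ge0.
have le1 : ole m (bump m).
  by move=> u; rewrite bE -/(t1 u); have := h1 u; have := h3 u; lra.
split=> //.
  split=> //; first by move=> u; rewrite opE rip0l; exact: le_trans (h4 u) (le1 u).
  by move=> u; rewrite bE -/(t0 u); have := h1 u; have := h2 u; lra.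
move=> fm; apply: sa_quad_eq => //.
  by have := sa_sandwich sm (sa_id H).
move=> u; rewrite /= [LHS](rip_sa sm) -/(t1 u) -/(t2 u).
by have := bE u; rewrite fm -/(t1 u); have := h1 u; have := h3 u; lra.
Qed.

(* Maximal effects provide the part of the Hahn decomposition of
   [z |-> tau ((a - d) z)] below [p] that is needed, for each [d > 0]; as it is a
   projection, it is [p], so that [tau (a z) <= 0] for all positive [z]. *)
Lemma minimal_scalar p a : minimal_projection B p -> B a -> sa a -> a \o p = a ->
  retr tau a = 0 -> a = 0.
Proof.
move=> [[Bp pp ap] p0 minp] Ba sa_a aP ta.
have ep : eff p by apply: projP => //; exact: bB.
have pa : p \o a = a by rewrite (abB Bp Ba).
have Bid : B id := vn_id vB.
have tp : 0 < retr tau p.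
  rewrite lt_neqAle (retr_ge0 tM vB BM Bp)//; last 2 first.
  - by case: ep.
  - by case: ep.
  rewrite andbT eq_sym; apply/negP => /eqP h; apply: p0.
  apply: (tau_faithful tM); first exact: BM.
  by rewrite ap pp; apply: complex_ext => //=; exact: (tau_Im tM vB BM).
suff key (d : R) z : 0 < d -> B z -> sa z -> ole 0 z ->
    retr tau (p \o (z \o (a - d%:C%C *: id))) <= 0.
  (* [key] is applied to [z = k + a], positive as [k] bounds [a]: since [tau a = 0], it reads
     [tau (a a) <= d k tau p], for every [d > 0]. *)
  have [k k0 hk] := bounded_pos Ba.
  have Baa : B (a \o a) by exact: cB.
  suff h : retr tau (a \o a) = 0.
    have [_ aa] := sa_a; have Maa := BM Baa.
    apply: (tau_faithful tM); first exact: BM.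
    rewrite aa; apply: complex_ext => //=.
    have := tau_ge0 tM vB BM Baa; case/(_ _ _)/cge0P => //.
    + by have := sa_sandwich sa_a (sa_id H).
    + by move=> u; rewrite opE rip0l /= (rip_sa sa_a) rip_ge0.
  apply: (@small_eq0 _ _ (k * retr tau p)).
    apply: (retr_ge0 tM vB BM) => //; first by have := sa_sandwich sa_a (sa_id H).
    by move=> u; rewrite opE rip0l /= (rip_sa sa_a) rip_ge0.
  move=> d d0; have := key d (k%:C%C *: id + a) d0.
  have Bz : B (k%:C%C *: id + a) by exact: (vn_lin vB).
  have -> : p \o ((k%:C%C *: id + a) \o (a - d%:C%C *: id)) =
    (k%:C%C *: a - (d * k)%:C%C *: p) + ((a \o a) - d%:C%C *: a).
    apply/funext => u; rewrite /= !opE /= (opD (bB Bp)) (opZ (bB Bp)).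
    rewrite (opB (bB Bp)) (opZ (bB Bp)) -![p (a _)]/((p \o a) _) pa (opB (bB Ba)).
    rewrite (opZ (bB Ba)); congr (_ + _).
    by rewrite scalerBr scalerA -rmorphM mulrC.
  have Bz1 (l : R[i]) T : B T -> B (l *: T) by exact: (vn_Z vB).
  rewrite (retrD tM BM); last 2 first.
  - by apply: (vn_B vB); exact: Bz1.
  - by apply: (vn_B vB) => //; exact: Bz1.
  rewrite (retrB tM vB BM); last 2 first; [exact: Bz1|exact: Bz1|].
  rewrite (retrB tM vB BM) //; last exact: Bz1.
  rewrite !(retrZ tM vB BM) //.
  rewrite ta !mulr0 => /(_ Bz); rewrite subr0.
  have sz : sa (k%:C%C *: id + a) by apply: sa_D => //; apply: sa_Z; exact: sa_id.
  have oz : ole 0 (k%:C%C *: id + a).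
    move=> u; rewrite !opE rip0l ripDl ripZl.
    have := rip_le (a u) (- u); rewrite ripNr nrmN.
    have h := hk u; have h' := nrm_ge0 u.
    have : nrm (a u) * nrm u <= k * nrm u * nrm u by rewrite ler_wpM2r.
    by rewrite -mulrA -expr2 nrm_sqr; lra.
  by move=> /(_ sz oz); lra.
move=> d0 Bz sz z0; set c0 := a - d%:C%C *: id.
have Bc0 : B c0 by apply: (vn_B vB) => //; exact: (vn_Z vB).
(* [x] is a maximal effect below [p] with [tau (x c0) >= 0]. On what remains, [y = p - x], every
   effect [b <= y] of [B] has [tau (b c0) <= 0] ([low]), since otherwise [x + b] would be larger. *)
pose C1 := [set - c0].
have NC1 : C1 `<=` N by move=> _ ->; apply: BN; rewrite -scaleN1r; exact: (vn_Z vB).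
have [|||x [Fx _ maxx]] := @eff_maximal R H (lower_part p C1) 0.
- by move=> b [].
- exact: lower_part_closed.
- split; [exact: (vn_0 vB)|exact: eff_0|by case: ep|].
  move=> c Cc; have -> : 0 \o c = 0 :> (H -> H) by [].
  by rewrite /retr (tau0 tM vB BM).
have [Bx ex xp hx] := Fx; set y := p - x.
have By : B y by exact: (vn_B vB).
have ey : eff y by exact: eff_diff.
have [sy _ _] := ey.
have low b : B b -> eff b -> ole b y -> retr tau (b \o c0) <= 0.
  move=> Bb eb bY; rewrite leNgt; apply/negP => hb.
  have [sx x0 _] := ex; have [sb b0 _] := eb.
  have bxp : ole (x + b) p by move=> u; have := bY u; rewrite /y !opE ripBl ripDl; lra.
  have bx : x + b = x.
    apply: maxx; last by move=> u; rewrite !opE ripDl lerDl; exact: eff_ge0.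
    split=> //; first exact: (vn_D vB).
      split; first exact: sa_D.
        by move=> u; rewrite !opE ripDl rip0l addr_ge0// eff_ge0.
      by apply: ole_trans bxp _; case: ep.
    move=> _ ->; have -> : (x + b) \o - c0 = (x \o - c0) - (b \o c0).
      by apply/funext => u; rewrite /= !opE /= (opN (bB Bb)).
    have BNc0 : B (- c0) by rewrite -scaleN1r; exact: (vn_Z vB).
    rewrite (retrB tM vB BM); [|exact: cB|exact: cB].
    by have := hx _ erefl; lra.
  have b00 : b = 0 by apply: (addrI x); rewrite addr0.
  move: hb; rewrite b00; have -> : 0 \o c0 = 0 :> (H -> H) by [].
  by rewrite /retr (tau0 tM vB BM) ltxx.
(* The sign condition is strengthened to all [w c0] with [w] positive, so that it survives
   multiplication by the square occurring in [bump]. It holds for [y y]: by commutativity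
   [y y w = y w y], which up to scaling is an effect below [y]. *)
pose C3 := [set T | exists w, [/\ B w, sa w, ole 0 w & T = w \o c0]].
have NC3 : C3 `<=` N by move=> _ [w [Bw _ _ ->]]; apply: BN; exact: cB.
have Pyy : lower_part p C3 (y \o y).
  have [e1 _ e2] := eff_sandwich ey (eff_id H).
  have yp : ole y p by move=> u; rewrite /y !opE ripBl gerBl; exact: eff_ge0.
  split; [exact: cB|exact: e1|exact: ole_trans e2 yp|].
  move=> _ [w [Bw sw w0 ->]].
  have [k k0 hk] := bounded_pos Bw.
  have Bkw : B ((k^-1)%:C%C *: w) by exact: (vn_Z vB).
  have [f1 f2 _] := eff_sandwich ey (eff_scale sw w0 k0 hk).
  have By3 : B (y \o ((k^-1)%:C%C *: w) \o y) by apply: cB => //; exact: cB.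
  have := low _ By3 f1 (ole_trans f2 e2).
  have -> : (y \o ((k^-1)%:C%C *: w) \o y) \o c0 = (k^-1)%:C%C *: ((y \o y) \o (w \o c0)).
    apply/funext => u; rewrite /= !opE /= (opZ (bB By)).
    by rewrite -[w (y _)]/((w \o y) _) (abB Bw By).
  rewrite (retrZ tM vB BM); last by apply: cB; exact: cB.
  by rewrite pmulr_rle0// invr_gt0.
have [|||m [Pm ym maxm]] := @eff_maximal R H (lower_part p C3) (y \o y).
- by move=> b [].
- exact: lower_part_closed.
- exact: Pyy.
have [Bm em mp hm] := Pm.
have [eb mb fixm] := bump_eff em.
have [w3 w3E] : exists w3, w3 = id + id + id - m by eexists.
have bE : bump m = (4^-1 : R)%:C%C *: (w3 \o m \o w3) by rewrite w3E.
have B3 : B w3.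
  by rewrite w3E; apply: (vn_B vB) => //; apply: (vn_D vB) => //; exact: (vn_D vB).
have Bb : B (bump m) by rewrite bE; apply: (vn_Z vB); apply: cB => //; exact: cB.
have [mP Pm'] := eff_below_proj em ep pp mp.
have bP : ole (bump m) p.
  have [_ h _] := eff_sandwich ep eb; rewrite pp in h.
  suff -> : bump m = p \o bump m \o p by [].
  rewrite -[RHS]/(p \o (bump m \o p)) (abB Bb Bp).
  rewrite -[RHS]/((p \o p) \o bump m) pp (abB Bp Bb).
  apply/funext => u; rewrite bE /= !opE /=.
  rewrite -[m (w3 (p u))]/(m ((w3 \o p) u)) (abB B3 Bp) /=.
  by rewrite -[m (p _)]/((m \o p) _) mP.
have Pb : lower_part p C3 (bump m).
  split=> // _ [w [Bw sw w0 ->]].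
  have sw3 : sa w3 by rewrite w3E; apply: sa_B; [do !apply: sa_D; exact: sa_id|case: em].
  have Bww : B (w3 \o w \o w3) by apply: cB => //; exact: cB.
  have := hm ((w3 \o w \o w3) \o c0).
  have -> : bump m \o (w \o c0) = (4^-1 : R)%:C%C *: (m \o ((w3 \o w \o w3) \o c0)).
    apply/funext => u; rewrite bE /= !opE /=; congr (_ *: _).
    rewrite -[w3 (m _)]/((w3 \o m) _) (abB B3 Bm) /=; congr (m _); congr (w3 _).
    by rewrite -[w3 (w _)]/((w3 \o w) _) (abB B3 Bw).
  rewrite (retrZ tM vB BM); last by apply: cB => //; exact: cB.
  move=> h; rewrite pmulr_rle0 ?invr_gt0//; apply: h; exists (w3 \o w \o w3); split=> //.
    exact: sa_sandwich.
  by move=> u; rewrite opE rip0l /= (rip_sa sw3); have := w0 (w3 u); rewrite opE rip0l.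
(* [bump m] is admissible and above the maximal [m], hence equal to it, and [m] is a projection; by
   minimality it is 0 or [p]. *)
have mm := fixm (maxm _ Pb mb).
have [sm _ _] := em.
have pm : projection B m by split=> //; case: sm.
have omp : op_le m p by apply/op_leE => //; case: ep.
have [m0|mE] := minp _ pm omp.
  (* If [m = 0], then [y = 0] and [x = p], so that [tau (p c0) >= 0], although
     [tau (p c0) = - d tau p < 0]. *)
  exfalso; have y0 : y = 0.
    apply/funext => u; apply: nrm_eq0; apply/eqP; rewrite eq_le nrm_ge0 andbT.
    apply: ler_nrm => //; have := ym u; rewrite m0 opE rip0l /= (rip_sa sy) expr0n.
    by [].
  have xE : x = p by move: y0; rewrite /y => /subr0_eq ->.
  have := hx _ erefl; rewrite xE.
  have -> : p \o - c0 = d%:C%C *: p - a.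
    apply/funext => u; rewrite /= /c0 !opE /= (opN (bB Bp)) (opB (bB Bp)) (opZ (bB Bp)).
    by rewrite -[p (a u)]/((p \o a) u) pa opprB.
  rewrite (retrB tM vB BM)//; last exact: (vn_Z vB).
  by rewrite (retrZ tM vB BM)// ta subr0 pmulr_rle0// leNgt tp.
by rewrite -mE; apply: hm; exists z.
Qed.

End MinimalProjection.

(** * The resolvent of a variable *)

(** With [s^2 = r], the product [n s^n] is at most the geometric sum, hence at most [1 / (1 - s)],
    and [n r^n = (n s^n) s^n]. *)
Lemma geometric_small (R : realType) (r e : R) : 0 <= r -> r < 1 -> 0 < e ->
  exists2 n : nat, (0 < n)%N & n%:R * r ^+ n <= e.
Proof.
move=> r0 r1 e0; pose s := Num.sqrt r.
have s0 : 0 <= s := sqrtr_ge0 r.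
have s1 : s < 1 by rewrite -sqrtr1 ltr_sqrt.
have ss : s ^+ 2 = r by rewrite sqr_sqrtr.
have bound n : n%:R * s ^+ n * (1 - s) <= 1 - s ^+ n.
  elim: n => [|n IH]; first by rewrite !mul0r expr0 subrr.
  have t0 := exprn_ge0 n s0; have t1 := exprn_ile1 n s0 (ltW s1).
  rewrite exprS -natr1; move: (n%:R : R) (s ^+ n) IH t0 t1 => k t IH t0 t1.
  have h1 : 0 <= s * (1 - t - k * t * (1 - s)) by apply: mulr_ge0; lra.
  have h2 : s * t <= 1 by rewrite mulr_ile1// ltW.
  have h3 : 0 <= (1 - s) * (1 - s * t) by rewrite mulr_ge0 ?subr_ge0// ltW.
  lra.
have c0 : 0 < 1 - s by rewrite subr_gt0.
have s1' : `|s| < 1 by rewrite ger0_norm.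
have /cvgrPdist_le/(_ _ (mulr_gt0 e0 c0))[n _ hn] := cvg_expr s1'.
exists n.+1 => //.
have := hn n.+1 (leqnSn n); rewrite sub0r normrN ger0_norm ?exprn_ge0//= => h.
rewrite -ss -exprM mulnC exprM expr2 mulrA -(ler_pM2r c0) mulrAC.
apply: le_trans h; rewrite ler_piMl ?exprn_ge0//.
by apply: le_trans (bound _) _; rewrite gerBl exprn_ge0.
Qed.

Section Resolvent.
Variables (R : realType) (H : hilbert R) (M N : set (H -> H)) (tau : (H -> H) -> R[i]).
Hypothesis tM : tracial_state M tau.
Hypothesis vN : vnalg N.
Hypothesis NM : N `<=` M.
Variable L : l2space N tau.
Variables (I : choiceType) (x : I -> H -> H).
Hypothesis Nx : forall i, N (x i).
Variable k : I.
Variable E : calculus L x k.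

Notation emb := (l2_emb L).
Notation lm := (lmul L).
Notation rm := (rmul L).
Notation poly := {malg R[i][{fmonom I}]}.
Notation ev := (eval_poly x).
Notation el := (@tc_el _ _ _ _ _ _ _ _ E).
Notation tl := (@tc_tl _ _ _ _ _ _ _ _ E).
Notation tr := (@tc_tr _ _ _ _ _ _ _ _ E).
Notation d := (@tc_d _ _ _ _ _ _ _ _ E).
Notation pt := (pt E).
Implicit Types (p q P Q : poly) (T S : H -> H).

Let bN T : N T -> bounded_op T. Proof. exact: vnalg_bounded. Qed.
Let aN T : N T -> N (adj T). Proof. exact: vnalg_adj. Qed.
Let cN S T : N S -> N T -> N (S \o T). Proof. exact: vn_comp. Qed.
Let Nev p : N (ev p). Proof. exact: N_poly. Qed.
Let Nid : N id. Proof. exact: (vn_id vN). Qed.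

Lemma ev1 : ev 1 = id.
Proof.
have -> : ev 1 = eval_word x mone by exact: evU.
by rewrite [mone]fmoneE.
Qed.
Lemma evB p q : ev (p - q) = ev p - ev q.
Proof. by rewrite [p - q]addrC -scaleN1r ev_lin scaleN1r addrC. Qed.
Lemma evD p q : ev (p + q) = ev p + ev q.
Proof. by rewrite -[p]scale1r ev_lin !scale1r. Qed.
Lemma ev0 : ev 0 = 0.
Proof. by rewrite -[X in ev X](subrr 0) evB subrr. Qed.
Lemma evZ a p : ev (a *: p) = a *: ev p.
Proof. by rewrite -[a *: p]addr0 ev_lin ev0 addr0. Qed.

Lemma tc_dB p q : d (p - q) = d p - d q.
Proof.
by have := tc_d_lin E (-1) q p; rewrite !scaleN1r [- q + p]addrC [- d q + d p]addrC.
Qed.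
Lemma tc_d0 : d 0 = 0.
Proof. by rewrite -[X in d X](subrr 0) tc_dB subrr. Qed.
Lemma tc_dD p q : d (p + q) = d p + d q.
Proof. by rewrite -[p]scale1r tc_d_lin !scale1r. Qed.
Lemma tc_dZ a p : d (a *: p) = a *: d p.
Proof. by rewrite -[a *: p]addr0 tc_d_lin tc_d0 addr0. Qed.

Lemma ip_null (V : prehilb R) (z w : V) : nrm z = 0 -> ip z w = 0.
Proof.
move=> z0; apply: cabs_eq0; apply/eqP; rewrite eq_le cabs_ge0 andbT.
by apply: le_trans (ip_cs _ _) _; rewrite z0 mul0r.
Qed.

Lemma ip_d_elB p h h' f : ip (d p) (el (h - h') f) = ip (d p) (el h f) - ip (d p) (el h' f).
Proof.
have [s ->] := tc_decomp E p; rewrite !ip_suml -sumrB; apply: eq_bigr => t _.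
by rewrite !ipZl !tc_ip ipBr; ring.
Qed.

(* Apply [d] to [(1 - P) g = 1 - e], multiply by [g] on the left and pair with
   [1 (x) 1]. *)
Lemma resolvent_pair (P g e : poly) c : d P = c *: pt -> (1 - P) * g = 1 - e -> g * (1 - P) = 1 - e ->
  ip (d g) pt = c * tau (ev g) ^+ 2 + ip (d g) (el (emb (adj (ev e))) (emb id))
    - ip (d e) (el (emb (adj (ev g))) (emb id)).
Proof.
move=> dP lg rg; set w := el (emb (adj (ev g))) (emb id).
have := tc_leibniz E (1 - P) g; set z := tr _ _; set z' := tl _ _ => /(ip_null w).
rewrite ipBl ipDl lg !tc_dB tc_d1 !sub0r.
have zE : ip z w = - (c * tau (ev g) ^+ 2).
  rewrite /z tc_dB tc_d1 dP sub0r -scaleNr -[_ *: pt]addr0 tc_tr_lin.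
  have -> : tr (rm (ev g)) 0 = 0.
    by have := tc_tr_lin (rm (ev g)) (-1) (0 : E) 0; rewrite scaler0 add0r scaleN1r addNr.
  rewrite addr0 ipZl /pt tc_tr_el tc_ip (rmulE tM vN NM L (Nev g) Nid) -[id \o ev g]/(ev g).
  rewrite !(ip_emb L)//; last by exact: aN.
  by rewrite (adjK (bN (Nev g))) adj_id expr2 mulNr.
have z'E : ip z' w = ip (d g) pt - ip (d g) (el (emb (adj (ev e))) (emb id)).
  rewrite /z' (tc_tl_adj (S' := lm (adj (ev (1 - P))))); last first.
    by move=> u v; exact: (ip_lmul tM vN NM).
  rewrite /w tc_tl_el (lmulE tM vN NM L)//; [|exact: aN|exact: aN].
  rewrite -(adj_comp (bN (Nev g)) (bN (Nev _))) -(evM vN Nx) rg evB ev1.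
  have -> : adj (id - ev e) = id - adj (ev e).
    have := adj_lin (-1) (bN (Nev e)) (bN Nid); rewrite adj_id rmorphN1 !scaleN1r.
    by rewrite addrC [RHS]addrC.
  by rewrite (embB L)// ?ip_d_elB//; exact: aN.
rewrite zE z'E ipNl => /subr0_eq h.
by rewrite h; ring.
Qed.

(** Bounds for the operator norm of [ev P] and for the norm of [d P]. By the Leibniz rule the pair
    [(a, b)] behaves like the dual number [a + b eps], see [dsizeM]. *)
Definition dsize P a b := [/\ 0 <= a, bounded_by a (ev P) & nrm (d P) <= b].

Lemma dsize_le P a b a' b' : dsize P a b -> a <= a' -> b <= b' -> dsize P a' b'.
Proof.
move=> [a0 hP hd] aa bb; split; [exact: le_trans aa| |exact: le_trans hd bb].
by move=> u; apply: (le_trans (hP u)); rewrite ler_wpM2r ?nrm_ge0.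
Qed.

Lemma dsize1 : dsize 1 1 0.
Proof. by split=> //; [move=> u; rewrite ev1 mul1r|rewrite tc_d1 nrm0]. Qed.

Lemma dsize0 : dsize 0 0 0.
Proof.
split=> //; last by rewrite tc_d0 nrm0.
by move=> u; rewrite ev0 mul0r -[X in nrm X <= _]/(0 : H) nrm0.
Qed.

Lemma dsizeD P Q a b a' b' : dsize P a b -> dsize Q a' b' -> dsize (P + Q) (a + a') (b + b').
Proof.
move=> [a0 hP dP] [a0' hQ dQ]; split; first exact: addr_ge0.
  move=> u; rewrite evD opE mulrDl; apply: (le_trans (nrm_triangle _ _)); exact: lerD.
by rewrite tc_dD; apply: (le_trans (nrm_triangle _ _)); exact: lerD.
Qed.

Lemma dsizeZ c P a b : dsize P a b -> dsize (c *: P) (cabs c * a) (cabs c * b).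
Proof.
move=> [a0 hP dP]; split; first by rewrite mulr_ge0 ?cabs_ge0.
  by move=> u; rewrite evZ opE nrmZ -mulrA ler_wpM2l ?cabs_ge0.
by rewrite tc_dZ nrmZ ler_wpM2l ?cabs_ge0.
Qed.

Lemma dsize_sum n (F : 'I_n -> poly) (a b : 'I_n -> R) : (forall i, dsize (F i) (a i) (b i)) ->
  dsize (\sum_i F i) (\sum_i a i) (\sum_i b i).
Proof.
move=> h; elim: n => [|n IH] in F a b h *; first by rewrite !big_ord0; exact: dsize0.
by rewrite !big_ord_recl; apply: dsizeD => //; exact: IH.
Qed.

Lemma dsizeM P Q a b a' b' : dsize P a b -> dsize Q a' b' ->
  dsize (P * Q) (a * a') (a' * b + a * b').
Proof.
move=> [a0 hP dP] [a0' hQ dQ]; split; first exact: mulr_ge0.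
  move=> u; rewrite (evM vN Nx) /= -mulrA.
  by apply: (le_trans (hP _)); rewrite ler_wpM2l.
rewrite -[d _](subrK (tr (rm (ev Q)) (d P) + tl (lm (ev P)) (d Q))).
apply: (le_trans (nrm_triangle _ _)); rewrite tc_leibniz add0r.
apply: (le_trans (nrm_triangle _ _)); apply: lerD.
  have lr := op_lin (rmul_bounded tM vN NM L (Nev Q)).
  apply: (le_trans (tc_tr_bound lr a0' (rmul_bounded_by tM vN NM (Nev Q) a0' hQ) (d P))).
  by rewrite ler_wpM2l.
have ll := op_lin (lmul_bounded tM vN NM L (Nev P)).
apply: (le_trans (tc_tl_bound ll a0 (lmul_bounded_by tM vN NM (Nev P) a0 hP) (d Q))).
by rewrite ler_wpM2l.
Qed.

Lemma dsizeX P a b n : dsize P a (a * b) -> dsize (P ^+ n) (a ^+ n) (n%:R * a ^+ n * b).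
Proof.
move=> hP; elim: n => [|n IH]; first by rewrite !expr0 !mul0r; exact: dsize1.
rewrite !exprS; apply: dsize_le (dsizeM hP IH) _ _ => //.
by rewrite -natr1 le_eqVlt; apply/orP; left; apply/eqP; ring.
Qed.

Lemma nrm_emb_bound P a b : dsize P a b -> nrm (emb (ev P)) <= a.
Proof.
move=> [a0 hP _]; have := nrm_emb_lmul tM vN NM L a0 hP (Nev P) Nid.
by rewrite -[ev P \o id]/(ev P) (nrm_emb_id tM vN) mulr1.
Qed.

Lemma tau_sa_Im T : N T -> adj T = T -> complex.Im (tau T) = 0.
Proof.
move=> NT aT; have e1 : ip (emb T) (emb id) = tau T by rewrite (ip_emb L)// adj_id.
have e2 : ip (emb id) (emb T) = tau T by rewrite (ip_emb L)// aT.
have := ip_conj (emb T) (emb id); rewrite e1 e2 => /(congr1 (@complex.Im R)).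
by rewrite cIm_conj; lra.
Qed.

End Resolvent.

(** [S] is block diagonal for [p]: the identity on the range of [p], and positive on the complement.
    Applied to the powers of [Y], this keeps their traces above [tau p]. *)
Lemma fixed_ole (R : realType) (H : hilbert R) (S p : H -> H) :
  sa S -> ole 0 S -> sa p -> p \o p = p -> S \o p = p -> ole p S.
Proof.
move=> sS S0 sp pp Sp u; set v := u - p u.
have uE : u = p u + v by rewrite addrC subrK.
have pv : p v = 0 by rewrite /v (opB sp.1) -[p (p u)]/((p \o p) u) pp subrr.
have h1 : rip (S v) (p u) = 0.
  by rewrite (rip_sa sS) -[S (p u)]/((S \o p) u) Sp -(rip_sa sp) pv rip0l.
have h2 : rip (p u) v = 0 by rewrite (rip_sa sp) pv rip0r.
have h3 : rip (p u) u = rip (p u) (p u).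
  by rewrite -(rip_sa sp) -[p (p u)]/((p \o p) u) pp.
have e1 : S u = p u + S v by rewrite {1}uE (opD sS.1) -[S (p u)]/((S \o p) u) Sp.
have -> : rip (S u) u = rip (p u) (p u) + rip (S v) v.
  have e2 w : rip w u = rip w (p u) + rip w v by rewrite {1}uE ripDr.
  by rewrite e1 e2 !ripDl h1 h2 addr0 add0r.
by rewrite h3 lerDl; have := S0 v; rewrite opE rip0l.
Qed.

Lemma malg_scalerAr (C : comNzRingType) (K : monomType) (a : C) (p q : {malg C[K]}) :
  a *: (p * q) = p * (a *: q).
Proof.
pose D := (msupp q `|` msupp (a *: q))%fset.
have qD : (msupp q `<=` D)%fset by exact: fsubsetUl.
have aqD : (msupp (a *: q) `<=` D)%fset by exact: fsubsetUr.
rewrite (malgMEw (fsubset_refl _) qD) (malgMEw (fsubset_refl _) aqD).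
rewrite scaler_sumr; apply: eq_bigr => u _; rewrite scaler_sumr; apply: eq_bigr => v _.
by apply/malgP => w; rewrite !mcoeffsE mulrCA mulrnAr.
Qed.

Lemma malg_exprZn (C : comNzRingType) (K : monomType) (a : C) (p : {malg C[K]}) n :
  (a *: p) ^+ n = a ^+ n *: p ^+ n.
Proof.
elim: n => [|n IH]; first by rewrite !expr0 scale1r.
by rewrite !exprS IH -scalerAl -malg_scalerAr scalerA.
Qed.

Lemma malg_commrZ (C : comNzRingType) (K : monomType) (a : C) (p q : {malg C[K]}) :
  GRing.comm p q -> GRing.comm p (a *: q).
Proof. by rewrite /GRing.comm -malg_scalerAr -scalerAl => ->. Qed.

Lemma one_sub_sqr (A : pzRingType) (p : A) : (1 - p) * (1 + p) = 1 - p ^+ 2.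
Proof. by rewrite -[RHS]opprB subr_sqr_1 -mulNr opprB [p + 1]addrC. Qed.

Lemma geometric_sum (A : pzRingType) (p : A) n : (1 - p) * (\sum_(i < n) p ^+ i) = 1 - p ^+ n.
Proof. by apply: oppr_inj; rewrite -mulNr !opprB subrX1. Qed.

Lemma comm_one_sub_sqr (A : pzRingType) (p : A) : GRing.comm p (1 - p ^+ 2).
Proof. by apply: commrB; [exact: commr1|exact: commrX]. Qed.

Lemma comm_one_shift (A : pzRingType) (p q : A) : GRing.comm p q ->
  GRing.comm ((1 + p) * q) (1 - p).
Proof.
move=> pq; apply: commrB; first exact: commr1.
apply/commr_sym/commrM => //; apply: commrD; [exact: commr1|exact: commr_refl].
Qed.

Lemma shift_lincomb (C : pzRingType) (V : lmodType C) (a : C) (u v : V) :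
  u + a *: v = (1 + a) *: u - a *: (u - v).
Proof. by rewrite scalerDl scale1r scalerBr opprB addrACA subrr addr0. Qed.

(** * Absence of minimal projections in an abelian algebra containing a variable *)

Section Atomless.
Variables (R : realType) (H : hilbert R) (M N B : set (H -> H)) (tau : (H -> H) -> R[i]).
Hypothesis vM : vnalg M.
Hypothesis tM : tracial_state M tau.
Hypothesis vN : vnalg N.
Hypothesis NM : N `<=` M.
Variable L : l2space N tau.
Variables (I : choiceType) (x : I -> H -> H).
Hypothesis Nx : forall i, N (x i).
Variable k : I.
Variable E : calculus L x k.
Hypothesis vB : vnalg B.
Hypothesis BN : B `<=` N.
Hypothesis abB : abelian_alg B.
Hypothesis Bx : B (x k).
Hypothesis sx : sa (x k).
Variable Cf : R.
Hypothesis Cf0 : 0 <= Cf.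
Hypothesis fisher : forall p, cabs (eval_tau2 x tau (fdq k p)) <= Cf * nrm (l2_emb L (eval_poly x p)).

Notation emb := (l2_emb L).
Notation poly := {malg R[i][{fmonom I}]}.
Notation ev := (eval_poly x).
Notation el := (@tc_el _ _ _ _ _ _ _ _ E).
Notation d := (@tc_d _ _ _ _ _ _ _ _ E).
Notation pt := (pt E).
Implicit Types (S T : H -> H).

Let bN T : N T -> bounded_op T. Proof. exact: vnalg_bounded. Qed.
Let bB T : B T -> bounded_op T. Proof. exact: vnalg_bounded. Qed.
Let aN T : N T -> N (adj T). Proof. exact: vnalg_adj. Qed.
Let cB S T : B S -> B T -> B (S \o T). Proof. exact: vn_comp. Qed.
Let Nev p : N (ev p). Proof. exact: N_poly. Qed.
Let Nid : N id. Proof. exact: (vn_id vN). Qed.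
Let BM : B `<=` M. Proof. by move=> T /BN/NM. Qed.
Let evM := evM vN Nx.

(** [S] and [T] commute, so that [S \o T] is self-adjoint and has a real trace; multiplied by [i s],
    it has no real part. *)
Lemma Re_tau_imag (s : R) S T : B S -> B T -> sa S -> sa T ->
  complex.Re (tau (('i%C * s%:C%C) *: (S \o T) + T)) = retr tau T.
Proof.
move=> BS BT sS sT; have BST := cB BS BT.
have h : complex.Im (tau (S \o T)) = 0.
  apply: (tau_sa_Im vN L); first exact: BN.
  by rewrite (adj_comp sS.1 sT.1) sS.2 sT.2; exact: abB.
rewrite (tau_linear tM); [|exact: BM|exact: BM].
by rewrite cReD -mulrA cRe_Zi cIm_Zr h mulr0 oppr0 add0r.
Qed.

Section Shifted.
Variables (p : H -> H) (l kap : R).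
Hypothesis minp : minimal_projection B p.
Hypothesis kap0 : 0 < kap.
Hypothesis kapx : bounded_by kap (x k - l%:C%C *: id).
Hypothesis xp : (x k - l%:C%C *: id) \o p = 0.

(* Polynomials are variables to keep their values out of unification. *)
Variables X Y : poly.
Hypothesis XE : X = (kap^-1)%:C%C *: (<< fmu k >> - l%:C%C *: 1).
Hypothesis YE : Y = 1 - X ^+ 2.

Let Bp : B p. Proof. by case: minp => [[]]. Qed.
Let sp : sa p. Proof. by case: minp => [[h _ h'] _ _]; split=> //; exact: bB. Qed.
Let pp : p \o p = p. Proof. by case: minp => [[]]. Qed.

Lemma evX : ev X = (kap^-1)%:C%C *: (x k - l%:C%C *: id).
Proof. by rewrite XE evZ evB evZ ev1 evU /eval_word fmuE. Qed.

Let BX : B (ev X).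
Proof.
by rewrite evX; apply: (vn_Z vB); apply: (vn_B vB) => //; apply: (vn_Z vB); exact: (vn_id vB).
Qed.
Let sX : sa (ev X).
Proof. by rewrite evX; apply: sa_Z; apply: sa_B => //; apply: sa_Z; exact: sa_id. Qed.

Lemma contraction_X : bounded_by 1 (ev X).
Proof.
move=> u; rewrite evX opE nrmZ cabs_real ger0_norm; last by rewrite invr_ge0 ltW.
by rewrite mul1r ler_pdivrMl.
Qed.

Lemma X_comp_p : ev X \o p = 0.
Proof.
rewrite evX; apply/funext => u.
by have := congr1 (@^~ u) xp; rewrite /= !opE => ->; rewrite scaler0.
Qed.

Lemma dX : d X = (kap^-1)%:C%C *: pt.
Proof. by rewrite XE tc_dZ tc_dB tc_dZ tc_d1 tc_dU eqxx scaler0 subr0. Qed.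

Lemma evY : ev Y = id - (ev X \o ev X).
Proof. by rewrite YE evB ev1 expr2 evM. Qed.

Lemma eff_Y : eff (ev Y).
Proof.
have sXX : sa (ev X \o ev X) by have := sa_sandwich sX (sa_id H).
rewrite evY; split; first by apply: sa_B => //; exact: sa_id.
  move=> u; rewrite !opE rip0l ripBl /= (rip_sa sX) subr_ge0 -!nrm_sqr.
  rewrite ler_pXn2r ?nnegrE ?nrm_ge0//.
  by have := contraction_X u; rewrite mul1r.
by move=> u; rewrite !opE ripBl gerBl /= (rip_sa sX) rip_ge0.
Qed.

Lemma Y_comp_p : ev Y \o p = p.
Proof.
rewrite evY; apply/funext => u; rewrite /= !opE /=.
have := congr1 (@^~ u) X_comp_p; rewrite /= opE => ->.
by rewrite (op0 sX.1) subr0.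
Qed.

Lemma evYS n : ev (Y ^+ n.+1) = ev Y \o ev (Y ^+ n).
Proof. by rewrite exprS evM. Qed.

Lemma BYn n : B (ev (Y ^+ n)).
Proof.
elim: n => [|n IH]; first by rewrite expr0 ev1; exact: (vn_id vB).
rewrite evYS; apply: cB => //; rewrite evY; apply: (vn_B vB); first exact: (vn_id vB).
exact: cB.
Qed.

Lemma eff_Yn n : eff (ev (Y ^+ n)).
Proof.
suff : eff (ev (Y ^+ n)) /\ eff (ev (Y ^+ n.+1)) by case.
elim: n => [|n [e1 e2]].
  by rewrite expr0 expr1 ev1; split; [exact: eff_id|exact: eff_Y].
split=> //; have [h _ _] := eff_sandwich eff_Y e1.
suff -> : ev (Y ^+ n.+2) = ev Y \o ev (Y ^+ n) \o ev Y by [].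
by rewrite -!evM -exprS -exprSr.
Qed.

Lemma Yn_comp_p n : ev (Y ^+ n) \o p = p.
Proof.
elim: n => [|n IH]; first by rewrite expr0 ev1.
by rewrite evYS -[LHS]/(ev Y \o (ev (Y ^+ n) \o p)) IH Y_comp_p.
Qed.

Lemma retr_Yn n : retr tau p <= retr tau (ev (Y ^+ n)).
Proof.
have [sY Y0 _] := eff_Yn n.
apply: (retr_le tM vB BM) => //; first exact: BYn.
by apply: fixed_ole => //; exact: Yn_comp_p.
Qed.

Lemma dsize_X : dsize E X 1 (kap^-1).
Proof.
split=> //; first exact: contraction_X.
by rewrite dX nrmZ (nrm_pt tM vN) mulr1 cabs_real ger0_norm// invr_ge0 ltW.
Qed.

Lemma dsize_Y : dsize E Y 1 (2 / kap).
Proof.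
split=> //; first exact: eff_contraction eff_Y.
have [_ _] := dsizeM tM vN NM Nx dsize_X dsize_X.
rewrite YE tc_dB tc_d1 sub0r nrmN -expr2 => h; apply: (le_trans h).
by rewrite !mul1r mulr2n mulrDl mul1r.
Qed.

Section Approximant.
Variables (s : R) (n : nat).
Hypothesis s0 : 0 < s.
(** The inverse of [1 - i s X] is [(1 + i s X) (1 + s^2 X^2)^-1], and this [rho] is the one for
    which [1 + s^2 X^2 = (1 + s^2) (1 - rho Y)] with [Y = 1 - X^2]. As [rho < 1] and [Y] is a
    contraction, the second factor is [(1 - rho)] times the geometric series in [T = rho Y]; [q] is
    its truncation and [e = T^n] the remainder. *)
Let rho := s ^+ 2 / (1 + s ^+ 2).
Let cc : R[i] := 'i%C * s%:C%C.
Variables P T q g e : poly.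
Hypothesis PE : P = cc *: X.
Hypothesis TE : T = rho%:C%C *: Y.
Hypothesis qE : q = (1 - rho)%:C%C *: \sum_(i < n) T ^+ i.
Hypothesis gE : g = (1 + P) * q.
Hypothesis eE : e = T ^+ n.

Let s2 : 0 < 1 + s ^+ 2. Proof. by rewrite ltr_pwDl// exprn_ge0// ltW. Qed.
Lemma rho_compl : 1 - rho = (1 + s ^+ 2)^-1.
Proof. by rewrite /rho; field; exact: lt0r_neq0. Qed.
Lemma rho_ge0 : 0 <= rho.
Proof. by rewrite /rho divr_ge0 ?exprn_ge0 ?(ltW s0)// ltW. Qed.
Lemma rho_lt1 : rho < 1.
Proof. by rewrite -subr_gt0 rho_compl invr_gt0. Qed.

Lemma resolvent_factor : (1 - P) * (1 + P) = ((1 - rho)^-1)%:C%C *: (1 - T).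
Proof.
rewrite one_sub_sqr PE malg_exprZn; have -> : cc ^+ 2 = - (s ^+ 2)%:C%C.
  by rewrite /cc exprMn sqr_i mulN1r rmorphXn.
rewrite scaleNr opprK TE YE rho_compl invrK; move: (X ^+ 2) => Z.
have sr : (1 + s ^+ 2) * rho = s ^+ 2 by rewrite /rho mulrC divfK// lt0r_neq0.
rewrite [RHS]scalerBr scalerA -rmorphM sr rmorphD rmorph1.
exact: shift_lincomb.
Qed.

Lemma resolvent_l : (1 - P) * g = 1 - e.
Proof.
rewrite gE mulrA resolvent_factor qE -malg_scalerAr -scalerAl scalerA -rmorphM /= divff ?scale1r; last first.
  by rewrite rho_compl invr_eq0 lt0r_neq0.
by rewrite eE geometric_sum.
Qed.

Lemma resolvent_r : g * (1 - P) = 1 - e.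
Proof.
have cXY : GRing.comm X Y by rewrite YE; exact: comm_one_sub_sqr.
have cXT : GRing.comm X T by rewrite TE; exact: malg_commrZ.
have cXq : GRing.comm X q.
  by rewrite qE; apply: malg_commrZ; apply: commr_sum => i _; exact: commrX.
have cPq : P * q = q * P by rewrite PE; apply/esym/malg_commrZ/commr_sym.
by rewrite -resolvent_l gE; exact: comm_one_shift.
Qed.

Lemma ev_sum (J : Type) (r : seq J) (F : J -> poly) : ev (\sum_(j <- r) F j) = \sum_(j <- r) ev (F j).
Proof. by rewrite /eval_poly linear_sum. Qed.

Lemma evq : ev q = (1 - rho)%:C%C *: \sum_(i < n) (rho ^+ i)%:C%C *: ev (Y ^+ i).
Proof.
rewrite qE evZ ev_sum; congr (_ *: _); apply: eq_bigr => i _.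
by rewrite TE malg_exprZn evZ rmorphXn.
Qed.

Lemma sa_q : sa (ev q).
Proof.
rewrite evq; apply: sa_Z; apply: (big_ind (@sa R H)); [exact: sa_0|exact: sa_D|].
by move=> i _; apply: sa_Z; case: (eff_Yn i).
Qed.

Lemma B_q : B (ev q).
Proof.
by rewrite evq; apply: (vn_Z vB); apply: (vn_sum vB) => i; apply: (vn_Z vB); exact: BYn.
Qed.

Lemma retr_q : (1 - rho ^+ n) * retr tau p <= retr tau (ev q).
Proof.
rewrite -geometric_sum evq (retrZ tM vB BM); last first.
  by apply: (vn_sum vB) => i; apply: (vn_Z vB); exact: BYn.
rewrite -mulrA ler_pM2l; last by rewrite rho_compl invr_gt0.
rewrite /retr (tau_sum tM vB BM); last by move=> i; apply: (vn_Z vB); exact: BYn.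
rewrite cRe_sum mulr_suml; apply: ler_sum => i _.
rewrite (tauZ tM vB BM); last exact: BYn.
by rewrite cRe_Zr ler_wpM2l ?exprn_ge0 ?rho_ge0//; exact: retr_Yn.
Qed.

Let beta := 2 / kap.
Let beta0 : 0 < beta. Proof. by rewrite divr_gt0. Qed.

Lemma dsize_Tn m : dsize E (T ^+ m) (rho ^+ m) (m%:R * rho ^+ m * beta).
Proof.
apply: (dsizeX tM vN NM Nx); rewrite TE.
by apply: dsize_le (dsizeZ _ dsize_Y) _ _; rewrite cabs_real ger0_norm ?rho_ge0 ?mulr1.
Qed.

Lemma dsize_q : dsize E q 1 (n%:R * beta).
Proof.
have r1 : 0 < 1 - rho by rewrite rho_compl invr_gt0.
have h := dsizeZ (1 - rho)%:C%C (dsize_sum (fun i : 'I_n => dsize_Tn i)).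
rewrite qE; apply: dsize_le h _ _; rewrite cabs_real gtr0_norm//.
  by rewrite geometric_sum gerBl exprn_ge0// rho_ge0.
apply: (@le_trans _ _ ((1 - rho) * \sum_(i < n) rho ^+ i * (n%:R * beta))).
  rewrite ler_pM2l//; apply: ler_sum => i _.
  rewrite mulrAC [leRHS]mulrC ler_wpM2r ?exprn_ge0 ?rho_ge0//.
  by rewrite ler_pM2r// ler_nat ltnW.
rewrite -mulr_suml mulrA geometric_sum ler_piMl//.
  by rewrite mulr_ge0// ltW.
by rewrite gerBl exprn_ge0// rho_ge0.
Qed.

Lemma cabs_cc : cabs cc = s.
Proof. by rewrite /cc cabsM cabs_i mul1r cabs_real gtr0_norm. Qed.

Lemma dsize_g : dsize E g (1 + s) (s / kap + (1 + s) * (n%:R * beta)).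
Proof.
have h := dsizeM tM vN NM Nx (dsizeD (dsize1 E) (dsizeZ cc dsize_X)) dsize_q.
rewrite gE PE; apply: dsize_le h _ _; rewrite cabs_cc ?mulr1//.
by rewrite mul1r add0r.
Qed.

(** [1 - P] is the adjoint of [1 + P], so [|g u|^2 = <q u, (1 - P) g u> = <q u, (1 - e) u> <= 2
    |u|^2]. This bound does not depend on [s], contrary to the one in [dsize_g]. *)
Lemma bounded_g : bounded_by 2 (ev g).
Proof.
have [_ hq _] := dsize_q; have [_ he _] := dsize_Tn n; rewrite -eE in he.
move=> u; apply: ler_nrm; first by rewrite mulr_ge0// nrm_ge0.
have aP : adj (ev (1 + P)) = ev (1 - P).
  have := adj_lin cc sX.1 (bN Nid); rewrite adj_id sX.2 -evZ => h.
  rewrite addrC evD ev1 PE h evB ev1; have -> : cc^* = - cc.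
    by rewrite /cc; apply: complex_ext; rewrite ?cRe_conj ?cIm_conj /=; ring.
  by rewrite scaleNr addrC -evZ.
have -> : ev g u = ev (1 + P) (ev q u) by rewrite gE evM.
rewrite (rip_adj _ _ (bN (Nev _))) ripC aP.
have -> : ev (1 - P) (ev (1 + P) (ev q u)) = u - ev e u.
  by rewrite -[LHS]/((ev (1 - P) \o (ev (1 + P) \o ev q)) u) -!evM -gE resolvent_l evB ev1.
apply: (le_trans (rip_le _ _)).
have h1 : nrm (u - ev e u) <= 2 * nrm u.
  apply: (le_trans (nrmB_le _ _)); rewrite mulr2n mulrDl mul1r lerD2l.
  apply: (le_trans (he u)); rewrite ler_piMl ?nrm_ge0//.
  by rewrite exprn_ile1// ?rho_ge0// ltW// rho_lt1.
have h2 := hq u; rewrite mul1r in h2.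
have n0 := nrm_ge0 u.
apply: (@le_trans _ _ (2 * nrm u * nrm u)); first by apply: ler_pM => //; exact: nrm_ge0.
by rewrite exprMn expr2 -mulrA ler_wpM2r ?sqr_ge0 ?mulr_ge0//; lra.
Qed.

Lemma ev1P : ev (1 + P) = id + cc *: ev X.
Proof. by rewrite evD ev1 PE evZ. Qed.

Lemma evg : ev g = cc *: (ev X \o ev q) + ev q.
Proof.
rewrite gE evM ev1P; move: (ev q) (ev X) => S S'.
by apply/funext => u; rewrite /= !opE /= addrC.
Qed.

Lemma Re_tau_g : complex.Re (tau (ev g)) = retr tau (ev q).
Proof.
by rewrite evg; exact: Re_tau_imag BX B_q sX sa_q.
Qed.

(** The left side bounds [|c tau(g)^2|] from below, with [c = i s / kap], as [tau q] is the real
    part of [tau g]. On the right, [2 Cf] comes from the conjugate system and [|g|_2 <= 2]; the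
    other two terms come from the remainder [e] and from [d e]. *)
Lemma resolvent_estimate :
  s / kap * ((1 - rho ^+ n) * retr tau p) ^+ 2 <=
    2 * Cf + rho ^+ n * (s / kap + (1 + s) * (n%:R * beta)) + 2 * (n%:R * rho ^+ n * beta).
Proof.
have dP : d P = (cc * (kap^-1)%:C%C) *: pt by rewrite PE tc_dZ dX scalerA.
have id1 := nrm_emb_id tM vN L.
have sg := dsize_g; have [_ _ dg] := sg.
have se := dsize_Tn n; rewrite -eE in se; have [_ _ de] := se.
have pair := resolvent_pair tM vN NM Nx dP resolvent_l resolvent_r.
have g2 : nrm (emb (adj (ev g))) <= 2.
  rewrite (nrm_emb_adj tM vN NM L)//.
  have := nrm_emb_lmul tM vN NM L (ler0n R 2) bounded_g (Nev g) Nid.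
  by rewrite -[ev g \o id]/(ev g) id1 mulr1.
have e2 : nrm (emb (adj (ev e))) <= rho ^+ n.
  by rewrite (nrm_emb_adj tM vN NM L)//; exact: (nrm_emb_bound tM vN NM Nx se).
have h1 : cabs (ip (d g) pt) <= 2 * Cf.
  rewrite tc_pair; apply: (le_trans (fisher g)); rewrite mulrC ler_wpM2r//.
  by rewrite -(nrm_emb_adj tM vN NM L).
have h2 : cabs (ip (d g) (el (emb (adj (ev e))) (emb id))) <=
    rho ^+ n * (s / kap + (1 + s) * (n%:R * beta)).
  apply: (le_trans (ip_cs _ _)); rewrite tc_nrm id1 mulr1 mulrC.
  by apply: ler_pM; rewrite ?nrm_ge0.
have h3 : cabs (ip (d e) (el (emb (adj (ev g))) (emb id))) <=
    2 * (n%:R * rho ^+ n * beta).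
  apply: (le_trans (ip_cs _ _)); rewrite tc_nrm id1 mulr1 mulrC.
  by apply: ler_pM; rewrite ?nrm_ge0.
have h4 : cabs (cc * (kap^-1)%:C%C * tau (ev g) ^+ 2) <=
    2 * Cf + rho ^+ n * (s / kap + (1 + s) * (n%:R * beta)) + 2 * (n%:R * rho ^+ n * beta).
  have -> : cc * (kap^-1)%:C%C * tau (ev g) ^+ 2 = ip (d g) pt
      - ip (d g) (el (emb (adj (ev e))) (emb id)) + ip (d e) (el (emb (adj (ev g))) (emb id)).
    by rewrite pair; ring.
  apply: (le_trans (cabsD _ _)); apply: lerD => //.
  by apply: (le_trans (cabsD _ _)); rewrite cabsN; apply: lerD.
have h5 : cabs (cc * (kap^-1)%:C%C) = s / kap.
  by rewrite cabsM cabs_cc cabs_real gtr0_norm// invr_gt0.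
have h6 z : cabs (z ^+ 2) = cabs z ^+ 2 by rewrite !expr2 cabsM.
apply: le_trans h4; rewrite cabsM h5 h6.
rewrite ler_pM2l ?divr_gt0//.
have tp : 0 <= retr tau p.
  have [] : eff p by apply: projP => //; case: sp.
  by move=> _ p0 _; exact: (retr_ge0 tM vB BM).
have r1 : 0 <= 1 - rho ^+ n by rewrite subr_ge0 exprn_ile1 ?rho_ge0// ltW// rho_lt1.
rewrite ler_pXn2r ?nnegrE ?cabs_ge0 ?mulr_ge0//.
apply: (le_trans retr_q); rewrite -Re_tau_g.
by apply: (le_trans _ (Re_le_cabs _)); exact: ler_norm.
Qed.
End Approximant.
End Shifted.

Lemma no_atom p : ~ minimal_projection B p.
Proof.
move=> minp; have [[Bp pp ap] p0 _] := minp.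
have sp : sa p by split=> //; exact: bB.
have ep : eff p by apply: projP => //; exact: bB.
have tp : 0 < retr tau p.
  have [_ q0 _] := ep.
  rewrite lt_neqAle (retr_ge0 tM vB BM Bp sp q0) andbT eq_sym; apply/negP => /eqP h; apply: p0.
  apply: (tau_faithful tM); first exact: BM.
  by rewrite ap pp; apply: complex_ext => //=; exact: (tau_Im tM vB BM).
(* The scalar for which [(x k - l) p] has trace 0, as [minimal_scalar] requires. *)
pose l := retr tau (x k \o p) / retr tau p.
have Bxl : B (x k - l%:C%C *: id).
  by apply: (vn_B vB) => //; apply: (vn_Z vB); exact: (vn_id vB).
have sxl : sa (x k - l%:C%C *: id) by apply: sa_B => //; apply: sa_Z; exact: sa_id.
have xp : (x k - l%:C%C *: id) \o p = 0.
  apply: (minimal_scalar vM tM vN NM L vB BN abB minp).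
  - exact: cB.
  - split; first exact: (bB (cB Bxl Bp)).
    by rewrite (adj_comp sxl.1 sp.1) sxl.2 ap; exact: abB.
  - by rewrite -[LHS]/((x k - l%:C%C *: id) \o (p \o p)) pp.
  - have -> : (x k - l%:C%C *: id) \o p = (x k \o p) - l%:C%C *: p by [].
    rewrite (retrB tM vB BM) ?(retrZ tM vB BM)//; [|exact: cB|exact: (vn_Z vB)].
    by rewrite /l divfK ?subrr// gt_eqF.
have [kap kap0 kapx] := bounded_pos vN BN Bxl.
pose t := retr tau p / 2.
have t0 : 0 < t by rewrite divr_gt0.
(* Chosen so that [(s / kap) t^2 = 2 Cf + 2], while the right side of the estimate will be at most
   [2 Cf + 1]. *)
pose s := kap * (2 * Cf + 2) / t ^+ 2.
have s0 : 0 < s by rewrite divr_gt0 ?exprn_gt0// mulr_gt0// ltr_wpDl// mulr_ge0.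
pose rho := s ^+ 2 / (1 + s ^+ 2).
pose A := s / kap + (1 + s) * (2 / kap) + 2 * (2 / kap).
have sk0 : 0 < s / kap by rewrite divr_gt0.
have b0 : 0 < 2 / kap by rewrite divr_gt0.
have sb0 : 0 < (1 + s) * (2 / kap) by rewrite mulr_gt0// addr_gt0.
have A0 : 0 < A by rewrite /A; apply: addr_gt0; [exact: addr_gt0|exact: mulr_gt0].
have r0 : 0 <= rho := rho_ge0 s0; have r1 : rho < 1 := rho_lt1 s0.
have A2 : 0 < (A + 2)^-1 by rewrite invr_gt0 addr_gt0.
(* [A] collects the factors of [n rho^n] in the truncation errors, so these are at most
   [A / (A + 2) <= 1]. The summand 2 also gives [rho^n <= 1/2], whence [(1 - rho^n) tau p >= t]. *)
have [n n0 hn] := geometric_small r0 r1 A2.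
pose X : poly := (kap^-1)%:C%C *: (<< fmu k >> - l%:C%C *: 1).
have := resolvent_estimate minp kap0 kapx xp (erefl X) erefl s0 (n := n) erefl erefl erefl erefl erefl.
rewrite -/rho; have hm : rho ^+ n <= n%:R * rho ^+ n.
  by rewrite ler_peMl ?exprn_ge0// ler1n.
have rn0 : 0 <= rho ^+ n by rewrite exprn_ge0.
have hA : (A + 2)^-1 * (A + 2) = 1 by rewrite mulVf// gt_eqF// addr_gt0.
have sk : s / kap * t ^+ 2 = 2 * Cf + 2.
  by rewrite /s; field; rewrite !gt_eqF.
move: hm rn0 hn; move: (rho ^+ n) (n%:R : R) => r m hm rn0 hn.
set lhs := _ * _; set rhs := _ + _ + _ => hle.
have err : rhs <= 2 * Cf + m * r * A.
  rewrite /rhs /A -addrA lerD2l; have : r * (s / kap) <= m * r * (s / kap) by rewrite ler_pM2r.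
  by move: (s / kap) (2 / kap) => u b; lra.
have mA : m * r * A <= 1.
  have h1 : m * r * A <= (A + 2)^-1 * A by rewrite ler_pM2r.
  by have := ltW A2; lra.
have r2 : 2 * r <= 1.
  have h1 : (A + 2)^-1 * A >= 0 by rewrite mulr_ge0// ltW.
  by lra.
have low : s / kap * t ^+ 2 <= lhs.
  have tr : t <= (1 - r) * retr tau p.
    by rewrite /t mulrC ler_pM2r//; lra.
  rewrite /lhs ler_pM2l//; apply: lerXn2r => //; rewrite nnegrE; first exact: ltW.
  exact: le_trans (ltW t0) tr.
have := le_trans (le_trans low hle) err; rewrite sk; move: (m * r * A) mA => y mA.
by rewrite lerD2l => h; have := le_trans h mA; rewrite -[X in _ <= X]mulr1n ler_nat.
Qed.
End Atomless.

(** * Infinite index *)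

Lemma esum_exchange_le (R : realType) (B : choiceType) n (f : B -> 'I_n -> R)
    (w : 'I_n -> R) (h : B -> R) (K D : R) : 0 <= K -> (forall b i, 0 <= f b i) ->
  (forall i, (\esum_(b in [set: B]) (f b i)%:E = (w i)%:E)%E) ->
  (\esum_(b in [set: B]) (h b)%:E = D%:E)%E -> (forall b, \sum_i f b i <= K * h b) ->
  \sum_i w i <= K * D.
Proof.
move=> K0 f0 hw hD hf; rewrite -lee_fin -sumEFin.
rewrite (eq_bigr (fun i => \esum_(b in [set: B]) (f b i)%:E)); last by move=> i _; rewrite hw.
rewrite -esum_sum//; last by move=> b i _ _; rewrite lee_fin.
apply: ge_ereal_sup => _ [X [finX _] <-]; rewrite fsbig_finite//=.
under eq_bigr do rewrite sumEFin.
rewrite sumEFin lee_fin.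
apply: (@le_trans _ _ (K * \sum_(b <- fset_set X) h b)).
  by rewrite mulr_sumr; apply: ler_sum => b _.
rewrite ler_wpM2l// -lee_fin -hD -sumEFin -fsbig_finite//.
by apply: ereal_sup_ubound; exists X.
Qed.

Section InfiniteIndex.
Variables (R : realType) (H : hilbert R) (M N Q : set (H -> H)) (tau : (H -> H) -> R[i]).
Hypothesis tM : tracial_state M tau.
Hypothesis vN : vnalg N.
Hypothesis NM : N `<=` M.
Hypothesis vQ : vnalg Q.
Variable L : l2space N tau.
Variable LQ : l2space Q tau.
Variables (I : choiceType) (x : I -> H -> H).
Hypothesis Nx : forall i, N (x i).
Variable k : I.
Variable E : calculus L x k.

Notation emb := (l2_emb L).
Notation embQ := (l2_emb LQ).
Notation lm := (lmul L).
Notation rm := (rmul L).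
Notation ker := (ker E).
Notation ev := (eval_poly x).
Hypothesis dens : forall T e, N T -> 0 < e -> exists p, nrm (emb T - emb (ev p)) <= e.
Hypothesis Qker : Q `<=` ker.
Hypothesis partition : forall e, 0 < e -> exists n (f : 'I_n -> H -> H),
  [/\ forall i, projection Q (f i), \sum_i f i = id & forall i, retr tau (f i) <= e].
Hypothesis not_ker : ~ ker (x k).
Implicit Types (S T q : H -> H).

Let bN T : N T -> bounded_op T. Proof. exact: vnalg_bounded. Qed.
Let aN T : N T -> N (adj T). Proof. exact: vnalg_adj. Qed.
Let aQ T : Q T -> Q (adj T). Proof. exact: vnalg_adj. Qed.
Let cN S T : N S -> N T -> N (S \o T). Proof. exact: vn_comp. Qed.
Let QN : Q `<=` N. Proof. by move=> T /Qker[]. Qed.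
Let QM : Q `<=` M. Proof. by move=> T /QN/NM. Qed.
Let Qid : Q id. Proof. exact: (vn_id vQ). Qed.

Lemma nrm_embQ q : Q q -> nrm (embQ q) = nrm (emb q).
Proof.
move=> Qq; apply: (@pexpIrn _ 2); rewrite ?nnegrE ?nrm_ge0//.
by rewrite (nrm_emb LQ)// (nrm_emb L)//; exact: QN.
Qed.

Section Isometry.
Variables (B : choiceType) (V : B -> L -> LQ).
Hypothesis Vlin : forall b, linear (V b).
Hypothesis Viso : forall h, (\esum_(b in [set: B]) (sqnorm (V b h))%:E = (sqnorm h)%:E)%E.
Hypothesis Vmod : forall b q h, Q q -> V b (lmul L q h) = lmul LQ q (V b h).

Lemma V_bounded b : bounded_op (V b).
Proof.
apply/bounded_opP; split=> //; exists 1; split=> // u; rewrite mul1r.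
rewrite -(ler_pXn2r (n := 2)) ?nnegrE ?nrm_ge0// !nrm_sqr -!sqnormE -lee_fin -(Viso u).
apply: esum_ge; exists [set b]; first by split.
by rewrite fsbig_set1.
Qed.

(** By [Q]-linearity [V b] is determined by this vector, see [V_pair], and the sum over [b] of the
    [|hv b|^2] is the dimension. *)
Let hv b : L := adj (V b) (embQ id).

Lemma V_pair b q u : Q q -> ip (V b u) (embQ q) = ip (lm (adj q) u) (hv b).
Proof.
move=> Qq; rewrite -(adjP (V_bounded b)) Vmod; last exact: aQ.
rewrite (ip_lmul tM vQ QM); last exact: aQ.
rewrite (adjK (bN (QN Qq))) (lmulE tM vQ QM)//.
Qed.

Variable U : prodh L E -> L.
Hypothesis UP : is_proj U.

(** Pairing with [q] in [Q], dense in [LQ], gives [<W (adj q a, c e), hv b>]. The projection [e] can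
    be moved to [hv b], and [|adj q a|_2 <= ka |q|_2], so that [W_bound] yields the estimate. *)
Lemma V_bound b a c e ka : 0 <= ka -> bounded_by ka a -> N a -> N c -> projection Q e ->
  nrm (V b (W U a (c \o e))) <= ka * nrm (emb (c \o e)) * nrm (rm e (hv b)).
Proof.
move=> ka0 hka Na Nc [Qe ee ae]; have Ne := QN Qe; have Nce := cN Nc Ne.
set v := V b _; set K := _ * _ * _.
have K0 : 0 <= K by rewrite !mulr_ge0 ?nrm_ge0.
have key q : Q q -> rip v (embQ q) <= K * nrm (embQ q).
  move=> Qq; have Nq := QN Qq; apply: (le_trans (ler_norm _)).
  apply: (le_trans (Re_le_cabs _)); rewrite V_pair//.
  have kq := Qker Qq; have kq' := Qker (aQ Qq).
  rewrite (W_lmul tM vN NM Nx UP)//; last by rewrite (adjK (bN Nq)).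
  have -> : c \o e = (c \o e) \o e by rewrite -[RHS]/(c \o (e \o e)) ee.
  rewrite -(W_rmul tM vN NM Nx UP)//; [|exact: Qker|by rewrite ae; exact: Qker].
  rewrite (ip_rmul tM vN NM)// ae; apply: (le_trans (ip_cs _ _)).
  rewrite /K [leRHS]mulrAC ler_wpM2r ?nrm_ge0//.
  apply: (le_trans (W_bound UP _ _)).
  rewrite mulrAC ler_wpM2r ?nrm_ge0//.
  rewrite (nrm_embQ Qq) -(nrm_emb_adj tM vN NM L Nq).
  by apply: (nrm_emb_rmul tM vN NM L) => //; exact: aN.
have dense_key e0 : 0 < e0 -> nrm v ^+ 2 <= K * nrm v + (K + nrm v) * e0.
  move=> e00; have [q Qq hq] := emb_dense v e00.
  have h1 := key _ Qq.
  have h2 : nrm (embQ q) <= nrm v + e0.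
    have := nrmB_triangle (embQ q) v 0; rewrite !subr0 [nrm (embQ q - v)]nrmB => h.
    by apply: (le_trans h); rewrite addrC lerD2l.
  have h3 : rip v (v - embQ q) <= nrm v * e0.
    by apply: (le_trans (rip_le _ _)); rewrite ler_wpM2l ?nrm_ge0.
  have h4 : K * nrm (embQ q) <= K * (nrm v + e0) by rewrite ler_wpM2l.
  by rewrite ripBr -nrm_sqr in h3; lra.
have [->|v0] := eqVneq (nrm v) 0; first exact: K0.
have vp : 0 < nrm v by rewrite lt_neqAle eq_sym v0 nrm_ge0.
rewrite -(ler_pM2r vp) -expr2; apply/ler_addgt0Pr => s s0.
have c0 : 0 < K + nrm v by rewrite ltr_wpDl.
have := dense_key _ (divr_gt0 s0 c0).
by rewrite [(K + nrm v) * _]mulrC divfK// gt_eqF.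
Qed.

(* The vectors [W (a, c f_i)] are orthogonal with sum [W (a, c)]; bound each of
   them by [V_bound] and sum over [b], then over [i]. *)
Lemma W_eq0 (D : R) a c : N a -> N c ->
  (\esum_(b in [set: B]) (sqnorm (hv b))%:E = D%:E)%E -> W U a c = 0.
Proof.
move=> Na Nc hD.
have [ka ka0 hka] := N_bound vN Na; have [kc kc0 hkc] := N_bound vN Nc.
suff h0 : nrm (W U a c) ^+ 2 = 0.
  by apply: nrm_eq0; apply/eqP; rewrite -sqrf_eq0 h0.
apply: (@small_eq0 _ _ (ka ^+ 2 * kc ^+ 2 * D)); first by rewrite sqr_ge0.
move=> e e0; have [n [f [pf sf tf]]] := partition e0.
have pf' i : projection N (f i) by case: (pf i) => Qf ff af; split=> //; exact: QN.
rewrite -(rm_partition tM vN NM (W U a c) pf' sf).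
rewrite -[leRHS]mulrA [D * e]mulrC mulrA.
apply: (@esum_exchange_le _ B _ (fun b i => sqnorm (V b (rm (f i) (W U a c)))) _
  (fun b => sqnorm (hv b))).
- by apply: mulr_ge0; [apply: mulr_ge0; exact: sqr_ge0|exact: ltW].
- by move=> b i; rewrite sqnormE rip_ge0.
- by move=> i; rewrite Viso sqnormE nrm_sqr.
- exact: hD.
move=> b; rewrite sqnormE -nrm_sqr -(rm_partition tM vN NM (hv b) pf' sf) mulr_sumr.
apply: ler_sum => i _; have [Qf ff af] := pf i; have Nf := QN Qf.
rewrite (W_rmul tM vN NM Nx UP)//; [|exact: Qker|by rewrite af; exact: Qker].
rewrite sqnormE -nrm_sqr.
have hb := V_bound b ka0 hka Na Nc (pf i).
have hc : nrm (emb (c \o f i)) ^+ 2 <= kc ^+ 2 * e.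
  have h1 := nrm_emb_lmul tM vN NM L kc0 hkc Nc Nf.
  apply: (@le_trans _ _ ((kc * nrm (emb (f i))) ^+ 2)).
    by apply: lerXn2r => //; rewrite nnegrE ?mulr_ge0 ?nrm_ge0.
  by rewrite exprMn (nrm_emb_proj L (pf' i)) ler_wpM2l ?sqr_ge0.
apply: (@le_trans _ _ ((ka * nrm (emb (c \o f i)) * nrm (rm (f i) (hv b))) ^+ 2)).
  by apply: lerXn2r => //; rewrite nnegrE ?mulr_ge0 ?nrm_ge0.
rewrite !exprMn ler_wpM2r ?sqr_ge0//.
by rewrite -[leRHS]mulrA ler_wpM2l ?sqr_ge0.
Qed.

End Isometry.

Lemma infinite_dim : vn_dim LQ (lmul L) = +oo%E.
Proof.
rewrite /vn_dim; set D := (X in ereal_inf X).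
suff DE d : D d -> d = +oo%E.
  (* This includes the case of an empty set [D], whose infimum is [+oo]. *)
  apply/eqP; rewrite -leye_eq; apply: le_ereal_inf_tmp => d /DE ->.
  by rewrite leey.
move=> [B [V [Vlin Viso Vmod dE]]].
have bV := V_bounded Vlin Viso.
have dE' : d = (\esum_(b in [set: B]) (sqnorm (adj (V b) (embQ id)))%:E)%E.
  rewrite dE; apply: eq_esum => b _; congr (_%:E).
  by rewrite -[LHS]/(rip _ _) (rip_adj _ _ (bV b)) sqnormE.
have d0 : (0 <= d)%E by rewrite dE'; apply: esum_ge0 => b _; rewrite lee_fin sqnormE rip_ge0.
case: d d0 dE' {dE} => // r _ rE; exfalso; apply: not_ker.
have [U UP] := proj_exists vN Nx E.
apply: (ker_of_ortho vN Nx dens UP) => // a c Na Nc.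
by rewrite (W_eq0 Vlin Viso Vmod UP Na Nc (esym rE)) ip0r.
Qed.

End InfiniteIndex.

(** * The main theorem *)

Section Corollary.
Variables (R : realType) (H : hilbert R) (M : set (H -> H)) (tau : (H -> H) -> R[i]).
Variables (I : choiceType) (x : I -> H -> H).
Hypothesis vM : vnalg M.
Hypothesis tM : tracial_state M tau.
Hypothesis Mx : forall i, M (x i).
Hypothesis ax : forall i, adj (x i) = x i.
Hypothesis conj_system : admits_conjugate_system x tau.
Implicit Types (S T u z : H -> H) (G A : set (H -> H)).

Let N := Wstar (range x).
Let rangeM : range x `<=` M. Proof. by move=> _ [i _ <-]. Qed.
Let vN : vnalg N. Proof. exact: Wstar_vnalg vM rangeM. Qed.
Let NM : N `<=` M. Proof. exact: Wstar_min vM rangeM. Qed.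
Let Nx i : N (x i). Proof. by apply: Wstar_sub; exists i. Qed.
Let bN T : N T -> bounded_op T. Proof. exact: vnalg_bounded. Qed.
Let bx i : bounded_op (x i). Proof. exact: bN. Qed.
Let sax G : G `<=` range x -> forall T, G T -> G (adj T).
Proof. by move=> Gx T GT; have [i _ iT] := Gx _ GT; rewrite -iT ax iT. Qed.
Let Gb G : G `<=` range x -> forall T, G T -> bounded_op T.
Proof. by move=> Gx T /Gx[i _ <-]. Qed.

(** Cauchy-Schwarz, with [c = |xi i|]. The conjugate system lives in a model [L'] of its own; the
    norm of a polynomial is the same in [L], being computed by [tau]. *)
Lemma fisher_bound (L : l2space N tau) i : exists2 c, 0 <= c & forall p,
  cabs (eval_tau2 x tau (fdq i p)) <= c * nrm (l2_emb L (eval_poly x p)).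
Proof.
have [L' [xi hxi]] := conj_system; exists (nrm (xi i)); first exact: nrm_ge0.
move=> p; rewrite -hxi; apply: (le_trans (ip_cs _ _)); rewrite mulrC.
rewrite ler_wpM2l ?nrm_ge0//; have Np : N (eval_poly x p) by exact: N_poly.
rewrite le_eqVlt; apply/orP; left; apply/eqP/(@pexpIrn _ 2); rewrite ?nnegrE ?nrm_ge0//.
by rewrite (nrm_emb L')// (nrm_emb L).
Qed.

Lemma poly_dense (L : l2space N tau) T e : N T -> 0 < e ->
  exists p, nrm (l2_emb L T - l2_emb L (eval_poly x p)) <= e.
Proof.
move=> NT e0; have Nr : range x `<=` N by exact: Wstar_sub.
have bT := Wstar_bicomm (Gb (@subset_refl _ _)) (sax (@subset_refl _ _)) NT.
have [S gS hS] := bicommutant_dense vM tM vN NM L Nr (sax (@subset_refl _ _)) NT bT e0.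
suff [p Sp] : exists p, S = eval_poly x p by exists p; rewrite -Sp.
elim: gS => [|S1 S2 [i _ <-] _ [p ->]|a S1 S2 _ [p ->] _ [q ->]].
- by exists 1; rewrite ev1.
- exists (<< fmu i >> * p); rewrite (evM vN Nx) evU.
  by rewrite /eval_word fmuE.
- by exists (a *: p + q); rewrite ev_lin.
Qed.

Section Kernel.
Variable L : l2space N tau.
Variable k : I.
Variable E : calculus L x k.
Notation ker := (ker E).

Lemma Wstar_ker (G : set I) : ~ G k -> Wstar (x @` G) `<=` ker.
Proof.
move=> Gk T GT.
have Gr : x @` G `<=` range x by move=> _ [i _ <-]; exists i.
have Gker : x @` G `<=` ker.
  by move=> _ [i Gi <-]; apply: (ker_var Nx); apply/eqP => ki; apply: Gk; rewrite ki.
apply: (ker_gen vM tM vN NM Nx Gker (sax Gr)); first exact: WstarS GT.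
exact: (Wstar_bicomm (Gb Gr) (sax Gr)) GT.
Qed.

Lemma x_not_ker : ~ ker (x k).
Proof.
by have [c c0 hc] := fisher_bound L k; exact: (not_ker tM vN Nx c0 hc).
Qed.

Definition small_partitions A := forall e, 0 < e -> exists n (f : 'I_n -> H -> H),
  [/\ forall i, projection A (f i), \sum_i f i = id & forall i, retr tau (f i) <= e].

Lemma small_partitionsS A A' : A `<=` A' -> small_partitions A -> small_partitions A'.
Proof.
move=> AA' h e e0; have [n [f [pf sf tf]]] := h e e0; exists n, f; split=> // i.
by have [Af ff af] := pf i; split=> //; exact: AA'.
Qed.

Lemma commute_ker A T : A `<=` ker -> small_partitions A -> N T ->
  (forall S, A S -> T \o S = S \o T) -> ker T.
Proof.
move=> Aker hA NT comT; apply: (ker_of_partition tM vN NM Nx (poly_dense L)) => // d d0.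
have [n [f [pf sf tf]]] := hA _ (exprn_gt0 2 d0).
have pk i : projection ker (f i) by have [Af ff af] := pf i; split=> //; exact: Aker.
by exists n, f, f; split=> // i; split=> //; apply: comT; case: (pf i).
Qed.

Lemma normalizer_ker A : A `<=` ker -> small_partitions A -> normalizer A N `<=` ker.
Proof.
move=> Aker hA u [Nu uu' uu nu].
apply: (ker_of_partition tM vN NM Nx (poly_dense L)) => // d d0.
have [n [f [pf sf tf]]] := hA _ (exprn_gt0 2 d0).
have bu := bN Nu; have bu' := adj_bounded bu.
(* The conjugated partition is in [ker] because [u] normalizes [A]; that [u] itself is in [ker] is
   what is being proved. *)
exists n, f, (fun i => u \o f i \o adj u); split.
- by move=> i; have [Af ff af] := pf i; split=> //; exact: Aker.
- move=> i; have [Af ff af] := pf i; have bf := bN (Aker _ Af).1.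
  split.
  + by apply: Aker; rewrite -nu; exists (f i).
  + apply/funext => v /=; rewrite -[adj u (u _)]/((adj u \o u) _) uu' /=.
    by rewrite -[f i (f i _)]/((f i \o f i) _) ff.
  + have bfu : bounded_op (f i \o adj u) := bounded_comp bf bu'.
    by rewrite -[u \o _ \o _]/(u \o (f i \o adj u)) (adj_comp bu bfu) (adj_comp bf bu') (adjK bu) af.
- by [].
- apply/funext => v; rewrite fun_sumE /=.
  have -> : \sum_i u (f i (adj u v)) = u (\sum_i f i (adj u v)) by rewrite (op_sum bu).
  have := congr1 (@^~ (adj u v)) sf; rewrite fun_sumE => ->.
  by rewrite -[LHS]/((u \o adj u) v) uu.
- by move=> i; split=> //; rewrite -compA uu'.
Qed.

Lemma not_regular A : A `<=` ker -> small_partitions A -> ~ regular_in A N.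
Proof.
move=> Aker hA reg; apply: x_not_ker.
apply: (ker_gen vM tM vN NM Nx (normalizer_ker Aker hA)) => //; last by rewrite reg.
(* [ker_gen] asks for a set closed under adjoints: the adjoint of a normalizing unitary is again
   one. *)
move=> u [Nu uu' uu nu]; have bu := bN Nu; have bA T : A T -> bounded_op T by move=> /Aker[/bN].
split; first exact: (vnalg_adj vN).
- by rewrite (adjK bu).
- by rewrite (adjK bu).
rewrite (adjK bu); apply/seteqP; split=> [_ [T AT <-]|T AT].
  rewrite -nu in AT; have [S AS <-] := AT.
  suff -> : adj u \o (u \o S \o adj u) \o u = S by [].
  apply/funext => v /=; rewrite -[adj u (u v)]/((adj u \o u) v) uu' /=.
  by rewrite -[LHS]/((adj u \o u) (S v)) uu'.
exists (u \o T \o adj u); first by rewrite -nu; exists T.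
apply/funext => v /=; rewrite -[adj u (u v)]/((adj u \o u) v) uu' /=.
by rewrite -[LHS]/((adj u \o u) (T v)) uu'.
Qed.

End Kernel.

(** Being self-adjoint, [x i] lies in its own commutant. Hence elements of its bicommutant commute
    with [x i], so they lie in the commutant, with which the bicommutant commutes. *)
Lemma Wstar1_abelian i : abelian_alg (Wstar [set x i]).
Proof.
move=> S T hS hT.
have b1 U : [set x i] U -> bounded_op U by move=> ->.
have a1 U : [set x i] U -> [set x i] (adj U) by move=> ->; exact: ax.
have [_ cS] := Wstar_bicomm b1 a1 hS; have [bT cT] := Wstar_bicomm b1 a1 hT.
by apply: cS; split=> // _ ->; apply: cT; split=> // _ ->.
Qed.

Lemma Wstar1_diffuse i : diffuse (Wstar [set x i]).
Proof.
have [L _] := conj_system; have [E] := calculus_exists tM vN NM L Nx i.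
have [c c0 hc] := fisher_bound L i.
have sub : [set x i] `<=` N by move=> _ ->.
have vB := Wstar_vnalg vN sub; have BN := Wstar_min vN sub.
have Bx : Wstar [set x i] (x i) by exact: Wstar_sub.
by move=> [p]; apply: (no_atom vM tM vN NM Nx E vB BN (@Wstar1_abelian i) Bx (conj (bx i) (ax i)) c0 hc).
Qed.

Lemma Wstar_small_partitions (J : set I) : J !=set0 -> small_partitions (Wstar (x @` J)).
Proof.
move=> [j Jj]; have sub : [set x j] `<=` M by move=> _ ->.
apply: (@small_partitionsS (Wstar [set x j])).
  by apply: WstarS => _ ->; exists j.
move=> e e0; apply: (diffuse_partition vM tM (Wstar_vnalg vM sub) (Wstar_min vM sub)) => //.
exact: Wstar1_diffuse.
Qed.

Lemma irreducible (J : set I) i j : J i -> J j -> i != j -> irreducible_in (Wstar (x @` J)) N.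
Proof.
move=> Ji Jj ij; set Q := Wstar (x @` J).
have QN : Q `<=` N by apply: WstarS => _ [l _ <-]; exists l.
have Qx l : J l -> Q (x l) by move=> Jl; apply: Wstar_sub; exists l.
have Nid : N id := vn_id vN.
apply/seteqP; split=> [z [[bz cz] Nz]|_ [c _ <-]]; last first.
  have Nc : N (c *: id) by exact: (vn_Z vN).
  split=> //; split=> [|S QS]; first exact: bN.
  by apply/funext => v; rewrite /= !opE /= (opZ (bN (QN _ QS))).
have [L _] := conj_system; have [E] := calculus_exists tM vN NM L Nx j.
have sub : x @` [set i] `<=` x @` J by move=> _ [_ -> <-]; exists i.
have ker_i : Wstar (x @` [set i]) `<=` ker E by apply: Wstar_ker => /= ji; rewrite ji eqxx in ij.
have part : small_partitions (Wstar (x @` [set i])) by apply: Wstar_small_partitions; exists i.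
have Naz : N (adj z) := vnalg_adj vN Nz.
(* [z] commutes with [W^*(x_i)], which lies in the kernel of [d_j] since [i != j], and which has
   small partitions. *)
have kz : ker E z.
  by apply: (commute_ker ker_i part) => // S hS; apply: cz; exact: WstarS hS.
have [c c0 hc] := fisher_bound L j.
have gx := closed_graph_pt E << fmu j >>; rewrite graph_pt_var eqxx in gx.
have lz := ker_lact tM vN NM Nx kz gx; have rz := ker_ract tM vN NM Nx kz gx.
have xJN : x @` J `<=` N by move=> _ [l _ <-].
have vQ := Wstar_vnalg vN xJN.
have [_ caz] := commutant_adj (vnalg_bounded vQ) (vnalg_adj vQ) (conj bz cz).
have kaz : ker E (adj z).
  by apply: (commute_ker ker_i part) => // S hS; apply: caz; exact: WstarS hS.
(* As [z] commutes with [x j], the difference of the left and right actions of [z] on the graph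
   point of [x j] is 0 in its first entry and [z (x) 1 - 1 (x) z] in the second. Acting by [adj z]
   on the left and pairing with [pt] gives [tau (adj z \o z) = |tau z|^2], that is
   [|z - tau z|_2 = 0]. *)
have h0 := closed_graph_fisher tM vN c0 hc (ker_lact tM vN NM Nx kaz (closed_graph_lin vN Nx (-1) rz lz)).
have az_id : tau (adj z \o id) = (tau z)^*.
  rewrite -(ip_emb L Nid Nz) ip_conj.
  by rewrite (ip_emb L Nz Nid) adj_id.
have eq0 : tau (adj z \o z) = (tau z)^* * tau z.
  apply/subr0_eq/cabs_eq0/eqP; rewrite eq_le cabs_ge0 andbT; move: h0; rewrite /=.
  rewrite (rmulE tM vN NM L Nz (Nx j)) (lmulE tM vN NM L Nz (Nx j)).
  rewrite (cz (x j) (Qx j Jj)) [(-1) *: l2_emb L _]scaleN1r addNr.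
  rewrite (op0 (lmul_bounded tM vN NM L Naz)) nrm0 mulr0.
  rewrite tc_tl_lin /pt tc_tr_el !tc_tl_el.
  rewrite (lmulE tM vN NM L Nz Nid) (rmulE tM vN NM L Nz Nid).
  rewrite (lmulE tM vN NM L Naz Nid) (lmulE tM vN NM L Naz (vn_comp vN Nz Nid)).
  have Nzz : N (adj z \o z) := vn_comp vN Naz Nz.
  rewrite ipDl ipZl !tc_ip !(ip_emb L)// adj_id.
  rewrite -[id \o (adj z \o id)]/(adj z \o id) az_id -[id \o (id \o z)]/z.
  rewrite -[id \o (adj z \o (z \o id))]/(adj z \o z) -[id \o id]/(id : H -> H).
  by rewrite (tau_unit tM) mulr1 mulN1r addrC.
exists (tau z) => //; apply/esym/subr0_eq.
have Nw : N (z - tau z *: id) by apply: (vn_B vN) => //; exact: (vn_Z vN).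
apply: (tau_faithful tM); first exact: NM.
rewrite -(ip_emb L Nw Nw) (embB L)//; last exact: (vn_Z vN).
rewrite (embZ vN)// !ipBl !ipBr !ipZl !ipZr (ip_emb L Nz Nz) (ip_emb L Nid Nz).
rewrite (ip_emb L Nz Nid) (ip_emb L Nid Nid) adj_id az_id eq0.
by rewrite -[id \o id]/(id : H -> H) (tau_unit tM) -[id \o z]/z; ring.
Qed.

End Corollary.

Theorem corollary3 (R : realType) (H : hilbert R) (M : set (H -> H))
    (tau : (H -> H) -> R[i]) (I : choiceType) (x : I -> H -> H) (J : set I) :
  vnalg M -> tracial_state M tau ->
  (forall i, M (x i)) -> (forall i, adj (x i) = x i) ->
  admits_conjugate_system x tau ->
  J !=set0 -> J `<` [set: I] ->
  [/\ infinite_index (Wstar (x @` J)) (Wstar (range x)) tau /\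
      ~ regular_in (Wstar (x @` J)) (Wstar (range x)),
      forall A : set (H -> H), vnalg A -> A `<=` Wstar (range x) ->
        abelian_alg A -> diffuse (A `&` Wstar (x @` J)) ->
        ~ regular_in A (Wstar (range x)) &
      (exists i j, [/\ J i, J j & i != j]) ->
        irreducible_in (Wstar (x @` J)) (Wstar (range x))].
Proof.
move=> vM tM Mx ax cs J0 [_ nJ].
have [k Jk] : exists k, ~ J k by apply/existsNP => Jall; apply: nJ => k _; exact: Jall.
have rM : range x `<=` M by move=> _ [i _ <-].
have vN := Wstar_vnalg vM rM; have NM := Wstar_min vM rM.
have Nx i : Wstar (range x) (x i) by apply: Wstar_sub; exists i.
have xJN : x @` J `<=` Wstar (range x) by move=> _ [l _ <-].
have vQ := Wstar_vnalg vN xJN; have QN := Wstar_min vN xJN.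
have part := Wstar_small_partitions vM tM Mx ax cs J0.
split; [split|move=> A vA AN abA dA|].
- move=> LQ LN; have [E] := calculus_exists tM vN NM LN Nx k.
  have Qker := Wstar_ker vM tM Mx ax E Jk.
  apply: (infinite_dim tM vN NM vQ LQ Nx _ Qker part).
    exact: (poly_dense vM tM Mx ax).
  exact: (x_not_ker vM tM Mx cs).
- have [L _] := cs; have [E] := calculus_exists tM vN NM L Nx k.
  have Qker := Wstar_ker vM tM Mx ax E Jk.
  exact: (not_regular vM tM Mx ax cs Qker part).
- have [L _] := cs; have [E] := calculus_exists tM vN NM L Nx k.
  have Qker := Wstar_ker vM tM Mx ax E Jk.
  have vAQ := vnalg_setI vA vQ.
  have AQM : A `&` Wstar (x @` J) `<=` M by move=> T [/AN/NM].
  have partAQ := diffuse_partition vM tM vAQ AQM dA.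
  have Aker : A `<=` ker E.
    move=> T AT; apply: (commute_ker vM tM Mx ax (A := A `&` Wstar (x @` J))) => //.
    - by move=> S [_ /Qker].
    - exact: AN.
    - by move=> S [AS _]; exact: abA.
  apply: (not_regular vM tM Mx ax cs Aker).
  by apply: small_partitionsS partAQ => T [].
- move=> [i [j [Ji Jj ij]]]; exact: (irreducible vM tM Mx ax cs Ji Jj ij).
Qed.
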